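(* Let $G=[g_{ij}]\in\mathbb{R}^{N\times N}$ satisfy $g_{ii}=0$ for all $i$ and have spectral radius $\rho(G)<1$, let $\alpha\in\mathbb{R}^N$, let $B=\operatorname{diag}(b_1,\dots,b_N)$ with $b_i\in\{0,1\}$, and suppose the pair $(G,B)$ is controllable. Let $(w_t)_{t\ge1}$ be i.i.d. random vectors in $\mathbb{R}^N$ with $\mathbb{E}[w_t]=0$ and $\|w_t\|\le C_w$ almost surely for all $t\ge1$, for some deterministic constant $C_w>0$. Let $u_t=v_t/t^{\epsilon/2}$, where $v_t\sim\mathcal{N}(0,I)$ and $\epsilon\in[0,\frac{1}{3(N+2)})$ (the initial input $u_0\in\mathbb{R}^N$ being prescribed). Let $(x_t)$ be generated by $$x_{t+1}=\alpha+Gx_t+Bu_t+w_{t+1},\qquad t\ge0,$$ and let $\hat G_{n+1}$ be the estimator of $G$ produced from these data by the sparse recovery algorithm described in the context. Then there exists a subset $\Omega_0$ of the probability space with $\mathbb{P}(\Omega_0)=1$ such that, for every $\omega\in\Omega_0$, $\|\hat G_{n+1}-G\|\to0$ as $n\to\infty$. Moreover, there exists a finite integer threshold $n_0(\omega)$ such that, for all sample sizes $n\ge n_0(\omega)$, the algorithm recovers the exact support of $G$, i.e. $\{(i,j):\hat G_{n+1}(i,j)\neq0\}=\{(i,j):g_{ij}\neq0\}$.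
   Context: The pair $(G,B)$ is controllable if $\operatorname{rank}[B,\ GB,\ \dots,\ G^{N-1}B]=N$. Here $x_t\in\mathbb{R}^N$ is the observed action vector, $G$ and $\alpha$ are unknown, and $B$ and $u_t$ are known. Sparse recovery algorithm (with scalar initialization parameter $\alpha_0$). For $k\ge1$ put $\hat x_{k+1}=x_{k+1}-Bu_k\in\mathbb{R}^N$ and $z_k=(1,x_k^\top)^\top\in\mathbb{R}^{N+1}$. (1) Recursive least squares: start from $P_1=\alpha_0I_{N+1}$ and $\Theta_1=0\in\mathbb{R}^{(N+1)\times N}$, and for $k=1,\dots,n$ set $$P_{k+1}=P_k-\frac{P_kz_kz_k^\top P_k}{1+z_k^\top P_kz_k},\qquad \Theta_{k+1}=\Theta_k+P_{k+1}z_k\bigl(\hat x_{k+1}^\top-z_k^\top\Theta_k\bigr).$$ (2) Let $\lambda_{\max}(n)$ and $\lambda_{\min}(n)$ be the largest and smallest eigenvalues of $\sum_{k=1}^nz_kz_k^\top$, and let $\delta_n=\sqrt{\log\lambda_{\max}(n)/\lambda_{\min}(n)}$, i.e. the square root of the quotient of $\log\lambda_{\max}(n)$ by $\lambda_{\min}(n)$. Let $\widetilde\Theta_{n+1}=\Theta_{n+1}^\top\in\mathbb{R}^{N\times(N+1)}$ and define the shifted pilot estimator entrywise by $$\widehat\Theta_{n+1}(s,l)=\widetilde\Theta_{n+1}(s,l)+\operatorname{sgn}\bigl(\widetilde\Theta_{n+1}(s,l)\bigr)\,\delta_n,$$ where $\operatorname{sgn}$ is the sign function. (3) Choose a positive sequence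 $(\lambda_n)_{n\ge1}$ satisfying $\lambda_n^2=\lambda_{\max}(n)\sqrt{\log(\lambda_{\max}(n))\,\lambda_{\min}(n)}$. (4) Let $\Gamma_{n+1}$ be the minimizer over $\Gamma\in\mathbb{R}^{N\times(N+1)}$ of the convex function $$J_{n+1}(\Gamma)=\sum_{k=1}^n\|\hat x_{k+1}-\Gamma z_k\|^2+\lambda_n\sum_{s=1}^N\sum_{l=1}^{N+1}\frac{|\Gamma(s,l)|}{|\widehat\Theta_{n+1}(s,l)|}.$$ (5) Return $\Gamma_{n+1}=[\hat\alpha_{n+1},\hat G_{n+1}]$, where $\hat\alpha_{n+1}\in\mathbb{R}^N$ is the first column and $\hat G_{n+1}\in\mathbb{R}^{N\times N}$ consists of the remaining columns. Under the stated conditions the matrix $\sum_{k=1}^nz_kz_k^\top$ becomes nonsingular after a finite random time almost surely, so $\lambda_{\min}(n)>0$ for all sufficiently large $n$, and for such $n$ step (4) is a well-defined convex optimization problem whose solution gives the estimator.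
   Formalization: The vectors v_t and w_t (t≥1) are assumed mutually independent over time and of each other (the claim fails if, e.g., all v_t coincide); α_0>0; the equation for λ_n is imposed only where its right-hand side is positive; a zero pilot entry forces Γ(s,l)=0. *)

(* Defs.v *)
From mathcomp Require Import all_boot all_order all_algebra.
From mathcomp Require Import complex.
From mathcomp Require Import all_classical all_reals all_analysis.

Set Implicit Arguments.
Unset Strict Implicit.
Unset Printing Implicit Defensive.

Import Order.TTheory GRing.Theory Num.Theory numFieldNormedType.Exports.

Local Open Scope classical_set_scope.
Local Open Scope ring_scope.

Section MatrixNotions.
Context {R : realType}.

(* Frobenius norm; on column vectors it is the Euclidean norm. *)
Definition fnorm m n (A : 'M[R]_(m, n)) : R :=
  Num.sqrt (\sum_i \sum_j A i j ^+ 2).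

(* The eigenvalues are complex; the set is finite, so its sup is a maximum
   (and sup set0 = 0 when N = 0). *)
Definition spectral_radius N (G : 'M[R]_N) : R :=
  sup [set r | exists2 l : R[i],
    eigenvalue (map_mx (real_complex R) G) l & r = Normc.normc l].

Definition controllable N (G B : 'M[R]_N) : Prop :=
  \rank (\mxrow_(k < N) (G ^+ k *m B)) = N.

(* Used for symmetric matrices, whose eigenvalues are all real. *)
Definition lambda_max N (S : 'M[R]_N) : R := sup [set l | eigenvalue S l].
Definition lambda_min N (S : 'M[R]_N) : R := inf [set l | eigenvalue S l].

Definition mxsupport m n (A : 'M[R]_(m, n)) : set ('I_m * 'I_n) :=
  [set ij | A ij.1 ij.2 != 0].

End MatrixNotions.

Section RandomVectors.
Context {d : measure_display} {T : measurableType d} {R : realType}.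
Variable P : probability T R.

Definition borel N : set (set 'cV[R]_N) := <<s @open 'cV[R]_N >>.
Arguments borel N : clear implicits.

Definition random_vector N (X : T -> 'cV[R]_N) : Prop :=
  forall A, borel N A -> measurable (X @^-1` A).

Definition identically_distributed N (X Y : T -> 'cV[R]_N) : Prop :=
  forall A, borel N A -> P (X @^-1` A) = P (Y @^-1` A).

Definition mutually_independent (I : eqType) N (X : I -> T -> 'cV[R]_N) : Prop :=
  forall (s : seq I) (A : I -> set 'cV[R]_N), uniq s ->
    (forall i, borel N (A i)) ->
    P (\bigcap_(i in [set` s]) (X i @^-1` A i)) =
    (\prod_(i <- s) P (X i @^-1` A i))%E.

(* N(0, I): the law is the product of N standard normal laws on the line. *)
Definition standard_gaussian N (X : T -> 'cV[R]_N) : Prop :=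
  forall A : 'I_N -> set R, (forall i, measurable (A i)) ->
    P [set omega | forall i, A i (X omega i 0)] =
    (\prod_i normal_prob 0 1 (A i))%E.

End RandomVectors.

Arguments borel {R} N.

(* Everything below is about one trajectory: x and u are the state and input
   sequences, and the sample of size n consists of x_1, ..., x_(n+1) and
   u_1, ..., u_n. *)
Section SparseRecovery.
Context {R : realType} {N : nat}.
Variables (alpha0 : R) (B : 'M[R]_N) (x u : nat -> 'cV[R]_N).

Definition regressor (k : nat) : 'cV[R]_(1 + N) := col_mx 1%:M (x k).

(* obs k is \hat x_(k+1). *)
Definition obs (k : nat) : 'cV[R]_N := x k.+1 - B *m u k.

(* rls_P n is P_(n+1) and rls_Theta n is Theta_(n+1): the argument counts the
   updates performed. *)
Fixpoint rls_P (n : nat) : 'M[R]_(1 + N) :=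
  if n is k.+1 then
    let z := regressor n in
    rls_P k - (1 + (z^T *m rls_P k *m z) 0 0)^-1 *:
      (rls_P k *m z *m z^T *m rls_P k)
  else alpha0%:M.

Fixpoint rls_Theta (n : nat) : 'M[R]_(1 + N, N) :=
  if n is k.+1 then
    let z := regressor n in
    rls_Theta k + rls_P n *m z *m ((obs n)^T - z^T *m rls_Theta k)
  else 0.

Definition gram (n : nat) : 'M[R]_(1 + N) :=
  \sum_(1 <= k < n.+1) regressor k *m (regressor k)^T.

Definition lmax (n : nat) : R := lambda_max (gram n).
Definition lmin (n : nat) : R := lambda_min (gram n).

Definition delta (n : nat) : R := Num.sqrt (ln (lmax n) / lmin n).

(* pilot n is \hat Theta_(n+1). *)
Definition pilot (n : nat) : 'M[R]_(N, 1 + N) :=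
  \matrix_(s, l) ((rls_Theta n)^T s l + Num.sg ((rls_Theta n)^T s l) * delta n).

(* For small n the Gram matrix is singular and the right-hand side vanishes, so
   no positive number satisfies the equation; it is then not imposed. *)
Definition admissible_penalty (lam : nat -> R) : Prop :=
  forall n, (0 < n)%N ->
    0 < lam n /\
    (let r := lmax n * Num.sqrt (ln (lmax n) * lmin n) in
     0 < r -> lam n ^+ 2 = r).

(* J_(n+1). The quotients are taken in the extended reals, where a / 0 = +oo
   for a > 0 and 0 / 0 = 0: a zero entry of the pilot estimator forces the
   corresponding entry of Gamma to vanish. *)
Definition objective (lam : nat -> R) (n : nat) (Gamma : 'M[R]_(N, 1 + N)) :
    \bar R :=
  ((\sum_(1 <= k < n.+1) fnorm (obs k - Gamma *m regressor k) ^+ 2)%:E +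
   (lam n)%:E * \sum_s \sum_l (`|Gamma s l|%:E / `|pilot n s l|%:E))%E.

Definition is_objective_minimizer (lam : nat -> R) (n : nat)
    (Gamma : 'M[R]_(N, 1 + N)) : Prop :=
  forall Gamma', (objective lam n Gamma <= objective lam n Gamma')%E.

(* Gamma n.+1 is the estimator computed from the sample of size n. *)
Definition sparse_recovery_output (lam : nat -> R)
    (Gamma : nat -> 'M[R]_(N, 1 + N)) : Prop :=
  forall n, (0 < n)%N -> 0 < lmin n -> is_objective_minimizer lam n (Gamma n.+1).

End SparseRecovery.

Definition G_part {R : realType} {N : nat} (Gamma : 'M[R]_(N, 1 + N)) : 'M[R]_N :=
  rsubmx Gamma.

(* Main.v *)
Require Import Defs.
From mathcomp Require Import all_boot all_order all_algebra.
From mathcomp Require Import complex.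
From mathcomp Require Import all_classical all_reals all_analysis.
From mathcomp Require Import measurable_realfun.
From mathcomp Require Import ring lra zify.

Import Order.TTheory GRing.Theory Num.Theory numFieldNormedType.Exports.

Local Open Scope classical_set_scope.
Local Open Scope ring_scope.

Set Implicit Arguments.
Unset Strict Implicit.
Unset Printing Implicit Defensive.

(** The estimator works because a few growth rates are in the right order. Put
    [h = n ^ (1/72)] (see [root72]).

    _Excitation_. The largest eigenvalue of the Gram matrix has order [n = h ^ 72],
    because the system is stable. For the smallest one, combine [N + 1] consecutive
    states with the coefficients of the characteristic polynomial of [G]: by the
    Cayley-Hamilton theorem the result is a moving average of the last [N] inputs and
    noise vectors ([filtered_state]). Controllability makes it respond to the inputs
    in every direction, and [det (1 - G) != 0] takes care of the constant regressor
    ([excitation_coercive]). In the sum of its squares the noise can only help, the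
    inputs contribute [sum_k k ^ (- eps)], which is at least of order
    [n ^ (8/9) = h ^ 64] since [eps < 1/9], and the cross terms are sums of orthogonal
    random variables ([excitation_bound]).

    _Fluctuations_. The sum of [n] orthogonal variables with bounded variances is almost
    surely of order at most [n ^ (3/4 + 1/72) = h ^ 55] ([orthogonal_sum_bound]): its
    variance is summable along the squares with suitable weights, and little happens
    between two squares. The variables at hand are orthogonal because in each product
    the factor that comes last in time is centered and independent of the others
    ([mean_mul_others]). The correlation of the noise with the regressors is of this
    kind once the state is replaced by the trajectory issued from [0]; a Lyapunov
    function ([lyapunov]) shows that the difference is square summable, so that the
    replacement costs no more than the square root of [n] ([correlation_transfer]).

    _Estimation_. The rest is deterministic ([pathwise_consistency]). The least squares
    error is of order at most [h ^ (55 - 64) = h ^- 9] ([rls_error_rate]), and so is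
    [delta n]; hence the pilot estimator stays away from [0] on the support of the
    parameter and is of order at most [h ^- 9] off it. The penalty parameter lies
    between the orders [h ^ 52] and [h ^ 55] ([penalty_ge], [penalty_le]). Comparing the
    minimizer with the true parameter, whose penalty is of order at most [h ^ 55],
    shows that the error tends to [0] ([lasso_error_bound]); so the entries on the
    support end up nonzero. At a nonzero entry off the support the slope of the
    penalty, of order at least [h ^ (52 + 9) = h ^ 61], would be balanced by the
    gradient of the quadratic part ([lasso_entry_stationary]), which is of order at
    most [h ^ 59]: such entries vanish for large [n]. *)

(** * Sums of squares and quadratic forms *)

Section QuadraticForms.
Context {R : realType}.

Lemma sum_cauchy_schwarz (I : Type) (r : seq I) (p : pred I) (a b : I -> R) :
  (\sum_(i <- r | p i) a i * b i) ^+ 2 <=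
  (\sum_(i <- r | p i) a i ^+ 2) * (\sum_(i <- r | p i) b i ^+ 2).
Proof.
have : 0 <= \sum_(i <- r | p i) \sum_(j <- r | p j) (a i * b j - a j * b i) ^+ 2.
  by apply: sumr_ge0 => i _; apply: sumr_ge0 => j _; exact: sqr_ge0.
set A := \sum_(i <- r | p i) a i ^+ 2; set B := \sum_(i <- r | p i) b i ^+ 2.
set C := \sum_(i <- r | p i) a i * b i.
suff -> : \sum_(i <- r | p i) \sum_(j <- r | p j) (a i * b j - a j * b i) ^+ 2
   = A * B + A * B - (C * C + C * C).
  by rewrite expr2; lra.
transitivity (\sum_(i <- r | p i) (a i ^+ 2 * B + b i ^+ 2 * A
                                   - (a i * b i * C + a i * b i * C))).
  apply: eq_bigr => i _; rewrite /A /B /C !mulr_sumr -!big_split -sumrB /=.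
  by apply: eq_bigr => j _; ring.
by rewrite sumrB !big_split /= -!mulr_suml -/A -/B -/C; ring.
Qed.

(** The square of [fnorm]: without square roots all estimates are polynomial. *)
Definition sqn m n (A : 'M[R]_(m, n)) : R := \sum_i \sum_j A i j ^+ 2.

Lemma sqn_ge0 m n (A : 'M[R]_(m, n)) : 0 <= sqn A.
Proof. by apply: sumr_ge0 => i _; apply: sumr_ge0 => j _; exact: sqr_ge0. Qed.

Lemma fnormE m n (A : 'M[R]_(m, n)) : fnorm A = Num.sqrt (sqn A).
Proof. by []. Qed.

Lemma fnorm_sqr m n (A : 'M[R]_(m, n)) : fnorm A ^+ 2 = sqn A.
Proof. by rewrite fnormE sqr_sqrtr // sqn_ge0. Qed.

Lemma sqr_entry_le m n (A : 'M[R]_(m, n)) i j : A i j ^+ 2 <= sqn A.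
Proof.
rewrite /sqn (bigD1 i) //= (bigD1 j) //= -addrA lerDl addr_ge0 //.
  by apply: sumr_ge0 => k _; exact: sqr_ge0.
by apply: sumr_ge0 => k _; apply: sumr_ge0 => l _; exact: sqr_ge0.
Qed.

Lemma sqn0 m n : sqn (0 : 'M[R]_(m, n)) = 0.
Proof. by rewrite /sqn big1 // => i _; rewrite big1 // => j _; rewrite mxE expr0n. Qed.

Lemma sqn_eq0 m n (A : 'M[R]_(m, n)) : sqn A = 0 -> A = 0.
Proof.
move=> h; apply/matrixP => i j; rewrite mxE; apply/eqP.
by rewrite -sqrf_eq0 eq_le sqr_ge0 -h sqr_entry_le.
Qed.

Lemma sqnT m n (A : 'M[R]_(m, n)) : sqn A^T = sqn A.
Proof.
rewrite /sqn exchange_big; apply: eq_bigr => i _.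
by apply: eq_bigr => j _; rewrite mxE.
Qed.

Lemma sqnZ m n c (A : 'M[R]_(m, n)) : sqn (c *: A) = c ^+ 2 * sqn A.
Proof.
rewrite /sqn mulr_sumr; apply: eq_bigr => i _; rewrite mulr_sumr.
by apply: eq_bigr => j _; rewrite mxE exprMn.
Qed.

Lemma sqnD m n (A B : 'M[R]_(m, n)) : sqn (A + B) <= 2 * sqn A + 2 * sqn B.
Proof.
rewrite /sqn !mulr_sumr -big_split; apply: ler_sum => i _ /=.
rewrite !mulr_sumr -big_split; apply: ler_sum => j _ /=; rewrite mxE.
have := sqr_ge0 (A i j - B i j); nra.
Qed.

Lemma sqnM m n p (A : 'M[R]_(m, n)) (B : 'M[R]_(n, p)) :
  sqn (A *m B) <= sqn A * sqn B.
Proof.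
rewrite {1}/sqn /sqn mulr_suml; apply: ler_sum => i _.
rewrite [X in _ * X]exchange_big /= mulr_sumr; apply: ler_sum => j _.
by rewrite mxE; exact: sum_cauchy_schwarz.
Qed.

Lemma sqn_rowE n (q : 'rV[R]_n) : sqn q = \sum_i q 0 i ^+ 2.
Proof. by rewrite /sqn big_ord1. Qed.

Lemma sqn_row_le m n (A : 'M[R]_(m, n)) s : sqn (row s A) <= sqn A.
Proof.
rewrite sqn_rowE /sqn [leRHS](bigD1 s) //=.
under eq_bigr do rewrite mxE.
by rewrite lerDl sumr_ge0 // => i _; apply: sumr_ge0 => j _; exact: sqr_ge0.
Qed.

Lemma sqn_rowsE m n (A : 'M[R]_(m, n)) : sqn A = \sum_s sqn (row s A).
Proof.
apply: eq_bigr => s _; rewrite sqn_rowE.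
by apply: eq_bigr => l _; rewrite mxE.
Qed.

Lemma sqn_colE n (x : 'cV[R]_n) : sqn x = \sum_i x i 0 ^+ 2.
Proof. by rewrite /sqn; apply: eq_bigr => i _; rewrite big_ord1. Qed.

Lemma sqn_scal (A : 'M[R]_1) : sqn A = A 0 0 ^+ 2.
Proof. by rewrite /sqn !big_ord1. Qed.

Lemma sqn_mulT n (q : 'rV[R]_n) : (q *m q^T) 0 0 = sqn q.
Proof. by rewrite sqn_rowE mxE; apply: eq_bigr => i _; rewrite mxE expr2. Qed.

(** Vectors are rows, as in the eigenvector equation of [eigenvalue]. *)
Definition qform n (K : 'M[R]_n) (q : 'rV[R]_n) : R := (q *m K *m q^T) 0 0.

Definition psd n (K : 'M[R]_n) := K^T = K /\ forall q, 0 <= qform K q.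

Lemma qformD n (K L : 'M[R]_n) q : qform (K + L) q = qform K q + qform L q.
Proof. by rewrite /qform mulmxDr mulmxDl mxE. Qed.

Lemma qformB n (K L : 'M[R]_n) q : qform (K - L) q = qform K q - qform L q.
Proof. by rewrite /qform mulmxBr mulmxBl !mxE. Qed.

Lemma qform_scalar n (m : R) (q : 'rV[R]_n) : qform m%:M q = m * sqn q.
Proof. by rewrite /qform mul_mx_scalar -scalemxAl mxE sqn_mulT. Qed.

Lemma qform_sum n (I : Type) (r : seq I) (p : pred I) (F : I -> 'M[R]_n) q :
  qform (\sum_(i <- r | p i) F i) q = \sum_(i <- r | p i) qform (F i) q.
Proof. by rewrite /qform mulmx_sumr mulmx_suml summxE. Qed.

Lemma qform_outer n p (z : 'M[R]_(n, p)) q : qform (z *m z^T) q = sqn (q *m z).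
Proof.
rewrite /qform mulmxA -mulmxA -trmx_mul mxE sqn_rowE.
by apply: eq_bigr => i _; rewrite !mxE expr2.
Qed.

Lemma bilin_sym n (K : 'M[R]_n) (q r : 'rV[R]_n) : K^T = K ->
  (r *m K *m q^T) 0 0 = (q *m K *m r^T) 0 0.
Proof.
move=> Ks; have -> : r *m K *m q^T = (q *m K *m r^T)^T.
  by rewrite !trmx_mul trmxK Ks mulmxA.
by rewrite mxE.
Qed.

Lemma qform_comb n (K : 'M[R]_n) (q r : 'rV[R]_n) t : K^T = K ->
  qform K (q + t *: r) = qform K q + 2 * t * (q *m K *m r^T) 0 0 + t ^+ 2 * qform K r.
Proof.
move=> Ks; rewrite /qform linearD linearZ /= !mulmxDl !mulmxDr -!scalemxAl -!scalemxAr.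
move: (bilin_sym q r Ks); rewrite !mxE => ->; ring.
Qed.

Lemma psd_cauchy_schwarz n (K : 'M[R]_n) (q r : 'rV[R]_n) : psd K ->
  (q *m K *m r^T) 0 0 ^+ 2 <= qform K q * qform K r.
Proof.
move=> [Ks K0]; set b := (_ *m _ *m _) 0 0.
(* The discriminant of the nonnegative polynomial [t |-> qform K (q + t r)]. *)
have h t : 0 <= qform K q + 2 * t * b + t ^+ 2 * qform K r by rewrite -qform_comb.
have := K0 r; rewrite le_eqVlt => /orP[/eqP r0 | r_gt0].
  (* [r] is isotropic: the polynomial is affine, hence constant. *)
  rewrite -r0 mulr0; case: (eqVneq b 0) => [->|bn0]; first by rewrite expr0n.
  have := h (- (qform K q + 1) / (2 * b)).
  rewrite -r0 mulr0 addr0.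
  have -> : 2 * (- (qform K q + 1) / (2 * b)) * b = - (qform K q + 1) by field.
  lra.
have := h (- b / qform K r).
have -> : qform K q + 2 * (- b / qform K r) * b + (- b / qform K r) ^+ 2 * qform K r
   = (qform K q * qform K r - b ^+ 2) / qform K r by field; rewrite gt_eqF.
by rewrite pmulr_lge0 ?invr_gt0 // subr_ge0.
Qed.

(** A positive semidefinite form bounds the square of its own matrix: with
    [r := q K] in the Cauchy-Schwarz inequality, [|q K|^4 <= (q K q^T) (r K r^T)].
    When [K] is invertible this controls [q] itself. *)
Lemma psd_unit_coercive n (K : 'M[R]_n) : psd K -> K \in unitmx ->
  exists2 c, 0 < c & forall q, c * sqn q <= qform K q.
Proof.
move=> psdK Ku.
set a := sqn K + 1; set b := sqn (invmx K) + 1.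
have a_gt0 : 0 < a by rewrite ltr_wpDl ?sqn_ge0.
have b_gt0 : 0 < b by rewrite ltr_wpDl ?sqn_ge0.
exists (b * a)^-1; first by rewrite invr_gt0 mulr_gt0.
move=> q; rewrite mulrC ler_pdivrMr ?mulr_gt0 //.
have K0 := psdK.2 q.
have h1 : sqn (q *m K) ^+ 2 <= qform K q * (sqn (q *m K) * a).
  have := psd_cauchy_schwarz q (q *m K) psdK; rewrite sqn_mulT => /le_trans; apply.
  rewrite ler_wpM2l //.
  have : qform K (q *m K) ^+ 2 <= (sqn (q *m K) * a) ^+ 2.
    rewrite -sqn_scal; apply: (le_trans (sqnM _ _)); rewrite sqnT.
    apply: (le_trans (ler_wpM2r (sqn_ge0 _) (sqnM _ _))).
    have := sqn_ge0 (q *m K); have := sqn_ge0 K; rewrite /a; nra.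
  rewrite ler_sqr ?nnegrE ?psdK.2 //.
  by rewrite mulr_ge0 ?sqn_ge0 // ltW.
have h2 : sqn (q *m K) <= qform K q * a.
  have := sqn_ge0 (q *m K); rewrite le_eqVlt => /orP[/eqP <-|s0].
    by rewrite mulr_ge0 // ltW.
  by move: h1; rewrite mulrCA expr2 ler_pM2l.
have h3 : sqn q <= sqn (q *m K) * sqn (invmx K).
  by rewrite -{1}(mulmxK Ku q) sqnM.
apply: (le_trans h3); rewrite [b * a]mulrC mulrA.
apply: ler_pM; rewrite ?sqn_ge0 //.
by rewrite /b lerDl.
Qed.

End QuadraticForms.

(** * Extreme eigenvalues of symmetric matrices *)

Section Eigenvalues.
Context {R : realType}.

Lemma qform_le_sqn n (S : 'M[R]_n) q : qform S q <= (sqn S + 1) * sqn q.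
Proof.
have h : qform S q ^+ 2 <= sqn S * sqn q ^+ 2.
  rewrite -sqn_scal; apply: (le_trans (sqnM _ _)); rewrite sqnT.
  apply: (le_trans (ler_wpM2r (sqn_ge0 _) (sqnM _ _))).
  by rewrite expr2 mulrA [sqn S * _]mulrC.
have q0 := sqn_ge0 q; have S0 := sqn_ge0 S.
rewrite leNgt; apply/negP => lt.
suff : ((sqn S + 1) * sqn q) ^+ 2 < qform S q ^+ 2.
  apply/negP; rewrite -leNgt (le_trans h) // exprMn ler_wpM2r ?sqr_ge0 //; nra.
by rewrite ltr_sqr ?nnegrE // ?(le_trans _ (ltW lt)) // mulr_ge0 // ltW // ltr_wpDl.
Qed.

Lemma eigenvalue_le n (S : 'M[R]_n) m l :
  (forall q, qform S q <= m * sqn q) -> eigenvalue S l -> l <= m.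
Proof.
move=> h /eigenvalueP[v vS v0]; have := h v.
rewrite /qform vS -scalemxAl mxE sqn_mulT ler_pM2r //.
by rewrite lt_neqAle sqn_ge0 andbT eq_sym; apply: contra v0 => /eqP/sqn_eq0 ->.
Qed.

Lemma eigenvalue_ge n (S : 'M[R]_n) m l :
  (forall q, m * sqn q <= qform S q) -> eigenvalue S l -> m <= l.
Proof.
move=> h /eigenvalueP[v vS v0]; have := h v.
rewrite /qform vS -scalemxAl mxE sqn_mulT ler_pM2r //.
by rewrite lt_neqAle sqn_ge0 andbT eq_sym; apply: contra v0 => /eqP/sqn_eq0 ->.
Qed.

(** The supremum [m] of the Rayleigh quotient is an eigenvalue: were [m I - S]
    invertible, it would be coercive and [m] could be lowered. *)
Lemma rayleigh_eigenvalue n (S : 'M[R]_n.+1) : S^T = S ->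
  exists2 m, eigenvalue S m & forall q, qform S q <= m * sqn q.
Proof.
move=> Ssym.
pose E := [set r | exists2 q : 'rV[R]_n.+1, sqn q = 1 & r = qform S q].
pose e : 'rV[R]_n.+1 := delta_mx 0 0.
have se : sqn e = 1.
  rewrite sqn_rowE (bigD1 0) //= big1 ?addr0; first by rewrite mxE !eqxx expr1n.
  by move=> i /negbTE i0; rewrite mxE i0 andbF expr0n.
have E0 : E !=set0 by exists (qform S e); exists e.
have Eub : has_ubound E.
  exists (sqn S + 1) => _ [q q1 ->].
  by rewrite (le_trans (qform_le_sqn _ _)) // q1 mulr1.
set m := sup E.
have hm q : qform S q <= m * sqn q.
  have := sqn_ge0 q; rewrite le_eqVlt => /orP[/eqP/esym q0|q_gt0].
    by rewrite (sqn_eq0 q0) /qform !mul0mx mxE sqn0 mulr0.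
  pose t := (Num.sqrt (sqn q))^-1.
  have t2 : t ^+ 2 = (sqn q)^-1 by rewrite exprVn sqr_sqrtr // ltW.
  have : qform S (t *: q) <= m.
    apply: ub_le_sup => //; exists (t *: q) => //.
    by rewrite sqnZ t2 mulVf // gt_eqF.
  have -> : qform S (t *: q) = t ^+ 2 * qform S q.
    by rewrite /qform linearZ /= -!scalemxAl -scalemxAr !mxE; ring.
  by rewrite t2 mulrC ler_pdivrMr.
exists m => //.
apply: contrapT => /negP; rewrite eigenvalue_root_char -[_ (char_poly _) _]/(_ == 0) => nroot.
have Mpsd : psd (m%:M - S).
  split; first by rewrite linearB /= tr_scalar_mx Ssym.
  by move=> q; rewrite qformB qform_scalar subr_ge0.
have Mu : m%:M - S \in unitmx.
  rewrite unitmxE unitfE; apply: contra nroot => /eqP d0.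
  rewrite /char_poly -horner_evalE -det_map_mx /=.
  rewrite -d0; apply/eqP; congr (\det _).
  apply/matrixP => i j; rewrite !mxE /horner_eval /= hornerD hornerN !hornerC.
  by rewrite hornerMn hornerX.
have [c c0 hc] := psd_unit_coercive Mpsd Mu.
have : m <= m - c.
  apply: ge_sup => // _ [q q1 ->].
  by have := hc q; rewrite qformB qform_scalar q1; lra.
by lra.
Qed.

Lemma lambda_max_rayleigh n (S : 'M[R]_n.+1) q : S^T = S ->
  qform S q <= lambda_max S * sqn q.
Proof.
move=> Ssym; have [m meig hm] := rayleigh_eigenvalue Ssym.
apply: (le_trans (hm q)); rewrite ler_wpM2r ?sqn_ge0 //.
apply: ub_le_sup => //; exists m => l; exact: eigenvalue_le.
Qed.

Lemma lambda_max_le n (S : 'M[R]_n.+1) m : S^T = S ->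
  (forall q, qform S q <= m * sqn q) -> lambda_max S <= m.
Proof.
move=> Ssym h; have [l leig _] := rayleigh_eigenvalue Ssym.
by apply: ge_sup; [exists l | move=> k; exact: eigenvalue_le].
Qed.

Lemma lambda_min_ge n (S : 'M[R]_n.+1) m : S^T = S ->
  (forall q, m * sqn q <= qform S q) -> m <= lambda_min S.
Proof.
move=> Ssym h; have [l leig _] := rayleigh_eigenvalue Ssym.
by apply: lb_le_inf; [exists l | move=> k; exact: eigenvalue_ge].
Qed.

Lemma lambda_min_le_max n (S : 'M[R]_n.+1) : psd S -> lambda_min S <= lambda_max S.
Proof.
move=> [Ssym S0]; have [m meig hm] := rayleigh_eigenvalue Ssym.
have h1 : lambda_min S <= m.
  apply: ge_inf => //; exists 0 => l; apply: eigenvalue_ge => q.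
  by rewrite mul0r.
apply: (le_trans h1); apply: ub_le_sup => //; exists m => l; exact: eigenvalue_le.
Qed.

End Eigenvalues.

(** * Recursive least squares and the weighted lasso *)

Section Estimator.
Context {R : realType} {N : nat}.
Variables (alpha0 : R) (B : 'M[R]_N) (x u wn : nat -> 'cV[R]_N).
Variable Th : 'M[R]_(N, 1 + N).
Hypothesis alpha0_gt0 : 0 < alpha0.
Hypothesis obsE : forall k, (0 < k)%N -> obs B x u k = Th *m regressor x k + wn k.

Local Notation z := (regressor x).
Local Notation K := (gram x).

Definition noise_corr (n : nat) : 'M[R]_(N, 1 + N) :=
  \sum_(1 <= k < n.+1) wn k *m (z k)^T.

Lemma gram_psd n : psd (K n).
Proof.
split; first by rewrite /gram linear_sum; apply: eq_bigr => k _ /=; rewrite trmx_mul trmxK.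
move=> q; rewrite /gram qform_sum sumr_ge0 // => k _.
by rewrite qform_outer sqn_ge0.
Qed.

Lemma qform_gram n q : qform (K n) q = \sum_(1 <= k < n.+1) sqn (q *m z k).
Proof. by rewrite /gram qform_sum; apply: eq_bigr => k _; rewrite qform_outer. Qed.

Lemma gram_diag n l : K n l l = \sum_(1 <= k < n.+1) z k l 0 ^+ 2.
Proof.
rewrite /gram summxE; apply: eq_bigr => k _.
by rewrite !mxE big_ord1 !mxE expr2.
Qed.

Lemma qform_gram_le n q :
  qform (K n) q <= (\sum_(1 <= k < n.+1) sqn (z k)) * sqn q.
Proof.
rewrite qform_gram mulr_suml; apply: ler_sum => k _.
by rewrite [leRHS]mulrC sqnM.
Qed.

Lemma gramS n : K n.+1 = K n + z n.+1 *m (z n.+1)^T.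
Proof. by rewrite /gram big_nat_recr. Qed.

Local Notation ridge n := (K n + alpha0^-1%:M).

(** The matrix inversion lemma: each rank-one update of the recursion inverts
    the corresponding rank-one update of the regularized Gram matrix. *)
Lemma rls_P_inverse n : ridge n *m rls_P alpha0 x n = 1%:M.
Proof.
elim: n => [|n IH].
  by rewrite /gram big_geq // add0r /= -scalar_mxM mulVf // gt_eqF.
rewrite gramS /=; set P := rls_P alpha0 x n in IH *; set v := z n.+1.
set s := (1 + _).
have vPv : v^T *m P *m v = (s - 1)%:M.
  by rewrite /s addrAC subrr add0r [LHS]mx11_scalar.
have s0 : s != 0.
  have ridge_sym : (ridge n)^T = ridge n.
    by rewrite linearD /= tr_scalar_mx (gram_psd n).1.
  have e : v = ridge n *m (P *m v) by rewrite mulmxA IH mul1mx.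
  have : 0 <= (v^T *m P *m v) 0 0.
    rewrite -mulmxA {1}e trmx_mul ridge_sym -[X in _ *m X]trmxK.
    rewrite -/(qform _ _) qformD qform_scalar addr_ge0 //.
      exact: (gram_psd n).2.
    by rewrite mulr_ge0 ?sqn_ge0 // invr_ge0 ltW.
  by rewrite vPv mxE eqxx mulr1n => h; rewrite gt_eqF //; lra.
rewrite [K n + _ + _]addrAC mulmxDl !mulmxBr IH -!scalemxAr !mulmxA IH mul1mx.
rewrite -[v *m v^T *m P *m v]mulmxA -[v *m v^T *m (P *m v)]mulmxA (mulmxA v^T) vPv.
rewrite mul_mx_scalar -!scalemxAl scalerA.
set A := v *m v^T *m P.
have -> : A - (s^-1 * (s - 1)) *: A = s^-1 *: A.
  by rewrite -{1}[A]scale1r -scalerBl; congr (_ *: _); field.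
by rewrite subrK.
Qed.

(** The recursion started at [0] computes the ridge regression with parameter
    [alpha0^-1]. *)
Lemma rls_normal_equation n :
  ridge n *m rls_Theta alpha0 B x u n =
  \sum_(1 <= k < n.+1) z k *m (obs B x u k)^T.
Proof.
elim: n => [|n IH]; first by rewrite mulmx0 big_geq.
rewrite big_nat_recr //= -IH.
rewrite mulmxDr !mulmxA -[rls_P _ _ _ - _]/(rls_P alpha0 x n.+1) rls_P_inverse.
rewrite mul1mx mulmxBr gramS [K n + _ + _]addrAC mulmxDl.
by rewrite -addrA; congr (_ + _); rewrite addrC mulmxA subrK.
Qed.

Lemma rls_error_equation n :
  ((rls_Theta alpha0 B x u n)^T - Th) *m ridge n = noise_corr n - alpha0^-1 *: Th.
Proof.
have ridge_sym : (ridge n)^T = ridge n.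
  by rewrite linearD /= tr_scalar_mx (gram_psd n).1.
rewrite mulmxBl -{1}ridge_sym -trmx_mul rls_normal_equation.
rewrite mulmxDr mul_mx_scalar opprD addrA; congr (_ - _).
rewrite linear_sum /gram mulmx_sumr -sumrB /noise_corr.
apply: eq_big_nat => k /andP[k1 _] /=.
by rewrite trmx_mul trmxK obsE // mulmxDl mulmxA addrAC subrr add0r.
Qed.

(** Cauchy-Schwarz turns a lower bound on the form of [S] into one on [q S]. *)
Lemma coercive_solve n (S : 'M[R]_n) (m : R) (q : 'rV_n) : 0 <= m ->
  (forall q, m * sqn q <= qform S q) -> m ^+ 2 * sqn q <= sqn (q *m S).
Proof.
move=> m0 h; have := h q; have := sqn_ge0 q.
have cs : qform S q ^+ 2 <= sqn (q *m S) * sqn q.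
  by rewrite -sqn_scal -(sqnT q) sqnM.
rewrite le_eqVlt => /orP[/eqP <- _|q0 hq]; first by rewrite mulr0 sqn_ge0.
rewrite -(ler_pM2r q0) (le_trans _ cs) //.
have : (m * sqn q) ^+ 2 <= qform S q ^+ 2.
  by rewrite ler_sqr ?nnegrE //; [rewrite mulr_ge0 // ltW | rewrite (le_trans _ hq) // mulr_ge0 // ltW].
by rewrite exprMn [sqn q ^+ 2]expr2 mulrA.
Qed.

Lemma rls_error_bound n m s l : 0 <= m -> (forall q, m * sqn q <= qform (K n) q) ->
  m ^+ 2 * ((rls_Theta alpha0 B x u n)^T s l - Th s l) ^+ 2 <=
  2 * sqn (noise_corr n) + 2 * alpha0^-1 ^+ 2 * sqn Th.
Proof.
move=> m0 h; set E := (rls_Theta alpha0 B x u n)^T - Th.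
have -> : (rls_Theta alpha0 B x u n)^T s l - Th s l = row s E 0 l by rewrite !mxE.
have h' q : m * sqn q <= qform (ridge n) q.
  rewrite qformD qform_scalar (le_trans (h q)) // lerDl mulr_ge0 ?sqn_ge0 //.
  by rewrite invr_ge0 ltW.
apply: le_trans (ler_wpM2l (sqr_ge0 _) (sqr_entry_le (row s E) 0 l)) _.
apply: le_trans (coercive_solve (row s E) m0 h') _.
rewrite -row_mul rls_error_equation.
have -> : 2 * alpha0^-1 ^+ 2 * sqn Th = 2 * sqn (- (alpha0^-1 *: Th)).
  by rewrite -scaleNr sqnZ sqrrN mulrA.
apply: le_trans _ (sqnD _ _).
exact: sqn_row_le.
Qed.

Definition fit n (C : 'M[R]_(N, 1 + N)) : R :=
  \sum_(1 <= k < n.+1) fnorm (obs B x u k - C *m z k) ^+ 2.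

Lemma fitE n D : fit n (Th + D) = \sum_(1 <= k < n.+1) sqn (wn k)
  - 2 * (\sum_s \sum_l D s l * noise_corr n s l) + \sum_s qform (K n) (row s D).
Proof.
have -> : \sum_s \sum_l D s l * noise_corr n s l =
   \sum_(1 <= k < n.+1) \sum_s wn k s 0 * (D *m z k) s 0.
  rewrite [RHS]exchange_big /=; apply: eq_bigr => s _.
  under eq_bigr => l _ do rewrite /noise_corr summxE mulr_sumr.
  rewrite exchange_big /=; apply: eq_bigr => k _.
  rewrite [in RHS]mxE mulr_sumr; apply: eq_bigr => l _.
  by rewrite [(wn k *m _) s l]mxE big_ord1 [(z k)^T _ _]mxE; ring.
have -> : \sum_s qform (K n) (row s D) =
    \sum_(1 <= k < n.+1) \sum_s (D *m z k) s 0 ^+ 2.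
  rewrite [RHS]exchange_big /=; apply: eq_bigr => s _.
  rewrite qform_gram; apply: eq_bigr => k _.
  by rewrite sqn_scal -row_mul mxE.
rewrite mulr_sumr -sumrB -big_split /= /fit; apply: eq_big_nat => k /andP[k1 _].
rewrite fnorm_sqr obsE // mulmxDl opprD addrACA subrr add0r !sqn_colE mulr_sumr -sumrB -big_split.
by apply: eq_bigr => s _; rewrite !mxE /=; ring.
Qed.

Section OneSample.
Variables (lam : nat -> R) (n : nat) (C : 'M[R]_(N, 1 + N)).
Hypothesis lam_gt0 : 0 < lam n.
Local Notation p := (pilot alpha0 B x u n).
Local Notation J := (objective alpha0 B x u lam n).

(** The domain of the objective: elsewhere its value is [+oo]. *)
Definition feasible (D : 'M[R]_(N, 1 + N)) := forall s l, p s l = 0 -> D s l = 0.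

Definition penalty (D : 'M[R]_(N, 1 + N)) : R := \sum_s \sum_l `|D s l| / `|p s l|.

Lemma penalty_term (D : 'M[R]_(N, 1 + N)) s l : (p s l = 0 -> D s l = 0) ->
  (`|D s l|%:E / `|p s l|%:E)%E = (`|D s l| / `|p s l|)%:E.
Proof.
move=> h; case: (eqVneq (p s l) 0) => [p0|pn0].
  by rewrite h // p0 !normr0 mul0e mul0r.
by rewrite inver normr_eq0 (negbTE pn0) EFinM.
Qed.

Lemma objective_feasible D : feasible D -> J D = (fit n D + lam n * penalty D)%:E.
Proof.
move=> Df; rewrite /objective EFinD EFinM; congr (_ + _ * _)%E.
rewrite /penalty -sumEFin; apply: eq_bigr => s _.
by rewrite -sumEFin; apply: eq_bigr => l _; rewrite penalty_term //; exact: Df.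
Qed.

Lemma objective_lty D : (J D < +oo)%E -> feasible D.
Proof.
move=> Jlt s l p0; apply: contrapT => /eqP Dn0.
have t0 s' l' : (0 <= `|D s' l'|%:E / `|p s' l'|%:E)%E.
  rewrite mule_ge0 ?lee_fin //.
  by rewrite inve_ge0 lee_fin.
suff S : (\sum_s \sum_l (`|D s l|%:E / `|p s l|%:E) = +oo)%E.
  by move: Jlt; rewrite /objective S gt0_muley ?lte_fin // addey.
apply/eqP; rewrite -leye_eq (bigD1 s) //= (bigD1 l) //=.
rewrite p0 normr0 inver eqxx gt0_muley ?lte_fin ?normr_gt0 //.
by rewrite addye ?addye // gt_eqF // (lt_le_trans (ltNyr 0)) // sume_ge0 // => i _; rewrite sume_ge0.
Qed.

Hypothesis Cmin : is_objective_minimizer alpha0 B x u lam n C.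
Variables (m om p0 : R).
Hypothesis m_gt0 : 0 < m.
Hypothesis coercive : forall q, m * sqn q <= qform (K n) q.
Hypothesis om_bound : forall s l, `|noise_corr n s l| <= om.
Hypothesis p0_gt0 : 0 < p0.
Hypothesis pilot_large : forall s l, Th s l != 0 -> p0 <= `|p s l|.

Local Notation D := (C - Th).
Local Notation bnd := (2 * om + lam n / p0).
Local Notation dim := ((N * (1 + N))%:R : R).

Lemma feasible_true : feasible Th.
Proof.
move=> s l p_eq0; apply: contrapT => /eqP /pilot_large.
by rewrite p_eq0 normr0 leNgt p0_gt0.
Qed.

Lemma minimizer_feasible : feasible C.
Proof.
apply: objective_lty; apply: (le_lt_trans (Cmin Th)).
by rewrite (objective_feasible feasible_true) ltry.
Qed.

Lemma minimizer_le C' : feasible C' ->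
  fit n C + lam n * penalty C <= fit n C' + lam n * penalty C'.
Proof.
move=> f'; rewrite -lee_fin -!objective_feasible //; exact: minimizer_feasible.
Qed.

Lemma sum_norm_sqr (A : 'M[R]_(N, 1 + N)) :
  (\sum_s \sum_l `|A s l|) ^+ 2 <= dim * sqn A.
Proof.
have := sum_cauchy_schwarz (index_enum _) predT (fun=> 1) (fun i : 'I_N * 'I_(1 + N) => `|A i.1 i.2|).
rewrite -(pair_bigA _ (fun s l => 1 * `|A s l|)) /=.
rewrite -(pair_bigA _ (fun s l => `|A s l| ^+ 2)) /=.
under eq_bigr do under eq_bigr do rewrite mul1r.
move/le_trans; apply; rewrite expr1n sumr_const card_prod !card_ord.
rewrite ler_wpM2l // /sqn ler_sum // => s _; rewrite ler_sum // => l _.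
by rewrite real_normK ?num_real.
Qed.

(** Comparing the minimizer with the true parameter, the penalty can only pull
    through the entries of the true support, whose weights are at most
    [1 / p0]; the quadratic gain is thus dominated by a linear term. *)
Lemma lasso_quadratic_bound :
  \sum_s qform (K n) (row s D) <= bnd ^+ 2 * dim / m.
Proof.
set Q := \sum_s _.
have h1 : Q <= bnd * \sum_s \sum_l `|D s l|.
  have := minimizer_le feasible_true.
  rewrite -{1}[C](subrKC Th) -{3}[Th]addr0 !fitE -/Q.
  have -> : \sum_s \sum_l (0 : 'M[R]_(N, 1 + N)) s l * noise_corr n s l = 0.
    by rewrite big1 // => s _; rewrite big1 // => l _; rewrite mxE mul0r.
  have -> : \sum_s qform (K n) (row s (0 : 'M[R]_(N, 1 + N))) = 0.
    by rewrite big1 // => s _; rewrite linear0 /qform !mul0mx mxE.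
  have lin : \sum_s \sum_l D s l * noise_corr n s l <= om * \sum_s \sum_l `|D s l|.
    rewrite mulr_sumr ler_sum // => s _; rewrite mulr_sumr ler_sum // => l _.
    rewrite (le_trans (ler_norm _)) // normrM mulrC ler_wpM2r //.
  have pen : lam n * penalty Th - lam n * penalty C <= lam n / p0 * \sum_s \sum_l `|D s l|.
    rewrite -mulrBr -mulrA ler_wpM2l ?(ltW lam_gt0) // /penalty -sumrB mulr_sumr.
    apply: ler_sum => s _; rewrite -sumrB mulr_sumr; apply: ler_sum => l _.
    have [t0|tn0] := eqVneq (Th s l) 0.
      rewrite t0 normr0 mul0r sub0r; apply: (@le_trans _ _ 0).
        by rewrite oppr_le0 divr_ge0.
      by rewrite mulr_ge0 // invr_ge0 ltW.
    rewrite -mulrBl [leRHS]mulrC (@le_trans _ _ (`|D s l| / `|p s l|)) //.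
      rewrite ler_wpM2r ?invr_ge0 // !mxE distrC.
      exact: (le_trans _ (lerB_dist _ _)).
    rewrite ler_wpM2l // lef_pV2 ?pilot_large ?posrE //.
    exact: lt_le_trans p0_gt0 (pilot_large tn0).
  move: lin pen; set S := \sum_s \sum_l _; set S1 := \sum_s \sum_l _.
  by rewrite mulrDl; lra.
have Q0 : 0 <= Q by rewrite sumr_ge0 // => s _; exact: (gram_psd n).2.
have h2 : m * sqn D <= Q.
  rewrite sqn_rowsE mulr_sumr; apply: ler_sum => s _; exact: coercive.
have [Qpos|] := ltP 0 Q; last first.
  move=> Qle; apply: (le_trans Qle); rewrite divr_ge0 ?(ltW m_gt0) //.
  by rewrite mulr_ge0 ?sqr_ge0.
have h3 : Q ^+ 2 <= bnd ^+ 2 * (dim * sqn D).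
  have : Q ^+ 2 <= (bnd * \sum_s \sum_l `|D s l|) ^+ 2.
    by rewrite ler_sqr ?nnegrE // (le_trans Q0).
  move/le_trans; apply; rewrite exprMn ler_wpM2l ?sqr_ge0 //; exact: sum_norm_sqr.
rewrite ler_pdivlMr // -(ler_pM2r Qpos) mulrAC -expr2.
apply: (le_trans (ler_wpM2r (ltW m_gt0) h3)).
have d0 : 0 <= bnd ^+ 2 * dim by rewrite mulr_ge0 ?sqr_ge0.
have := ler_wpM2l d0 h2; rewrite [m * _]mulrC !mulrA; exact.
Qed.

Lemma lasso_error_bound : m ^+ 2 * sqn D <= bnd ^+ 2 * dim.
Proof.
rewrite expr2 -mulrA -ler_pdivlMl // [leRHS]mulrC; apply: le_trans lasso_quadratic_bound.
rewrite sqn_rowsE mulr_sumr; apply: ler_sum => s _; exact: coercive.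
Qed.

(** Shrinking an entry outside the true support by a factor [1 - t] gains
    [t] times its penalty and loses a multiple of [t] that is controlled by the
    gradient of the quadratic part; letting [t] tend to [0] leaves the
    stationarity inequality. *)
Lemma lasso_entry_stationary s l Z : Th s l = 0 -> C s l != 0 -> K n l l <= Z ->
  lam n / `|p s l| <= 2 * Num.sqrt (bnd ^+ 2 * dim / m * Z) + 2 * om.
Proof.
move=> Th0 C0 KZ.
set X := (row s D *m K n *m (delta_mx 0 l : 'rV_(1 + N))^T) 0 0.
have Kll : qform (K n) (delta_mx 0 l) = K n l l.
  by rewrite /qform -rowE trmx_delta -colE !mxE.
have Xle : `|X| <= Num.sqrt (bnd ^+ 2 * dim / m * Z).
  rewrite -sqrtr_sqr ler_wsqrtr // (le_trans (psd_cauchy_schwarz _ _ (gram_psd n))) //.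
  rewrite Kll ler_pM ?(gram_psd n).2 //; first by rewrite -Kll (gram_psd n).2.
  apply: le_trans lasso_quadratic_bound.
  rewrite (bigD1 s) //= lerDl sumr_ge0 // => i _; exact: (gram_psd n).2.
set g := C s l in C0 *.
have Dsl : D s l = g by rewrite !mxE Th0 subr0.
have pn0 : p s l != 0 by apply: contra C0 => /eqP /minimizer_feasible; rewrite -/g => ->.
have step t : 0 < t < 1 ->
    lam n * `|g| / `|p s l| <= 2 * `|g| * (`|X| + om) + t * (g ^+ 2 * K n l l).
  move=> /andP[t0 t1].
  (* Compare with the same matrix whose entry [(s, l)] is shrunk. *)
  pose C' := C - (t * g) *: delta_mx s l.
  have C'E s' l' : C' s' l' = C s' l' - t * g * ((s' == s) && (l' == l))%:R.
    by rewrite !mxE.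
  have f' : feasible C'.
    move=> s' l' pz; rewrite C'E (minimizer_feasible pz).
    case: eqP => [es|]; case: eqP => [el|] //=; rewrite ?mulr0 ?subr0 //.
    by move: pn0; rewrite -es -el pz eqxx.
  have := minimizer_le f'.
  have -> : penalty C' = penalty C - t * `|g| / `|p s l|.
    rewrite /penalty (bigD1 s) //= [in RHS](bigD1 s) //= (bigD1 l) //= [in RHS](bigD1 l) //=.
    rewrite C'E !eqxx /= mulr1 -/g.
    have -> : `|g - t * g| = (1 - t) * `|g|.
      by rewrite -{1}[g]mul1r -mulrBl normrM ger0_norm // subr_ge0 ltW.
    have -> : \sum_(i < 1 + N | i != l) `|C' s i| / `|p s i| =
              \sum_(i < 1 + N | i != l) `|C s i| / `|p s i|.
      by apply: eq_bigr => i /negbTE il; rewrite C'E il andbF mulr0 subr0.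
    have -> : \sum_(i < N | i != s) \sum_l0 `|C' i l0| / `|p i l0| =
              \sum_(i < N | i != s) \sum_l0 `|C i l0| / `|p i l0|.
      apply: eq_bigr => i /negbTE il; apply: eq_bigr => j _.
      by rewrite C'E il mulr0 subr0.
    by ring.
  have D'E : C' = Th + (D - (t * g) *: delta_mx s l) by rewrite addrA subrKC.
  rewrite -{1}[C](subrKC Th) D'E !fitE.
  set D' := D - _.
  have -> : \sum_s \sum_l D' s l * noise_corr n s l =
     \sum_s \sum_l D s l * noise_corr n s l - t * g * noise_corr n s l.
    rewrite (bigD1 s) //= [in RHS](bigD1 s) //= (bigD1 l) //= [in RHS](bigD1 l) //=.
    have E s' l' : D' s' l' = D s' l' - t * g * ((s' == s) && (l' == l))%:R.
      by rewrite !mxE.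
    have -> : \sum_(i < 1 + N | i != l) D' s i * noise_corr n s i =
              \sum_(i < 1 + N | i != l) D s i * noise_corr n s i.
      by apply: eq_bigr => i /negbTE il; rewrite E il andbF mulr0 subr0.
    have -> : \sum_(i < N | i != s) \sum_l0 D' i l0 * noise_corr n i l0 =
              \sum_(i < N | i != s) \sum_l0 D i l0 * noise_corr n i l0.
      apply: eq_bigr => i /negbTE il; apply: eq_bigr => j _.
      by rewrite E il mulr0 subr0.
    by rewrite E !eqxx /= mulr1; ring.
  have -> : \sum_s qform (K n) (row s D') =
     \sum_s qform (K n) (row s D) - 2 * (t * g) * X + (t * g) ^+ 2 * K n l l.
    rewrite (bigD1 s) //= [in RHS](bigD1 s) //=.
    have -> : row s D' = row s D + (- (t * g)) *: delta_mx 0 l.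
      apply/rowP => j; rewrite !mxE eqxx /=; ring.
    rewrite qform_comb ?(gram_psd n).1 // Kll -/X.
    have -> : \sum_(i < N | i != s) qform (K n) (row i D') =
              \sum_(i < N | i != s) qform (K n) (row i D).
      apply: eq_bigr => i /negbTE il; congr (qform _ _); apply/rowP => j.
      by rewrite !mxE il mulr0 subr0.
    by ring.
  move=> h.
  have h1 : t * (lam n * `|g| / `|p s l|) <=
      t * (- 2 * g * X + t * (g ^+ 2 * K n l l) + 2 * g * noise_corr n s l).
    have -> : t * (lam n * `|g| / `|p s l|) = lam n * (t * `|g| / `|p s l|) by ring.
    by move: h; rewrite mulrBr; lra.
  move: h1; rewrite ler_pM2l // => h1; apply: (le_trans h1).
  have a1 : - (g * X) <= `|g| * `|X| by rewrite -normrM -normrN ler_norm.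
  have a2 : g * noise_corr n s l <= `|g| * om.
    by rewrite (le_trans (ler_norm _)) // normrM ler_wpM2l.
  by lra.
have g0 : 0 < `|g| by rewrite normr_gt0.
have lim : lam n * `|g| / `|p s l| <= 2 * `|g| * (`|X| + om).
  apply/ler_addgt0Pr => e e0.
  set b := g ^+ 2 * K n l l in step.
  have b0 : 0 <= b by rewrite mulr_ge0 ?sqr_ge0 // -Kll (gram_psd n).2.
  (* Small enough for the quadratic term [t b] to stay below [e]. *)
  pose t := Num.min (1 / 2) (e / (b + 1)).
  have t01 : 0 < t < 1.
    apply/andP; split; last by rewrite gt_min; apply/orP; left; lra.
    by rewrite lt_min divr_gt0 // divr_gt0 // ltr_wpDl.
  apply: (le_trans (step t t01)); rewrite lerD2l.
  have tle : t <= e / (b + 1) by rewrite ge_min lexx orbT.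
  apply: (le_trans (ler_wpM2r b0 tle)).
  rewrite mulrAC ler_pdivrMr ?ltr_wpDl // mulrDr mulr1.
  by rewrite lerDl ltW.
have : lam n / `|p s l| <= 2 * (`|X| + om).
  rewrite -(ler_pM2l g0).
  by have -> : `|g| * (lam n / `|p s l|) = lam n * `|g| / `|p s l|; [ring | lra].
by lra.
Qed.

End OneSample.
End Estimator.

(** * Growth rates of the penalty and of the pilot correction *)

Section Rates.
Context {R : realType}.

Lemma norm_le_sqr (a b : R) : 0 <= b -> a ^+ 2 <= b ^+ 2 -> `|a| <= b.
Proof.
move=> b0; rewrite -[a ^+ 2]real_normK ?num_real // ler_sqr // nnegrE.
Qed.

Lemma le_sqr (a b : R) : 0 <= b -> a ^+ 2 <= b ^+ 2 -> a <= b.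
Proof. by move=> b0 /(norm_le_sqr b0); apply: le_trans; exact: ler_norm. Qed.

Lemma sqrt_le_scaled (a b y : R) : 0 <= y -> a <= b * y ^+ 2 -> 0 <= b ->
  Num.sqrt a <= Num.sqrt b * y.
Proof.
move=> y0 ab b0; apply: (@le_trans _ _ (Num.sqrt (b * y ^+ 2))).
  exact: ler_wsqrtr.
by rewrite sqrtrM // sqrtr_sqr ger0_norm.
Qed.

Lemma sqrt_ge_scaled (a b y : R) : 0 <= y -> 0 <= b -> b * y ^+ 2 <= a ->
  Num.sqrt b * y <= Num.sqrt a.
Proof.
move=> y0 b0 ab; apply: (@le_trans _ _ (Num.sqrt (b * y ^+ 2))).
  by rewrite sqrtrM // sqrtr_sqr ger0_norm.
exact: ler_wsqrtr.
Qed.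

(* [h] stands for [n ^ (1/72)], and [L], [l], [lam] for the extreme eigenvalues
   of the Gram matrix and for the penalty at sample size [n]. *)
Variables (h L l c K lam : R).
Hypothesis h_ge1 : 1 <= h.
Hypothesis h_large : expR 1 <= h ^+ 72.
Hypothesis c_gt0 : 0 < c.
Hypothesis l_ge : c * h ^+ 64 <= l.
Hypothesis l_le : l <= L.
Hypothesis L_ge : h ^+ 72 <= L.
Hypothesis L_le : L <= K * h ^+ 72.

Let h_gt0 : 0 < h. Proof. exact: lt_le_trans ltr01 h_ge1. Qed.
Let hX_gt0 k : 0 < h ^+ k. Proof. exact: exprn_gt0. Qed.
Let L_gt0 : 0 < L. Proof. exact: lt_le_trans (hX_gt0 _) L_ge. Qed.
Let l_gt0 : 0 < l.
Proof. by apply: lt_le_trans l_ge; rewrite mulr_gt0. Qed.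
Let K_gt0 : 0 < K.
Proof. by have := lt_le_trans L_gt0 L_le; rewrite pmulr_lgt0. Qed.

Lemma ln_lmax_ge1 : 1 <= ln L.
Proof.
rewrite -(expRK 1) ler_ln ?posrE ?expR_gt0 //; exact: le_trans h_large L_ge.
Qed.

Lemma ln_lmax_le : ln L <= (K + 72) * h.
Proof.
apply: (@le_trans _ _ (ln (K * h ^+ 72))).
  by rewrite ler_ln ?posrE // mulr_gt0.
rewrite lnM ?posrE // lnXn // mulrDl lerD //.
  rewrite (le_trans (ltW (ln_sublinear _))) // ler_peMr // ltW //.
by rewrite -[X in X <= _]mulr_natl ler_wpM2l // ltW // ln_sublinear.
Qed.

(** The pilot correction is at most of order [h ^ ((1 - 64) / 2)], the logarithm being
    at most of order [h]; this is below [h ^- 9], the rate of the least squares error. *)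
Definition pilot_rate : R := Num.sqrt ((K + 72) / c).

Lemma delta_rate : Num.sqrt (ln L / l) * h ^+ 9 <= pilot_rate.
Proof.
have K72 : 0 <= (K + 72) / c by rewrite divr_ge0 ?(ltW c_gt0) // addr_ge0 // ltW.
rewrite -ler_pdivlMr //; apply: sqrt_le_scaled => //; first by rewrite invr_ge0 ltW.
rewrite ler_pdivrMr // (le_trans ln_lmax_le) //.
apply: (@le_trans _ _ ((K + 72) / c * (h ^+ 9)^-1 ^+ 2 * (c * h ^+ 64))); last first.
  by rewrite ler_wpM2l // mulr_ge0 // sqr_ge0.
have -> : (K + 72) / c * (h ^+ 9)^-1 ^+ 2 * (c * h ^+ 64) = (K + 72) * h ^+ 46.
  by field; rewrite !gt_eqF.
by rewrite ler_wpM2l ?addr_ge0 ?(ltW K_gt0) // exprS ler_peMr ?(ltW h_gt0) // exprn_ege1.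
Qed.

Hypothesis lam_gt0 : 0 < lam.
Hypothesis lamE : lam ^+ 2 = L * Num.sqrt (ln L * l).

(** [lam] is of order at least [h ^ ((72 + (0 + 64) / 2) / 2)]. *)
Lemma penalty_ge : Num.sqrt (Num.sqrt c) * h ^+ 52 <= lam.
Proof.
apply: le_sqr; first exact: ltW.
rewrite lamE exprMn sqr_sqrtr ?sqrtr_ge0 //.
have -> : Num.sqrt c * h ^+ 52 ^+ 2 = h ^+ 72 * (Num.sqrt c * h ^+ 32) by ring.
apply: ler_pM => //; first exact: ltW.
  by apply: mulr_ge0; [exact: sqrtr_ge0 | exact: ltW].
apply: sqrt_ge_scaled; [exact: ltW | exact: ltW |]; rewrite -exprM.
apply: (le_trans l_ge); rewrite ler_peMl ?(ltW l_gt0) //; exact: ln_lmax_ge1.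
Qed.

(** The order is [(72 + (1 + 72) / 2) / 2 < 55]. *)
Definition penalty_rate : R := Num.sqrt (K * Num.sqrt ((K + 72) * K)).

Lemma penalty_le : lam <= penalty_rate * h ^+ 55.
Proof.
have K0 := ltW K_gt0.
have r0 : 0 <= K * Num.sqrt ((K + 72) * K) by rewrite mulr_ge0 ?sqrtr_ge0.
apply: le_sqr; first by rewrite mulr_ge0 ?sqrtr_ge0 // ltW.
rewrite lamE exprMn sqr_sqrtr //.
have -> : K * Num.sqrt ((K + 72) * K) * h ^+ 55 ^+ 2 =
   K * h ^+ 72 * (Num.sqrt ((K + 72) * K) * h ^+ 38) by ring.
apply: ler_pM => //; first exact: ltW.
have KK : 0 <= (K + 72) * K by apply: mulr_ge0 => //; exact: addr_ge0.
apply: sqrt_le_scaled => //; [exact: ltW |]; rewrite -exprM.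
have lnL0 : 0 <= ln L by exact: le_trans ler01 ln_lmax_ge1.
apply: (@le_trans _ _ ((K + 72) * h * (K * h ^+ 72))).
  by rewrite ler_pM ?(ltW l_gt0) ?ln_lmax_le // (le_trans l_le).
have -> : (K + 72) * K * h ^+ (38 * 2) = (K + 72) * h * (K * h ^+ 72) * h ^+ 3 by ring.
apply: ler_peMr; last exact: exprn_ege1.
apply: mulr_ge0; first by apply: mulr_ge0; [exact: addr_ge0 | exact: ltW].
by apply: mulr_ge0 => //; exact: ltW.
Qed.

End Rates.

Lemma positive_entries_bound (R : realType) m n (A : 'M[R]_(m, n)) :
  exists2 p : R, 0 < p & forall i j, A i j != 0 -> p <= `|A i j|.
Proof.
exists (\big[Num.min/1]_(ij : 'I_m * 'I_n | A ij.1 ij.2 != 0) `|A ij.1 ij.2|).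
  by elim/big_ind: _ => // [a b a0 b0|ij ij0]; rewrite ?lt_min ?a0 ?b0 ?normr_gt0.
by move=> i j Aij; exact: (bigmin_le_cond _ (j := (i, j))).
Qed.

(** * Consistency along one trajectory *)

Section RootScale.
Context {R : realType}.

(** All growth rates are powers of [n] whose exponents are rounded to multiples
    of [1/72], so that rates compare like natural numbers: [55/72] is
    [3/4 + 1/72], the order of the fluctuations, and [64/72] is [8/9], the order of
    the excitation. *)
Definition root72 (n : nat) : R := n%:R `^ 72^-1.

Lemma root72_ge0 n : 0 <= root72 n. Proof. exact: powR_ge0. Qed.

Lemma root72X n : root72 n ^+ 72 = n%:R.
Proof. by rewrite -powR_mulrn ?root72_ge0 // -powRrM mulVf // powRr1. Qed.

Lemma root72_le m n : (m <= n)%N -> root72 m <= root72 n.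
Proof. by move=> mn; rewrite ge0_ler_powR ?nnegrE ?invr_ge0 ?ler_nat. Qed.

Lemma root72_ge1 n : (0 < n)%N -> 1 <= root72 n.
Proof.
move=> n0; apply: (@le_trans _ _ (1 `^ 72^-1)); first by rewrite powR1.
by rewrite ge0_ler_powR ?nnegrE ?invr_ge0 // ler1n.
Qed.

Lemma add1_le_lt (a b : R) : a + 1 <= b -> a < b.
Proof. by apply: lt_le_trans; rewrite ltrDl. Qed.

Lemma near_root72_ge (A : R) : \forall n \near \oo, A <= root72 n.
Proof.
near=> n; rewrite leNgt; apply/negP => lt.
have A0 : 0 <= A by rewrite (le_trans (root72_ge0 n)) // ltW.
have : (n%:R : R) < A ^+ 72 + 1.
  by rewrite -root72X ltr_wpDr // ltrXn2r ?nnegrE ?root72_ge0.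
apply/negP; rewrite -leNgt; near: n; exact: nbhs_infty_ger.
Unshelve. all: by end_near. Qed.

End RootScale.
Arguments root72 {R} n.

Section PathwiseConsistency.
Context {R : realType} {N : nat}.
Variables (alpha0 : R) (B : 'M[R]_N) (x u wn : nat -> 'cV[R]_N).
Variable Th : 'M[R]_(N, 1 + N).
Hypothesis alpha0_gt0 : 0 < alpha0.
Hypothesis obsE : forall k, (0 < k)%N -> obs B x u k = Th *m regressor x k + wn k.
Variables (lam : nat -> R) (Gamma : nat -> 'M[R]_(N, 1 + N)).
Hypothesis lam_adm : admissible_penalty x lam.
Hypothesis Gamma_out : sparse_recovery_output alpha0 B x u lam Gamma.
Variables (c K : R).
Hypothesis c_gt0 : 0 < c.
Hypothesis excitation : \forall n \near \oo, forall q : 'rV[R]_(1 + N),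
  c * root72 n ^+ 64 * sqn q <= qform (gram x n) q.
Hypothesis energy : forall n, (0 < n)%N ->
  \sum_(1 <= k < n.+1) sqn (regressor x k) <= K * root72 n ^+ 72.
Hypothesis correlation : forall n s l, (0 < n)%N ->
  `|noise_corr x wn n s l| <= K * root72 n ^+ 55.

Local Notation h n := (root72 n : R).
Local Notation dim := ((N * (1 + N))%:R : R).

Lemma regressor0 k : regressor x k 0 0 = 1.
Proof.
by rewrite mxE; case: splitP => // -[] //= [] // ? _; rewrite mxE.
Qed.

Let K_ge1 : 1 <= K.
Proof.
have := @energy 1 isT; rewrite big_nat1 root72X mulr1; apply: le_trans.
by apply: le_trans (sqr_entry_le (regressor x 1) 0 0); rewrite regressor0 expr1n.
Qed.

Let K_gt0 : 0 < K. Proof. exact: lt_le_trans ltr01 K_ge1. Qed.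

Lemma gram00 n : gram x n 0 0 = n%:R.
Proof.
rewrite gram_diag; under eq_bigr do rewrite regressor0 expr1n.
by rewrite sumr_const_nat subn1.
Qed.

Lemma lmax_ge n : (n%:R : R) <= lmax x n.
Proof.
have := lambda_max_rayleigh (delta_mx 0 0) (gram_psd x n).1.
have -> : qform (gram x n) (delta_mx 0 0) = n%:R.
  by rewrite /qform -rowE trmx_delta -colE !mxE gram00.
have -> : sqn (delta_mx 0 0 : 'rV[R]_(1 + N)) = 1; last by rewrite mulr1.
rewrite sqn_rowE (bigD1 0) //= big1 ?addr0; first by rewrite mxE !eqxx expr1n.
by move=> i /negbTE i0; rewrite mxE i0 andbF expr0n.
Qed.

Lemma lmax_le n : (0 < n)%N -> lmax x n <= K * root72 n ^+ 72.
Proof.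
move=> n0; apply: lambda_max_le; first exact: (gram_psd x n).1.
move=> q; apply: le_trans (qform_gram_le _ _ _) _.
by rewrite ler_wpM2r ?sqn_ge0 // energy.
Qed.

Lemma noise_corr_sqn_le n : (0 < n)%N ->
  sqn (noise_corr x wn n) <= dim * K ^+ 2 * root72 n ^+ 110.
Proof.
move=> n0; have e s l : noise_corr x wn n s l ^+ 2 <= K ^+ 2 * h n ^+ 110.
  have -> : K ^+ 2 * h n ^+ 110 = (K * h n ^+ 55) ^+ 2 by ring.
  rewrite -[X in X <= _]real_normK ?num_real // ler_sqr ?nnegrE ?correlation //.
  by rewrite mulr_ge0 ?exprn_ge0 ?root72_ge0 // ltW.
apply: (le_trans (ler_sum _ (fun s _ => ler_sum _ (fun l _ => e s l)))).
by rewrite !sumr_const !card_ord -mulrnA -mulrA [leRHS]mulr_natl mulnC.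
Qed.

Definition rls_rate : R :=
  Num.sqrt ((2 * (dim * K ^+ 2) + 2 * alpha0^-1 ^+ 2 * sqn Th) / c ^+ 2).

(** The exponent is [64 - 55]: excitation against correlation with the noise. *)
Lemma rls_error_rate : \forall n \near \oo, forall s l,
  `|(rls_Theta alpha0 B x u n)^T s l - Th s l| * root72 n ^+ 9 <= rls_rate.
Proof.
near=> n => s l.
have n0 : (0 < n)%N by near: n; exact: nbhs_infty_gt.
have h1 : 1 <= h n by exact: root72_ge1.
have h0 : 0 < h n by exact: lt_le_trans ltr01 h1.
have hX k : 0 < h n ^+ k by exact: exprn_gt0.
set e := (_ - _).
have m0 : 0 <= c * h n ^+ 64 by rewrite mulr_ge0 ?(ltW c_gt0) // ltW.
have ex : forall q, c * h n ^+ 64 * sqn q <= qform (gram x n) q by near: n.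
have := rls_error_bound alpha0_gt0 obsE s l m0 ex; rewrite -/e => he.
set a := (2 * (dim * K ^+ 2) + 2 * alpha0^-1 ^+ 2 * sqn Th).
have a0 : 0 <= 2 * alpha0^-1 ^+ 2 * sqn Th by rewrite !mulr_ge0 ?sqn_ge0 ?invr_ge0 // ltW.
have he2 : (c * h n ^+ 64) ^+ 2 * e ^+ 2 <= a * h n ^+ 110.
  apply: (le_trans he); rewrite [leRHS]mulrDl; apply: lerD.
    by have := noise_corr_sqn_le n0; lra.
  by rewrite ler_peMr // exprn_ege1.
rewrite -[h n ^+ 9]ger0_norm ?(ltW (hX _)) // -normrM.
apply: norm_le_sqr; first exact: sqrtr_ge0.
rewrite sqr_sqrtr; last first.
  apply: divr_ge0; last exact: sqr_ge0.
  apply: addr_ge0 => //; apply: mulr_ge0 => //.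
  by apply: mulr_ge0 => //; exact: sqr_ge0.
rewrite ler_pdivlMr ?exprn_gt0 //.
rewrite -(ler_pM2r (hX 110)); apply: le_trans he2.
by rewrite le_eqVlt; apply/orP; left; apply/eqP; ring.
Unshelve. all: by end_near. Qed.

(** Off the support the pilot entry is of order at most [h ^- 9], so that the slope
    of the penalty is of order at least [h ^ (52 + 9)]. A nonzero entry would need a
    gradient of the quadratic part of that size, but by Cauchy-Schwarz the gradient
    is of order at most [h ^ ((110 - 64 + 72) / 2) = h ^ 59]. *)
Lemma lasso_rates : exists2 E, 0 <= E & \forall n \near \oo,
  sqn (Gamma n.+1 - Th) * root72 n ^+ 18 <= E /\
  forall s l, Th s l = 0 -> Gamma n.+1 s l = 0.
Proof.
have [p2 p2_gt0 hp2] := positive_entries_bound Th; pose p0 := p2 / 2.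
have p0_gt0 : 0 < p0 by rewrite divr_gt0.
pose bc := 2 * K + penalty_rate K / p0.
have K0 := ltW K_gt0.
have bc_ge0 : 0 <= bc.
  apply: addr_ge0; first by apply: mulr_ge0.
  by apply: divr_ge0; [exact: sqrtr_ge0 | exact: ltW].
exists (bc ^+ 2 * dim / c ^+ 2).
  apply: divr_ge0; last exact: sqr_ge0.
  by apply: mulr_ge0 => //; exact: sqr_ge0.
pose pc := rls_rate + pilot_rate c K.
pose sc := Num.sqrt (Num.sqrt c).
have sc_gt0 : 0 < sc by rewrite !sqrtr_gt0.
have pc_ge0 : 0 <= pc by rewrite addr_ge0 // sqrtr_ge0.
pose Q := bc ^+ 2 * dim / c * K.
have Q_ge0 : 0 <= Q.
  apply: mulr_ge0 => //; apply: divr_ge0; last exact: ltW.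
  by apply: mulr_ge0 => //; exact: sqr_ge0.
near=> n.
have n0 : (0 < n)%N by near: n; exact: nbhs_infty_gt.
have h1 : 1 <= h n by exact: root72_ge1.
have h0 : 0 < h n by exact: lt_le_trans ltr01 h1.
have hX k : 0 < h n ^+ k by exact: exprn_gt0.
have ex : forall q, c * h n ^+ 64 * sqn q <= qform (gram x n) q by near: n.
have hlarge : expR 1 <= h n ^+ 72 by rewrite root72X; near: n; exact: nbhs_infty_ger.
have l_ge : c * h n ^+ 64 <= lmin x n by apply: lambda_min_ge => //; exact: (gram_psd x n).1.
have l_le : lmin x n <= lmax x n by exact: lambda_min_le_max (gram_psd x n).
have L_ge : h n ^+ 72 <= lmax x n by rewrite root72X; exact: lmax_ge.
have L_le := lmax_le n0.
have l_gt0 : 0 < lmin x n by apply: lt_le_trans l_ge; rewrite mulr_gt0.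
have L_gt0 : 0 < lmax x n by apply: lt_le_trans l_le.
have Cmin := Gamma_out n0 l_gt0.
have [lam_gt0 lamE] := lam_adm n0.
have lnL := ln_lmax_ge1 h1 hlarge L_ge.
have {}lamE : lam n ^+ 2 = lmax x n * Num.sqrt (ln (lmax x n) * lmin x n).
  by apply: lamE; rewrite mulr_gt0 // sqrtr_gt0 mulr_gt0 // (lt_le_trans ltr01).
have lam_ge := penalty_ge h1 hlarge c_gt0 l_ge L_ge lam_gt0 lamE.
have lam_le := penalty_le h1 hlarge c_gt0 l_ge l_le L_ge L_le lamE.
have del := delta_rate h1 c_gt0 l_ge L_ge L_le.
have m0 : 0 < c * h n ^+ 64 by rewrite mulr_gt0.
have rls : forall s l, `|(rls_Theta alpha0 B x u n)^T s l - Th s l| * h n ^+ 9 <= rls_rate.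
  by near: n; exact: rls_error_rate.
have om s l := correlation s l n0.
have hp0 : rls_rate / p0 <= h n.
  by near: n; exact: near_root72_ge.
have h9 : h n <= h n ^+ 9 by rewrite exprS ler_peMr ?(ltW h0) // exprn_ege1.
have pilotE s l : `|pilot alpha0 B x u n s l| =
    `|(rls_Theta alpha0 B x u n)^T s l| + (((rls_Theta alpha0 B x u n)^T s l) != 0)%:R * delta x n.
  rewrite /pilot mxE; set a := _ s l.
  have d0 : 0 <= delta x n by exact: sqrtr_ge0.
  have [->|an0] := eqVneq a 0; first by rewrite sgr0 !mul0r !addr0.
  rewrite {1}[a]numEsg -mulrDr normrM normr_sg an0 mul1r mul1r ger0_norm //.
  exact: addr_ge0.
have large s l : Th s l != 0 -> p0 <= `|pilot alpha0 B x u n s l|.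
  move=> Tn0; rewrite pilotE; have := rls s l; set a := _^T s l => ra.
  have e1 : `|a - Th s l| <= p0.
    rewrite -(ler_pM2r (hX 9)); apply: (le_trans ra).
    rewrite mulrC -ler_pdivrMr //; exact: le_trans hp0 h9.
  have e2 := hp2 _ _ Tn0.
  have e3 : `|Th s l| <= `|a| + `|a - Th s l|.
    by rewrite -{1}[Th s l](subKr a) (le_trans (ler_normB _ _)).
  have : 0 <= (a != 0)%:R * delta x n by rewrite mulr_ge0 // sqrtr_ge0.
  by rewrite /p0 in e1 *; lra.
have small s l : Th s l = 0 -> `|pilot alpha0 B x u n s l| * h n ^+ 9 <= pc.
  move=> T0; rewrite pilotE [leLHS]mulrDl; apply: lerD.
    by have := rls s l; rewrite T0 subr0.
  apply: le_trans del; rewrite ler_wpM2r ?(ltW (hX _)) //.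
  case: (_ != 0); rewrite ?mul1r ?mul0r //; exact: sqrtr_ge0.
have bnd : 2 * (K * h n ^+ 55) + lam n / p0 <= bc * h n ^+ 55.
  rewrite [leRHS]mulrDl; apply: lerD; first by rewrite mulrA.
  by rewrite mulrAC ler_wpM2r // invr_ge0 ltW.
have bnd_ge0 : 0 <= 2 * (K * h n ^+ 55) + lam n / p0.
  apply: addr_ge0; last by apply: divr_ge0; exact: ltW.
  by apply: mulr_ge0 => //; apply: mulr_ge0 => //; exact: ltW.
have bnd2 : (2 * (K * h n ^+ 55) + lam n / p0) ^+ 2 <= bc ^+ 2 * h n ^+ 110.
  have -> : bc ^+ 2 * h n ^+ 110 = (bc * h n ^+ 55) ^+ 2 by ring.
  by rewrite ler_sqr ?nnegrE // (le_trans bnd_ge0).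
split.
  have := lasso_error_bound obsE lam_gt0 Cmin m0 ex om p0_gt0 large.
  move=> hD; rewrite ler_pdivlMr ?exprn_gt0 // -(ler_pM2r (hX 110)).
  apply: (@le_trans _ _ ((c * h n ^+ 64) ^+ 2 * sqn (Gamma n.+1 - Th))).
    by rewrite le_eqVlt; apply/orP; left; apply/eqP; ring.
  apply: (le_trans hD).
  have -> : bc ^+ 2 * dim * h n ^+ 110 = bc ^+ 2 * h n ^+ 110 * dim by ring.
  by rewrite ler_wpM2r.
move=> s l T0; apply: contrapT => /eqP Gn0.
have Kll : gram x n l l <= K * h n ^+ 72.
  apply: le_trans (energy n0); rewrite gram_diag; apply: ler_sum => k _.
  exact: sqr_entry_le.
have := lasso_entry_stationary obsE lam_gt0 Cmin m0 ex om p0_gt0 large T0 Gn0 Kll.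
have pn0 : 0 < `|pilot alpha0 B x u n s l|.
  rewrite normr_gt0; apply: contra Gn0 => /eqP.
  by move/(minimizer_feasible lam_gt0 Cmin p0_gt0 large) ->.
have pc_gt0 : 0 < pc by apply: lt_le_trans (small s l T0); rewrite mulr_gt0.
apply/negP; rewrite -ltNge.
have lower : sc / pc * h n ^+ 61 <= lam n / `|pilot alpha0 B x u n s l|.
  rewrite ler_pdivlMr //; apply: le_trans lam_ge.
  have -> : sc / pc * h n ^+ 61 * `|pilot alpha0 B x u n s l| =
     sc * h n ^+ 52 * ((`|pilot alpha0 B x u n s l| * h n ^+ 9) / pc) by ring.
  apply: ler_piMr; first by apply: mulr_ge0; exact: ltW.
  by rewrite ler_pdivrMr // mul1r small.
apply: lt_le_trans lower.
have upper : Num.sqrt ((2 * (K * h n ^+ 55) + lam n / p0) ^+ 2 * dim /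
     (c * h n ^+ 64) * (K * h n ^+ 72)) <= Num.sqrt Q * h n ^+ 59.
  apply: sqrt_le_scaled => //; first exact: ltW.
  have -> : Q * h n ^+ 59 ^+ 2 = bc ^+ 2 * h n ^+ 110 * (dim / (c * h n ^+ 64) * (K * h n ^+ 72)).
    by rewrite /Q; field; rewrite !gt_eqF.
  have assoc X : X * dim / (c * h n ^+ 64) * (K * h n ^+ 72) =
    X * (dim / (c * h n ^+ 64) * (K * h n ^+ 72)) by ring.
  rewrite assoc; apply: ler_wpM2r => //; apply: mulr_ge0.
    by apply: divr_ge0 => //; exact: ltW.
  by apply: mulr_ge0 => //; exact: ltW.
apply: (@le_lt_trans _ _ ((2 * Num.sqrt Q + 2 * K) * h n ^+ 59)).
  have : K * h n ^+ 55 <= K * h n ^+ 59 by rewrite ler_wpM2l // ler_weXn2l.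
  by move: upper; lra.
have -> : sc / pc * h n ^+ 61 = (sc / pc * h n ^+ 2) * h n ^+ 59 by ring.
rewrite ltr_pM2r //.
rewrite [ltRHS]mulrAC ltr_pdivlMr // [ltRHS]mulrC -ltr_pdivrMr //.
apply: (@lt_le_trans _ _ (h n)); last by rewrite expr2 ler_peMr // ltW.
apply: add1_le_lt; near: n; exact: near_root72_ge.
Unshelve. all: by end_near. Qed.

Lemma pathwise_consistency :
  (fnorm (Gamma n.+1 - Th) @[n --> \oo] --> (0 : R)) /\
  exists n0 : nat, forall n, (n0 <= n)%N ->
    mxsupport (Gamma n.+1) = mxsupport Th.
Proof.
have [E E0 rates] := lasso_rates; have [p2 p2_gt0 hp2] := positive_entries_bound Th.
have small e : 0 < e -> \forall n \near \oo, fnorm (Gamma n.+1 - Th) < e.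
  move=> e0; near=> n.
  have n0 : (0 < n)%N by near: n; exact: nbhs_infty_gt.
  have [r _] : sqn (Gamma n.+1 - Th) * root72 n ^+ 18 <= E /\
    (forall s l, Th s l = 0 -> Gamma n.+1 s l = 0) by near: n.
  have h1 : 1 <= h n by exact: root72_ge1.
  rewrite -(ger0_norm (ltW e0)) -[`|e|]sqrtr_sqr fnormE ltr_sqrt ?exprn_gt0 //.
  rewrite -(ltr_pM2r (_ : 0 < h n ^+ 18)) ?exprn_gt0 ?(lt_le_trans ltr01 h1) //.
  apply: (le_lt_trans r); rewrite mulrC -ltr_pdivrMr ?exprn_gt0 //.
  apply: (@lt_le_trans _ _ (h n)); last by rewrite exprS ler_peMr ?exprn_ege1 // (le_trans ler01).
  apply: add1_le_lt; near: n; exact: near_root72_ge.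
split.
  apply/cvgrPdist_lt => e e0; near=> n.
  by rewrite sub0r normrN ger0_norm ?sqrtr_ge0 //; near: n; exact: small.
suff [n0 _ h0] : \forall n \near \oo, mxsupport (Gamma n.+1) = mxsupport Th.
  by exists n0 => n /h0.
near=> n.
have [_ z] : sqn (Gamma n.+1 - Th) * root72 n ^+ 18 <= E /\
    (forall s l, Th s l = 0 -> Gamma n.+1 s l = 0) by near: n.
have d : fnorm (Gamma n.+1 - Th) < p2 by near: n; exact: small.
apply/seteqP; split=> -[s l] /=; apply: contra => /eqP.
  by move/z => ->.
move=> G0; apply: contrapT => /negP /hp2; apply/negP; rewrite -ltNge.
apply: le_lt_trans d; rewrite fnormE -sqrtr_sqr ler_wsqrtr //.
by have := sqr_entry_le (Gamma n.+1 - Th) s l; rewrite !mxE G0 sub0r sqrrN.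
Unshelve. all: by end_near. Qed.

End PathwiseConsistency.

(** * A Lyapunov function for a stable matrix *)

(* The construction runs over the complex numbers, where the characteristic
   polynomial splits. *)
Section Stability.
Context {R : realType}.
Local Notation C := R[i].
Local Notation nc := (@Normc.normc R).

Lemma normc_ge0 (z : C) : 0 <= nc z.
Proof. by case: z => a b; exact: sqrtr_ge0. Qed.

Lemma normc_real (a : R) : nc (real_complex R a) = `|a|.
Proof. by rewrite /Normc.normc /= expr0n addr0 sqrtr_sqr. Qed.

Definition csqn n (y : 'cV[C]_n) : R := \sum_i nc (y i 0) ^+ 2.

Lemma csqn_ge0 n (y : 'cV[C]_n) : 0 <= csqn y.
Proof. by apply: sumr_ge0 => i _; exact: sqr_ge0. Qed.

Lemma csqn_real n (x : 'cV[R]_n) : csqn (map_mx (real_complex R) x) = sqn x.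
Proof.
rewrite sqn_colE; apply: eq_bigr => i _.
by rewrite mxE normc_real real_normK ?num_real.
Qed.

Lemma csqn0 n : csqn (0 : 'cV[C]_n) = 0.
Proof. by rewrite /csqn big1 // => i _; rewrite mxE Normc.normc0 expr0n. Qed.

Lemma csqnD n (y y' : 'cV[C]_n) : csqn (y + y') <= 2 * (csqn y + csqn y').
Proof.
rewrite /csqn -big_split mulr_sumr ler_sum // => i _ /=; rewrite mxE.
have h := le_normcD (y i 0) (y' i 0).
have h2 : nc (y i 0 + y' i 0) ^+ 2 <= (nc (y i 0) + nc (y' i 0)) ^+ 2.
  by rewrite ler_sqr ?nnegrE ?addr_ge0 ?normc_ge0.
by have := sqr_ge0 (nc (y i 0) - nc (y' i 0)); nra.
Qed.

(** Convexity of the square: [l y + f] is the combination of [y] and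
    [f / (1 - |l|)] with weights [|l|] and [1 - |l|]. *)
Lemma csqn_contract n (l : C) (y f : 'cV[C]_n) : nc l < 1 ->
  csqn (l *: y + f) <= nc l * csqn y + csqn f / (1 - nc l).
Proof.
move=> l1; have d0 : 0 < 1 - nc l by rewrite subr_gt0.
rewrite /csqn mulr_sumr mulr_suml -big_split ler_sum // => i _ /=.
rewrite !mxE -[X in _ + X]mulr1.
have := le_normcD (l * y i 0) (f i 0); rewrite Normc.normcM.
set c := nc (_ + _); set r := nc l in d0 l1 *; set a := nc (y i 0); set b := nc (f i 0) => h.
have a0 : 0 <= a := normc_ge0 _; have b0 : 0 <= b := normc_ge0 _.
have c0 : 0 <= c := normc_ge0 _; have r0 : 0 <= r := normc_ge0 _.
rewrite mulr1 -(ler_pM2r d0) mulrDl divfK ?gt_eqF //.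
have h2 : c ^+ 2 <= (r * a + b) ^+ 2 by rewrite ler_sqr ?nnegrE // (le_trans c0).
have h3 : c ^+ 2 * (1 - r) <= (r * a + b) ^+ 2 * (1 - r) by rewrite ler_wpM2r // ltW.
apply: (le_trans h3).
have : 0 <= r * ((1 - r) * a - b) ^+ 2 by rewrite mulr_ge0 ?sqr_ge0.
nra.
Qed.

Lemma csqn_mulmx n (A : 'M[C]_n) : exists2 k, 0 <= k &
  forall y : 'cV[C]_n, csqn (A *m y) <= k * csqn y.
Proof.
pose a i j := nc (A i j).
exists (\sum_i \sum_j a i j ^+ 2).
  by apply: sumr_ge0 => i _; apply: sumr_ge0 => j _; exact: sqr_ge0.
move=> y; rewrite {1}/csqn mulr_suml ler_sum // => i _; rewrite mxE.
have h : nc (\sum_j A i j * y j 0) <= \sum_j a i j * nc (y j 0).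
  elim/big_ind2: _ => [|u1 u2 v1 v2 h1 h2|j _]; first by rewrite Normc.normc0.
    by apply: (le_trans (le_normcD _ _)); exact: lerD.
  by rewrite Normc.normcM.
apply: le_trans (sum_cauchy_schwarz _ _ _ _).
by rewrite ler_sqr ?nnegrE ?normc_ge0 // (le_trans (normc_ge0 _) h).
Qed.

Variable n : nat.
Variable A : 'M[C]_n.+1.

Definition root_poly (ls : seq C) : {poly C} := \prod_(l <- ls) ('X - l%:P).

Local Notation killed ls y := (horner_mx A (root_poly ls) *m y).

Lemma killed_cons l ls (y : 'cV[C]_n.+1) :
  killed (l :: ls) y = killed ls (A *m y - l *: y).
Proof.
rewrite /root_poly big_cons mulrC rmorphM /= -mulmxA; congr (_ *m _).
by rewrite rmorphB /= horner_mx_X horner_mx_C mulmxBl mul_scalar_mx.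
Qed.

(** The functional dominates [csqn] up to [killed ls y], which vanishes when [ls]
    lists all the roots of the characteristic polynomial, by Cayley-Hamilton.
    It is built one root at a time: [A y = l y + y1] with [y1 = (A - l) y], the map
    [y |-> l y] contracts, and a large multiple of the functional already built
    for [y1] absorbs the term [y1]. *)
Lemma lyapunov_roots (ls : seq C) : (forall l, l \in ls -> nc l < 1) ->
  exists (V : 'cV[C]_n.+1 -> R) (r K M : R),
  [/\ 0 <= r < 1, 0 <= K, 0 <= M &
   [/\ forall y, csqn y <= V y + csqn (killed ls y),
      forall y, 0 <= V y <= M * csqn y &
      forall y f, V (A *m y + f) <= r * V y + K * (csqn f + csqn (killed ls y))]].
Proof.
elim: ls => [|l ls IH] hls.
  exists (fun=> 0), 0, 0, 0; split; rewrite ?lexx ?ltr01 //; split.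
  - by move=> y; rewrite add0r /root_poly big_nil rmorph1 mul1mx.
  - by move=> y; rewrite mul0r lexx.
  - by move=> y f; rewrite !mul0r addr0.
have [|V [r [K [M [/andP[r0 r1] K0 M0 [h1 h2 h3]]]]]] := IH.
  by move=> k kls; apply: hls; rewrite inE kls orbT.
have l1 : nc l < 1 by apply: hls; rewrite mem_head.
have l0 := normc_ge0 l.
have [k k0 hk] := csqn_mulmx (A - l%:M).
pose y1 (y : 'cV[C]_n.+1) := A *m y - l *: y.
have y1E y : y1 y = (A - l%:M) *m y by rewrite mulmxBl mul_scalar_mx.
have [d dE] : exists d, d = 2 / (1 - nc l) by exists (2 / (1 - nc l)).
have d0 : 0 <= d by rewrite dE; apply: divr_ge0 => //; rewrite subr_ge0 ltW.
(* The weight [kap] of the old functional is such that its rate only moves from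
   [r] to the midpoint of [r] and [1]. *)
have [kap kapD] : exists kap, kap = 2 * d / (1 - r) by exists (2 * d / (1 - r)).
have kap0 : 0 <= kap.
  by rewrite kapD; apply: divr_ge0; [exact: mulr_ge0 | rewrite subr_ge0 ltW].
have kapE : d + kap * r = kap * ((1 + r) / 2).
  by rewrite kapD; field; rewrite gt_eqF // subr_gt0.
pose r' := Num.max (nc l) ((1 + r) / 2).
have rl : nc l <= r' by rewrite le_max lexx.
have rr : (1 + r) / 2 <= r' by rewrite le_max lexx orbT.
have [K' K'E] : exists K', K' = d + kap * K * (k + 1) by exists (d + kap * K * (k + 1)).
have K'0 : 0 <= K'.
  rewrite K'E; apply: addr_ge0 => //; apply: mulr_ge0; first exact: mulr_ge0.
  exact: addr_ge0.
exists (fun y => csqn y + kap * V (y1 y)), r', K', (1 + kap * (M * k)).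
split; [| exact: K'0 | |].
- by rewrite le_max l0 /= gt_max l1; lra.
- by apply: addr_ge0; [exact: ler01 | apply: mulr_ge0; [exact: kap0 | exact: mulr_ge0]].
split.
- move=> y; have := h2 (y1 y) => /andP[v0 _].
  by rewrite -addrA lerDl addr_ge0 ?csqn_ge0 // mulr_ge0.
- move=> y; have := h2 (y1 y) => /andP[v0 vM]; apply/andP; split.
    by rewrite addr_ge0 ?csqn_ge0 // mulr_ge0.
  rewrite mulrDl mul1r lerD2l -!mulrA ler_wpM2l //; apply: (le_trans vM).
  by rewrite ler_wpM2l // y1E.
move=> y f; rewrite killed_cons -/(y1 y).
set p := csqn (horner_mx _ _ *m _).
have p0 : 0 <= p by exact: csqn_ge0.
have e1 : A *m y + f = l *: y + (y1 y + f) by rewrite /y1 addrA [l *: y + _]addrC subrK.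
have e2 : y1 (A *m y + f) = A *m y1 y + (A - l%:M) *m f.
  rewrite y1E mulmxDr; congr (_ + _).
  by rewrite /y1 mulmxBl mulmxBr mul_scalar_mx -scalemxAr.
have /andP[v0 _] := h2 (y1 y).
have f0 := csqn_ge0 f.
have b1 : csqn (A *m y + f) <= nc l * csqn y + d * (V (y1 y) + p + csqn f).
  rewrite e1; apply: (le_trans (csqn_contract _ _ l1)); rewrite lerD2l.
  rewrite dE mulrAC ler_wpM2r ?invr_ge0 ?subr_ge0 ?(ltW l1) //.
  apply: (le_trans (csqnD _ _)); rewrite ler_wpM2l // lerD2r; exact: h1.
have b2 : V (y1 (A *m y + f)) <= r * V (y1 y) + K * (k * csqn f + p).
  rewrite e2; apply: (le_trans (h3 _ _)); rewrite lerD2l ler_wpM2l // lerD2r; exact: hk.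
have b3 : kap * V (y1 (A *m y + f)) <= kap * (r * V (y1 y) + K * (k * csqn f + p)).
  exact: ler_wpM2l.
have y0 := csqn_ge0 y.
have b4 : nc l * csqn y <= r' * csqn y by exact: ler_wpM2r.
have b5 : (d + kap * r) * V (y1 y) <= r' * (kap * V (y1 y)).
  by rewrite kapE [kap * _]mulrC -mulrA ler_wpM2r // mulr_ge0.
have b6 : d * (p + csqn f) + kap * (K * (k * csqn f + p)) <= K' * (csqn f + p).
  have : 0 <= kap * K * (csqn f + k * p) by rewrite !mulr_ge0 // addr_ge0 // mulr_ge0.
  rewrite K'E; nra.
nra.
Qed.

End Stability.

Section RealStability.
Context {R : realType}.
Variables (n : nat) (G : 'M[R]_n.+1).
Hypothesis G_stable : spectral_radius G < 1.

Local Notation Gc := (map_mx (real_complex R) G).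

Lemma char_poly_roots : exists2 ls, char_poly Gc = root_poly ls &
  forall l, l \in ls -> Normc.normc l < 1.
Proof.
have [ls Els] := closed_field_poly_normal (char_poly Gc).
rewrite (monicP (char_poly_monic _)) scale1r in Els.
exists ls => // l lls.
have eig k : eigenvalue Gc k = (k \in ls).
  by rewrite eigenvalue_root_char Els root_prod_XsubC.
apply: le_lt_trans G_stable; apply: ub_le_sup; last by exists l; rewrite ?eig.
exists (\sum_(k <- ls) Normc.normc k) => _ [k + ->]; rewrite eig => kls.
rewrite (big_rem k) //= lerDl sumr_ge0 // => j _; exact: normc_ge0.
Qed.

Lemma lyapunov : exists (V : 'cV[R]_n.+1 -> R) (r K M : R),
  [/\ 0 <= r < 1, 0 <= K, forall x, sqn x <= V x <= M * sqn x &
      forall x f, V (G *m x + f) <= r * V x + K * sqn f].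
Proof.
have [ls Els hls] := char_poly_roots.
have [V [r [K [M [r01 K0 M0 [h1 h2 h3]]]]]] := lyapunov_roots Gc hls.
have kill y : csqn (horner_mx Gc (root_poly ls) *m y) = 0.
  by rewrite -Els Cayley_Hamilton mul0mx csqn0.
exists (fun x => V (map_mx (real_complex R) x)), r, K, M; split => //.
- move=> x; have := h1 (map_mx (real_complex R) x); rewrite kill addr0 csqn_real => -> /=.
  by have := h2 (map_mx (real_complex R) x); rewrite csqn_real => /andP[].
- move=> x f; rewrite map_mxD map_mxM; apply: (le_trans (h3 _ _)).
  by rewrite kill addr0 csqn_real.
Qed.

Lemma stable_unit : 1%:M - G \in unitmx.
Proof.
have [ls Els hls] := char_poly_roots.
rewrite unitmxE unitfE; apply/negP => /eqP d0.
have : root (char_poly Gc) 1.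
  rewrite /root /char_poly -horner_evalE -det_map_mx /=.
  have -> : map_mx (horner_eval 1) (char_poly_mx Gc) = map_mx (real_complex R) (1%:M - G).
    apply/matrixP => i j; rewrite !mxE /horner_eval /= hornerD hornerN !hornerC.
    by rewrite hornerMn hornerX rmorphB rmorphMn /= rmorph1.
  by rewrite det_map_mx d0 rmorph0.
rewrite Els root_prod_XsubC => /hls; by rewrite Normc.normc1 ltxx.
Qed.

End RealStability.

(** * Filtering the states by the characteristic polynomial *)

Section Filter.
Context {R : realType}.
Variables (N' : nat).
Local Notation N := N'.+1.
Variables (G B : 'M[R]_N) (alpha : 'cV[R]_N) (x xi : nat -> 'cV[R]_N).
Hypothesis x_rec : forall k, x k.+1 = alpha + G *m x k + xi k.

Local Notation a j := ((char_poly G)`_j).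

Lemma state_shift k j :
  x (k + j)%N = G ^+ j *m x k + \sum_(i < j) G ^+ (j.-1 - i) *m (alpha + xi (k + i)%N).
Proof.
have GS l (y : 'cV[R]_N) : G *m (G ^+ l *m y) = G ^+ l.+1 *m y.
  by rewrite mulmxA mulmxE -exprS.
elim: j => [|j IH]; first by rewrite addn0 big_ord0 addr0 expr0 mul1mx.
rewrite addnS x_rec IH mulmxDr GS big_ord_recr /= subnn expr0 mul1mx mulmx_sumr.
have -> : \sum_(i < j) G *m (G ^+ (j.-1 - i) *m (alpha + xi (k + i)%N)) =
          \sum_(i < j) G ^+ (j - i) *m (alpha + xi (k + i)%N).
  apply: eq_bigr => -[i ij] _ /=; rewrite GS.
  by case: j ij {IH} => // j ij; rewrite subSn.
by rewrite addrCA -!addrA; congr (_ + _); rewrite addrCA.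
Qed.

(** Coefficients of the moving average [sum_j a_j x_(k+j)], obtained from the
    characteristic polynomial by repeated division by the indeterminate. *)
Definition ma_coef (i : nat) : 'M[R]_N :=
  \sum_(j < N.+1 | (i < j)%N) a j *: G ^+ (j.-1 - i).

Lemma char_poly_size : size (char_poly G) = N.+1.
Proof. exact: size_char_poly. Qed.

Lemma cayley_hamilton_coef : \sum_(j < N.+1) a j *: G ^+ j = 0.
Proof.
rewrite -[RHS](Cayley_Hamilton G) -[in RHS](coefK (char_poly G)) poly_def.
rewrite char_poly_size linear_sum /=; apply: eq_bigr => j _.
by rewrite linearZ /= rmorphXn /= horner_mx_X.
Qed.

(** By Cayley-Hamilton the combination of [N + 1] consecutive states given by
    the characteristic polynomial no longer depends on the initial state. *)
Lemma filtered_state k :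
  \sum_(j < N.+1) a j *: x (k + j)%N = \sum_(i < N) ma_coef i *m (alpha + xi (k + i)%N).
Proof.
under eq_bigr => j _ do rewrite state_shift scalerDr scalemxAl.
rewrite big_split /= -mulmx_suml cayley_hamilton_coef mul0mx add0r.
under [RHS]eq_bigr => i _ do rewrite /ma_coef mulmx_suml.
rewrite [RHS](exchange_big_dep predT) //=; apply: eq_bigr => j _.
rewrite scaler_sumr (big_ord_widen N (fun i => a j *: (G ^+ (j.-1 - i) *m (alpha + xi (k + i)%N)))).
  by apply: eq_bigr => i _; rewrite scalemxAl.
by rewrite -ltnS ltn_ord.
Qed.

Definition ma_offset : 'cV[R]_(1 + N) :=
  col_mx (\sum_(j < N.+1) a j)%:M (\sum_(i < N) ma_coef i *m alpha).

Definition ma_input (i : nat) : 'M[R]_(1 + N, N) := col_mx 0 (ma_coef i *m B).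
Definition ma_noise (i : nat) : 'M[R]_(1 + N, N) := col_mx 0 (ma_coef i).

Lemma filtered_regressor k (u w : nat -> 'cV[R]_N) (q : 'rV[R]_(1 + N)) :
  (forall k, xi k = B *m u k + w k) ->
  \sum_(j < N.+1) a j * (q *m regressor x (k + j)%N) 0 0 =
  (q *m ma_offset) 0 0 +
  \sum_(i < N) (q *m ma_input i *m u (k + i)%N) 0 0 +
  \sum_(i < N) (q *m ma_noise i *m w (k + i)%N) 0 0.
Proof.
move=> xiE; rewrite -[q]hsubmxK; set q0 := lsubmx q; set q1 := rsubmx q.
have -> : \sum_(j < N.+1) a j * (row_mx q0 q1 *m regressor x (k + j)%N) 0 0 =
  (q0 *m (\sum_(j < N.+1) a j)%:M + q1 *m \sum_(j < N.+1) a j *: x (k + j)%N) 0 0.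
  rewrite [RHS]mxE mul_mx_scalar [in RHS]mxE mulmx_sumr summxE mulr_suml -big_split /=.
  apply: eq_bigr => j _; rewrite /regressor mul_row_col mulmx1 mxE mulrDr.
  by rewrite -scalemxAr; congr (_ + _); rewrite [RHS]mxE.
rewrite filtered_state /ma_offset /ma_input /ma_noise.
under [X in _ = _ + X + _]eq_bigr do rewrite mul_row_col mulmx0 add0r.
under [X in _ = _ + X]eq_bigr do rewrite mul_row_col mulmx0 add0r.
have addE (P Q : 'M[R]_1) : P 0 0 + Q 0 0 = (P + Q) 0 0 by rewrite mxE.
rewrite mul_row_col !mulmx_sumr -!summxE !addE; congr (fun_of_matrix _ 0 0).
rewrite -!addrA; congr (_ + _); rewrite -!big_split /=; apply: eq_bigr => i _.
by rewrite xiE !mulmxDr !mulmxA.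
Qed.

Hypothesis ctrl : controllable G B.
Hypothesis regular : 1%:M - G \in unitmx.

Lemma char_poly_at1 : \sum_(j < N.+1) a j = \det (1%:M - G).
Proof.
have -> : \det (1%:M - G) = (char_poly G).[1].
  rewrite /char_poly -horner_evalE -det_map_mx /=; congr (\det _).
  apply/matrixP => i j; rewrite !mxE /horner_eval /= hornerD hornerN !hornerC.
  by rewrite hornerMn hornerX.
rewrite horner_coef char_poly_size; apply: eq_bigr => j _.
by rewrite expr1n mulr1.
Qed.

(** [ma_coef (N - 1 - m)] is [G ^ m] plus lower powers of [G], so the rows
    [q1 G ^ m B] vanish one after the other. *)
Lemma ma_input_injective (q1 : 'rV[R]_N) :
  (forall i, (i < N)%N -> q1 *m (ma_coef i *m B) = 0) -> q1 = 0.
Proof.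
move=> h.
have step m : (m < N)%N -> q1 *m (G ^+ m *m B) = 0.
  elim/ltn_ind: m => m IH mN; have := h (N.-1 - m)%N.
  rewrite ltnS leq_subr => /(_ isT).
  rewrite /ma_coef mulmx_suml mulmx_sumr (bigD1 ord_max) /=; last by rewrite ltnS leq_subr.
  rewrite subKn // (_ : a N = 1); last first.
    by have := monicP (char_poly_monic G); rewrite lead_coefE char_poly_size.
  rewrite scale1r big1 ?addr0 // => j /andP[ij jN].
  have lt : (j.-1 - (N.-1 - m) < m)%N.
    move: jN (ltn_ord j) ij mN; rewrite -val_eqE /=; lia.
  by rewrite -scalemxAl -scalemxAr IH ?scaler0 // (ltn_trans lt).
have rf : row_free (\mxrow_(k < N) (G ^+ k *m B)) by apply/eqP.
apply: (row_free_inj rf); rewrite mul0mx mul_mxrow.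
apply/eqP; rewrite -[X in _ == X]mxrow0; apply/eqP; congr (mxrow _).
by apply/funext => k; exact: step.
Qed.

Definition excitation_form : 'M[R]_(1 + N) :=
  ma_offset *m ma_offset^T + \sum_(i < N) ma_input i *m (ma_input i)^T.

Lemma qform_excitation q :
  qform excitation_form q = sqn (q *m ma_offset) + \sum_(i < N) sqn (q *m ma_input i).
Proof.
rewrite qformD qform_outer qform_sum; congr (_ + _).
by apply: eq_bigr => i _; rewrite qform_outer.
Qed.

(** Controllability makes the response of the moving average to the inputs
    injective in the slope part of [q], and [det (1 - G) <> 0] then settles its
    constant part. *)
Lemma excitation_coercive : exists2 c, 0 < c & forall q : 'rV_(1 + N),
  c * sqn q <= sqn (q *m ma_offset) + \sum_(i < N) sqn (q *m ma_input i).
Proof.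
have Ksym : excitation_form^T = excitation_form.
  rewrite linearD linear_sum /= trmx_mul trmxK; congr (_ + _).
  by apply: eq_bigr => i _; rewrite trmx_mul trmxK.
have Kpsd : psd excitation_form.
  split=> // q; rewrite qform_excitation addr_ge0 ?sqn_ge0 // sumr_ge0 // => i _.
  exact: sqn_ge0.
have Ku : excitation_form \in unitmx.
  rewrite -row_free_unit; apply: inj_row_free => q qK.
  have : qform excitation_form q = 0 by rewrite /qform qK mul0mx mxE.
  rewrite qform_excitation => /eqP; rewrite paddr_eq0 ?sqn_ge0 //; last first.
    by apply: sumr_ge0 => i _; exact: sqn_ge0.
  case/andP => /eqP/sqn_eq0 q_off; rewrite psumr_eq0; last by move=> i _; exact: sqn_ge0.
  move/allP => q_in.
  have q1 : rsubmx q = 0.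
    apply: ma_input_injective => i iN.
    have /eqP/sqn_eq0 := q_in (Ordinal iN) (mem_index_enum _).
    by rewrite -{1}[q]hsubmxK mul_row_col mulmx0 add0r.
  have q0 : lsubmx q = 0.
    move: q_off; rewrite -{1}[q]hsubmxK q1 mul_row_col mul0mx addr0 char_poly_at1.
    rewrite mul_mx_scalar => /eqP; rewrite scaler_eq0 => /orP[|/eqP //].
    by move: regular; rewrite unitmxE unitfE => /negbTE ->.
  by rewrite -[q]hsubmxK q0 q1 row_mx0.
have [c c0 hc] := psd_unit_coercive Kpsd Ku.
by exists c => // q; rewrite -qform_excitation.
Qed.

End Filter.

(** * Excitation of the regressors *)

Section QuadraticLowerBound.
Context {R : realType} (J : finType).

Lemma bilinear_bound (I : finType) (c : J -> R) (e : I -> R) (m : J -> I -> R) (F : R) :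
  (forall p r, `|m p r| <= F) ->
  `|\sum_p \sum_r c p * e r * m p r| <= F * (\sum_p `|c p|) * (\sum_r `|e r|).
Proof.
move=> mF; apply: (le_trans (ler_norm_sum _ _ _)).
have -> : F * (\sum_p `|c p|) * (\sum_r `|e r|) = \sum_p \sum_r `|c p| * `|e r| * F.
  rewrite -mulrA mulr_suml mulr_sumr; apply: eq_bigr => p _.
  by rewrite !mulr_sumr; apply: eq_bigr => r _; rewrite mulrC.
apply: ler_sum => p _; apply: (le_trans (ler_norm_sum _ _ _)).
by apply: ler_sum => r _; rewrite !normrM ler_wpM2l // mulr_ge0.
Qed.

Lemma linear_bound (c : J -> R) (m : J -> R) (F : R) :
  (forall p, `|m p| <= F) -> `|\sum_p c p * m p| <= F * \sum_p `|c p|.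
Proof.
move=> mF; apply: (le_trans (ler_norm_sum _ _ _)); rewrite mulr_sumr ler_sum // => p _.
by rewrite normrM mulrC ler_wpM2r.
Qed.

(** Only the square of the [W]-part is discarded: the constant and the inputs
    [U] contribute their mean squares, and all cross terms are fluctuations. *)
Lemma quadratic_lower_bound (U W : nat -> J -> R) (D : nat -> J -> R) n (F b : R)
    (c e : J -> R) : 0 <= F ->
  (forall p, `|\sum_(1 <= k < n.+1) U k p| <= F) ->
  (forall p, `|\sum_(1 <= k < n.+1) W k p| <= F) ->
  (forall p r, `|\sum_(1 <= k < n.+1) U k p * W k r| <= F) ->
  (forall p r, `|\sum_(1 <= k < n.+1) (U k p * U k r - (p == r)%:R * D k p)| <= F) ->
  n%:R * b ^+ 2 + \sum_p c p ^+ 2 * \sum_(1 <= k < n.+1) D k p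
   - 2 * F * (`|b| + \sum_p `|c p| + \sum_p `|e p|) ^+ 2
  <= \sum_(1 <= k < n.+1) (b + \sum_p c p * U k p + \sum_p e p * W k p) ^+ 2.
Proof.
move=> F_ge0 FU FW FUW FUU.
pose a k := \sum_p c p * U k p; pose v k := \sum_p e p * W k p.
set Sc := \sum_p `|c p|; set Se := \sum_p `|e p|.
have Sc0 : 0 <= Sc by exact: sumr_ge0.
have Se0 : 0 <= Se by exact: sumr_ge0.
have [b2 b2E] : exists b2, b2 = b ^+ 2 by exists (b ^+ 2).
have h1 : \sum_(1 <= k < n.+1) (b2 + 2 * b * a k + 2 * b * v k + 2 * (a k * v k) + a k ^+ 2)
    <= \sum_(1 <= k < n.+1) (b + a k + v k) ^+ 2.
  by apply: ler_sum => k _; rewrite b2E; have := sqr_ge0 (v k); nra.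
apply: le_trans h1; rewrite !big_split /= -!mulr_sumr sumr_const_nat subn1 /= -(mulr_natl b2) b2E.
have Ea : `|\sum_(1 <= k < n.+1) a k| <= F * Sc.
  rewrite /a exchange_big /=; under eq_bigr do rewrite -mulr_sumr.
  exact: linear_bound.
have Ev : `|\sum_(1 <= k < n.+1) v k| <= F * Se.
  rewrite /v exchange_big /=; under eq_bigr do rewrite -mulr_sumr.
  exact: linear_bound.
have Eav : `|\sum_(1 <= k < n.+1) a k * v k| <= F * Sc * Se.
  have -> : \sum_(1 <= k < n.+1) a k * v k =
    \sum_p \sum_r c p * e r * \sum_(1 <= k < n.+1) U k p * W k r.
    under [RHS]eq_bigr do under eq_bigr do rewrite mulr_sumr.
    under [RHS]eq_bigr do rewrite exchange_big /=.
    rewrite [RHS]exchange_big /=; apply: eq_bigr => k _.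
    rewrite /a /v mulr_suml; apply: eq_bigr => p _.
    by rewrite mulr_sumr; apply: eq_bigr => r _; ring.
  exact: bilinear_bound.
have Eaa : `|\sum_(1 <= k < n.+1) a k ^+ 2 - \sum_p c p ^+ 2 * \sum_(1 <= k < n.+1) D k p|
     <= F * Sc * Sc.
  have -> : \sum_(1 <= k < n.+1) a k ^+ 2 - \sum_p c p ^+ 2 * \sum_(1 <= k < n.+1) D k p =
    \sum_p \sum_r c p * c r * \sum_(1 <= k < n.+1) (U k p * U k r - (p == r)%:R * D k p).
    under [X in _ = X]eq_bigr do under eq_bigr do rewrite sumrB mulrBr.
    under [X in _ = X]eq_bigr do rewrite sumrB.
    rewrite [RHS]sumrB; congr (_ - _).
      under [RHS]eq_bigr do under eq_bigr do rewrite mulr_sumr.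
      under [RHS]eq_bigr do rewrite exchange_big /=.
      rewrite [RHS]exchange_big /=; apply: eq_bigr => k _.
      rewrite expr2 /a mulr_suml; apply: eq_bigr => p _.
      by rewrite mulr_sumr; apply: eq_bigr => r _; ring.
    apply: eq_bigr => p _; rewrite [RHS](bigD1 p) //= [X in _ + X]big1 ?addr0.
      by rewrite expr2; congr (_ * _); apply: eq_bigr => k _; rewrite eqxx mul1r.
    move=> r /negbTE rp; rewrite big1 ?mulr0 // => k _.
    by rewrite eq_sym rp mul0r.
  exact: bilinear_bound.
have b0 := normr_ge0 b.
have Eba : - (`|b| * (F * Sc)) <= b * \sum_(1 <= k < n.+1) a k.
  rewrite lerNl (le_trans _ (ler_wpM2l b0 Ea)) // -normrM -normrN ler_norm //.
have Ebv : - (`|b| * (F * Se)) <= b * \sum_(1 <= k < n.+1) v k.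
  rewrite lerNl (le_trans _ (ler_wpM2l b0 Ev)) // -normrM -normrN ler_norm //.
move: Eav; rewrite ler_norml => /andP[Eav _].
move: Eaa; rewrite ler_norml => /andP[Eaa _].
have r1 : 0 <= F * `|b| ^+ 2 by rewrite mulr_ge0 ?sqr_ge0.
have r2 : 0 <= F * Sc ^+ 2 by rewrite mulr_ge0 ?sqr_ge0.
have r3 : 0 <= F * Se ^+ 2 by rewrite mulr_ge0 ?sqr_ge0.
have r4 : 0 <= F * `|b| * Sc by rewrite !mulr_ge0.
have r5 : 0 <= F * `|b| * Se by rewrite !mulr_ge0.
have r6 : 0 <= F * Sc * Se by rewrite !mulr_ge0.
move: Eba Ebv Eav Eaa r1 r2 r3 r4 r5 r6; clear.
set X := \sum_(1 <= k < n.+1) a k; set Y := \sum_(1 <= k < n.+1) v k.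
lra.
Qed.

End QuadraticLowerBound.

Lemma sum_nat_sub (R : numDomainType) (f : nat -> R) a b c d : (forall k, 0 <= f k) ->
  (c <= a)%N -> (a <= b)%N -> (b <= d)%N ->
  \sum_(a <= k < b) f k <= \sum_(c <= k < d) f k.
Proof.
move=> f0 ca ab bd.
rewrite (big_cat_nat (n := a) (p := d)) //=; last exact: leq_trans ab bd.
rewrite (big_cat_nat (m := a) (n := b) (p := d)) //=.
by rewrite addrCA lerDl addr_ge0 // sumr_ge0.
Qed.

Section Excitation.
Context {R : realType}.
Variables (N' : nat).
Local Notation N := N'.+1.
(* [w k] is the noise that drives [x k.+1]. *)
Variables (G B : 'M[R]_N) (alpha : 'cV[R]_N) (x u w : nat -> 'cV[R]_N).
Hypothesis x_rec : forall k, x k.+1 = alpha + G *m x k + (B *m u k + w k).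
Hypothesis ctrl : controllable G B.
Hypothesis regular : 1%:M - G \in unitmx.
Variables (eps sg2 K : R).
Hypothesis eps_ge0 : 0 <= eps.
Hypothesis eps_le : eps <= 9^-1.
Hypothesis sg2_gt0 : 0 < sg2.
Hypothesis K_ge0 : 0 <= K.
Hypothesis mean_u : forall n (i s : 'I_N), (0 < n)%N ->
  `|\sum_(1 <= k < n.+1) u (k + i)%N s 0| <= K * root72 n ^+ 55.
Hypothesis mean_w : forall n (i s : 'I_N), (0 < n)%N ->
  `|\sum_(1 <= k < n.+1) w (k + i)%N s 0| <= K * root72 n ^+ 55.
Hypothesis cov_uw : forall n (i s j t : 'I_N), (0 < n)%N ->
  `|\sum_(1 <= k < n.+1) u (k + i)%N s 0 * w (k + j)%N t 0| <= K * root72 n ^+ 55.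
Hypothesis cov_uu : forall n (i s j t : 'I_N), (0 < n)%N ->
  `|\sum_(1 <= k < n.+1) (u (k + i)%N s 0 * u (k + j)%N t 0 -
      ((i, s) == (j, t))%:R * (sg2 * (k + i)%:R `^ (- eps)))| <= K * root72 n ^+ 55.

Local Notation off := (ma_offset G alpha).
Local Notation Ain := (ma_input G B).
Local Notation Ano := (ma_noise G).
Local Notation a j := ((char_poly G)`_j).
Local Notation J := ('I_N * 'I_N)%type.

(** The filter is a linear combination of [N + 1] shifted samples, each of which is
    part of the sample of size [n + N]. *)
Lemma filter_energy n (q : 'rV[R]_(1 + N)) :
  \sum_(1 <= k < n.+1) ((q *m off) 0 0 +
     \sum_(i < N) (q *m Ain i *m u (k + i)%N) 0 0 +
     \sum_(i < N) (q *m Ano i *m w (k + i)%N) 0 0) ^+ 2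
  <= (\sum_(j < N.+1) a j ^+ 2) * N.+1%:R * qform (gram x (n + N)) q.
Proof.
set A2 := \sum_(j < N.+1) a j ^+ 2.
have A20 : 0 <= A2 by apply: sumr_ge0 => j _; exact: sqr_ge0.
apply: (@le_trans _ _ (\sum_(1 <= k < n.+1)
    A2 * \sum_(j < N.+1) (q *m regressor x (k + j)%N) 0 0 ^+ 2)).
  apply: ler_sum => k _.
  rewrite -(filtered_regressor x_rec k q (fun k => erefl)).
  exact: sum_cauchy_schwarz.
rewrite -mulr_sumr -mulrA ler_wpM2l // exchange_big /=.
have -> : N.+1%:R * qform (gram x (n + N)) q = \sum_(j < N.+1) qform (gram x (n + N)) q.
  by rewrite sumr_const card_ord mulr_natl.
apply: ler_sum => j _; rewrite qform_gram.
under [leRHS]eq_bigr do rewrite sqn_scal.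
have -> : \sum_(1 <= k < n.+1) (q *m regressor x (k + j)%N) 0 0 ^+ 2 =
   \sum_(1 + j <= k < n.+1 + j) (q *m regressor x k) 0 0 ^+ 2.
  by rewrite big_addn addnK.
by apply: sum_nat_sub => [k|||]; rewrite ?sqr_ge0 //; have := ltn_ord j; lia.
Qed.

(** The smallest input variance in the window, relative to [sg2]. *)
Let gam n : R := (n + N)%:R `^ (- eps).

Lemma gam_le k i n : (k <= n)%N -> (i < N)%N -> (0 < k)%N -> gam n <= (k + i)%:R `^ (- eps).
Proof.
move=> kn iN k0; rewrite /gam !powRN lef_pV2 ?posrE ?powR_gt0 ?ltr0n ?addn_gt0 ?k0 ?orbT //.
rewrite ge0_ler_powR ?nnegrE // ler_nat; lia.
Qed.

Lemma gam_le1 n : gam n <= 1.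
Proof.
rewrite /gam powRN invf_le1 ?powR_gt0 ?ltr0n ?addnS //.
apply: (@le_trans _ _ (1 `^ eps)); first by rewrite powR1.
by rewrite ge0_ler_powR ?nnegrE // ler1n.
Qed.

Lemma gam_ge n : (0 < n)%N -> (N.+1%:R * root72 n ^+ 8)^-1 <= gam n.
Proof.
move=> n0; have h1 := root72_ge1 (R := R) n0.
rewrite /gam powRN lef_pV2 ?posrE ?powR_gt0 ?ltr0n ?addnS //; last first.
  by rewrite mulr_gt0 // exprn_gt0 // (lt_le_trans ltr01).
apply: (@le_trans _ _ ((N.+1 * n)%:R `^ 9^-1)).
  apply: (@le_trans _ _ ((n + N)%:R `^ 9^-1)).
    by rewrite addnS ler_powR // ler1n.
  by rewrite ge0_ler_powR ?nnegrE ?invr_ge0 // ler_nat mulSn leq_add2l leq_pmulr.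
rewrite natrM powRM //; apply: ler_pM; rewrite ?powR_ge0 //.
  apply: (@le_trans _ _ (N.+1%:R `^ 1)); last by rewrite powRr1.
  by rewrite ler_powR ?ler1n // invf_le1 // ler1n.
rewrite -root72X -powR_mulrn ?root72_ge0 // -powRrM.
have -> : 72%:R * 9^-1 = 8%:R :> R by lra.
by rewrite powR_mulrn ?root72_ge0.
Qed.

(** The input energy [n * gam n] is of order at least [n ^ (1 - 1/9)], that is
    [root72 n ^ 64], and exceeds the fluctuations, of order [root72 n ^ 55]. *)
Lemma excitation_bound : exists2 c : R, 0 < c &
  \forall n \near \oo, forall q : 'rV[R]_(1 + N),
    c * root72 n ^+ 64 * sqn q <= qform (gram x n) q.
Proof.
have [c c0 hc] := excitation_coercive alpha ctrl regular.
(* The characteristic polynomial is monic, hence [kap > 0]. *)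
pose kap : R := (\sum_(j < N.+1) a j ^+ 2) * N.+1%:R.
have kap0 : 0 < kap.
  rewrite mulr_gt0 // (bigD1 ord_max) //= ltr_pwDl ?exprn_gt0 //.
    by have := monicP (char_poly_monic G); rewrite lead_coefE char_poly_size => ->.
  by apply: sumr_ge0 => j _; exact: sqr_ge0.
pose nJ : R := #|{: J}|%:R.
pose C1 : R := 3 * (sqn off + nJ * (\sum_(i < N) sqn (Ain i)) + nJ * (\sum_(i < N) sqn (Ano i))).
pose d : R := Num.min 1 sg2 * c.
have d0 : 0 < d by rewrite mulr_gt0 // lt_min ltr01.
pose C2 : R := 2 * K * C1.
have lower n (q : 'rV[R]_(1 + N)) : (0 < n)%N ->
    (d * (n%:R * gam n) - C2 * root72 n ^+ 55) * sqn q <= kap * qform (gram x (n + N)) q.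
  move=> n0; apply: le_trans (filter_energy n q).
  pose b := (q *m off) 0 0.
  pose U k (p : J) := u (k + p.1)%N p.2 0; pose W k (p : J) := w (k + p.1)%N p.2 0.
  pose D k (p : J) := sg2 * (k + p.1)%:R `^ (- eps).
  pose ci (p : J) := (q *m Ain p.1) 0 p.2; pose ei (p : J) := (q *m Ano p.1) 0 p.2.
  pose F := K * root72 n ^+ 55 : R.
  have F0 : 0 <= F by rewrite mulr_ge0 // exprn_ge0 // root72_ge0.
  have Ec k : \sum_(i < N) (q *m Ain i *m u (k + i)%N) 0 0 = \sum_p ci p * U k p.
    rewrite -(pair_bigA _ (fun i s => ci (i, s) * U k (i, s))) /=.
    by apply: eq_bigr => i _; rewrite mxE.
  have Ee k : \sum_(i < N) (q *m Ano i *m w (k + i)%N) 0 0 = \sum_p ei p * W k p.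
    rewrite -(pair_bigA _ (fun i s => ei (i, s) * W k (i, s))) /=.
    by apply: eq_bigr => i _; rewrite mxE.
  under eq_bigr do rewrite Ec Ee -/b.
  have := @quadratic_lower_bound R J U W D n F b ci ei F0.
  move=> /(_ (fun p => mean_u p.1 p.2 n0) (fun p => mean_w p.1 p.2 n0)).
  move=> /(_ (fun p r => cov_uw p.1 p.2 r.1 r.2 n0)).
  have FUU (p r : J) : `|\sum_(1 <= k < n.+1) (U k p * U k r - (p == r)%:R * D k p)| <= F.
    by case: p r => [i s] [j t]; exact: cov_uu.
  move=> /(_ FUU); apply: le_trans.
  have sq_c : \sum_p ci p ^+ 2 = \sum_(i < N) sqn (q *m Ain i).
    rewrite -(pair_bigA _ (fun i s => ci (i, s) ^+ 2)) /=.
    by apply: eq_bigr => i _; rewrite sqn_rowE.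
  have sq_e : \sum_p ei p ^+ 2 = \sum_(i < N) sqn (q *m Ano i).
    rewrite -(pair_bigA _ (fun i s => ei (i, s) ^+ 2)) /=.
    by apply: eq_bigr => i _; rewrite sqn_rowE.
  have b2 : b ^+ 2 = sqn (q *m off) by rewrite sqn_scal.
  have g0 : 0 <= gam n by exact: powR_ge0.
  have main : d * (n%:R * gam n) * sqn q <=
      n%:R * b ^+ 2 + \sum_p ci p ^+ 2 * \sum_(1 <= k < n.+1) D k p.
    apply: (@le_trans _ _ (Num.min 1 sg2 * (n%:R * gam n) * (b ^+ 2 + \sum_p ci p ^+ 2))).
      have := hc q; rewrite -b2 -sq_c => h.
      have -> : d * (n%:R * gam n) * sqn q = Num.min 1 sg2 * (n%:R * gam n) * (c * sqn q).
        by rewrite /d; ring.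
      by rewrite ler_wpM2l // mulr_ge0 ?mulr_ge0 // le_min ler01 ltW.
    rewrite mulrDr lerD //.
      rewrite ler_wpM2r ?sqr_ge0 // -[leRHS]mul1r ler_pM //.
      - by rewrite le_min ler01 ltW.
      - by rewrite mulr_ge0.
      - by rewrite ge_min lexx.
      by rewrite ler_piMr // gam_le1.
    rewrite mulr_sumr ler_sum // => p _; rewrite mulrC ler_wpM2l ?sqr_ge0 //.
    apply: (@le_trans _ _ (\sum_(1 <= k < n.+1) sg2 * gam n)).
      rewrite sumr_const_nat subn1 /= -[leRHS]mulr_natl mulrCA ler_wpM2l //.
      by rewrite ler_wpM2r // ge_min lexx orbT.
    rewrite big_nat [leRHS]big_nat; apply: ler_sum => k /andP[k1 kn].
    rewrite ler_wpM2l ?(ltW sg2_gt0) // gam_le //.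
  rewrite mulrBl; apply: lerB; first exact: main.
  have tri (u1 v1 w1 : R) : (u1 + v1 + w1) ^+ 2 <= 3 * (u1 ^+ 2 + v1 ^+ 2 + w1 ^+ 2).
    by have := sqr_ge0 (u1 - v1); have := sqr_ge0 (v1 - w1); have := sqr_ge0 (u1 - w1); nra.
  have l1 (f : J -> R) : (\sum_p `|f p|) ^+ 2 <= nJ * \sum_p f p ^+ 2.
    have := sum_cauchy_schwarz (index_enum _) predT (fun=> 1) (fun p : J => `|f p|).
    under eq_bigr do rewrite mul1r.
    move/le_trans; apply; rewrite expr1n sumr_const ler_wpM2l // ler_sum // => p _.
    by rewrite real_normK ?num_real.
  have T : (`|b| + \sum_p `|ci p| + \sum_p `|ei p|) ^+ 2 <= C1 * sqn q.
    apply: (le_trans (tri _ _ _)); rewrite /C1 -mulrA ler_wpM2l // !mulrDl.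
    rewrite lerD //; first rewrite lerD //.
    - by rewrite real_normK ?num_real // b2 mulrC sqnM.
    - apply: (le_trans (l1 _)); rewrite -mulrA ler_wpM2l // sq_c mulr_suml ler_sum // => i _.
      by rewrite mulrC sqnM.
    - apply: (le_trans (l1 _)); rewrite -mulrA ler_wpM2l // sq_e mulr_suml ler_sum // => i _.
      by rewrite mulrC sqnM.
  have -> : C2 * root72 n ^+ 55 * sqn q = 2 * F * (C1 * sqn q) by rewrite /C2 /F; ring.
  by rewrite ler_wpM2l // mulr_ge0.
pose c1 : R := d / N.+1%:R.
have c10 : 0 < c1 by rewrite divr_gt0.
exists (c1 / 2 / kap / 2 ^+ 64); first by rewrite !divr_gt0 // exprn_gt0.
have lower2 : \forall n \near \oo, forall q : 'rV[R]_(1 + N),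
    c1 / 2 / kap * root72 n ^+ 64 * sqn q <= qform (gram x (n + N)) q.
  near=> n => q.
  have n0 : (0 < n)%N by near: n; exact: nbhs_infty_gt.
  have h1 : 1 <= root72 n :> R by exact: root72_ge1.
  have h0 : 0 < root72 n :> R by exact: lt_le_trans ltr01 h1.
  have -> : c1 / 2 / kap * root72 n ^+ 64 * sqn q = c1 / 2 * root72 n ^+ 64 * sqn q / kap by ring.
  rewrite ler_pdivrMr // [leRHS]mulrC; apply: le_trans (lower n q n0).
  rewrite ler_wpM2r ?sqn_ge0 //.
  have e1 : c1 * root72 n ^+ 64 <= d * (n%:R * gam n).
    rewrite /c1 -mulrA ler_wpM2l ?(ltW d0) //.
    apply: le_trans (ler_wpM2l _ (gam_ge n0)) => //.
    rewrite -root72X le_eqVlt; apply/orP; left; apply/eqP; field.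
    by rewrite gt_eqF //= gt_eqF // ltr_wpDr.
  have e2 : C2 * root72 n ^+ 55 <= c1 / 2 * root72 n ^+ 64.
    have -> : root72 n ^+ 64 = root72 n ^+ 9 * root72 n ^+ 55 :> R by ring.
    rewrite mulrA ler_wpM2r ?exprn_ge0 ?(ltW h0) //.
    apply: (@le_trans _ _ (c1 / 2 * root72 n)).
      rewrite -ler_pdivrMl ?divr_gt0 //; near: n; exact: near_root72_ge.
    apply: ler_wpM2l; first by apply: divr_ge0 => //; exact: ltW.
    by rewrite exprS ler_peMr ?exprn_ege1 // ltW.
  have -> : c1 / 2 * root72 n ^+ 64 = c1 * root72 n ^+ 64 - c1 / 2 * root72 n ^+ 64 by field.
  exact: lerB.
(* The filter window looks [N] steps ahead: the bound at [m] is read off at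
   [m - N >= m / 2], at the price of the factor [2 ^ 64]. *)
have [m0 _ hm0] := lower2.
exists (m0 + 2 * N)%N => // m /= mm q.
have mN : m = ((m - N) + N)%N by lia.
have mge : (m0 <= m - N)%N by lia.
have := hm0 (m - N)%N mge q; rewrite -mN; apply: le_trans.
rewrite ler_wpM2r ?sqn_ge0 // -[leLHS]mulrA; apply: ler_wpM2l.
  by apply: divr_ge0; [apply: divr_ge0 => // |]; exact: ltW.
rewrite mulrC ler_pdivrMr ?exprn_gt0 // mulrC -exprMn.
apply: lerXn2r; rewrite ?nnegrE ?mulr_ge0 ?root72_ge0 //.
have -> : 2 = (2 ^+ 72 : R) `^ 72^-1.
  by rewrite -powR_mulrn // -powRrM mulfV // powRr1.
rewrite /root72 -powRM // ge0_ler_powR ?nnegrE ?invr_ge0 ?mulr_ge0 //.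
rewrite -natrX -natrM ler_nat.
apply: (@leq_trans (2 * (m - N))); first lia.
by rewrite leq_mul2r (leq_pexp2l (m := 2) (n1 := 1)) ?orbT.
Unshelve. all: by end_near. Qed.
End Excitation.

(** * Square integrable random variables *)

Section Expectation.
Context d (T : measurableType d) (R : realType) (P : probability T R).
Implicit Types X Y : T -> R.

Definition itg X := P.-integrable setT (EFin \o X).
Definition mean X : R := \int[P]_t X t.
Definition L2 X := measurable_fun setT X /\ itg (fun t => X t ^+ 2).

Lemma itg_measurable X : itg X -> measurable_fun setT X.
Proof. by move/integrableP => [/measurable_EFinP]. Qed.

Lemma itg_le X Y : measurable_fun setT X -> itg Y ->
  (forall t, `|X t| <= Y t) -> itg X.
Proof.
move=> mX iY XY; apply: le_integrable iY => //; first exact/measurable_EFinP.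
by move=> t _; rewrite lee_fin (le_trans (XY t)) // ler_norm.
Qed.

Lemma itgD X Y : itg X -> itg Y -> itg (fun t => X t + Y t).
Proof.
move=> iX iY; have := integrableD measurableT iX iY.
by apply: eq_integrable => // t _; rewrite /= EFinD.
Qed.

Lemma itgZ c X : itg X -> itg (fun t => c * X t).
Proof.
move=> iX; have := integrableZl measurableT c iX.
by apply: eq_integrable => // t _; rewrite /= EFinM.
Qed.

Lemma itg_cst c : itg (fun=> c).
Proof. exact: finite_measure_integrable_cst. Qed.

Lemma itg_sum (I : Type) (r : seq I) (p : pred I) (X : I -> T -> R) :
  (forall i, p i -> itg (X i)) -> itg (fun t => \sum_(i <- r | p i) X i t).
Proof.
move=> iX; have := integrable_sum measurableT r iX.
by apply: eq_integrable => // t _; rewrite /= sumEFin.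
Qed.

Lemma meanD X Y : itg X -> itg Y -> mean (fun t => X t + Y t) = mean X + mean Y.
Proof. by move=> iX iY; exact: RintegralD. Qed.

Lemma meanZ c X : itg X -> mean (fun t => c * X t) = c * mean X.
Proof. by move=> iX; exact: RintegralZl. Qed.

Lemma mean_cst c : mean (fun=> c) = c.
Proof.
rewrite /mean Rintegral_cst; last exact: measurableT.
rewrite -[RHS]mulr1; congr (_ * _).
exact: (congr1 fine (@probability_setT _ _ _ P)).
Qed.

Lemma mean_sum (I : Type) (r : seq I) (p : pred I) (X : I -> T -> R) :
  (forall i, p i -> itg (X i)) ->
  mean (fun t => \sum_(i <- r | p i) X i t) = \sum_(i <- r | p i) mean (X i).
Proof.
move=> iX; elim: r => [|i r IH].
  rewrite big_nil -[RHS](mean_cst 0); congr mean; apply/funext => t; exact: big_nil.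
rewrite big_cons; case: ifPn => pi.
  rewrite -IH -meanD; [|exact: iX|exact: itg_sum].
  by congr mean; apply/funext => t; rewrite big_cons pi.
by rewrite -IH; congr mean; apply/funext => t; rewrite big_cons (negbTE pi).
Qed.

Lemma mean_le X Y : itg X -> itg Y -> (forall t, X t <= Y t) -> mean X <= mean Y.
Proof. by move=> iX iY XY; apply: le_Rintegral => // t _. Qed.

Lemma mean_ge0 X : (forall t, 0 <= X t) -> 0 <= mean X.
Proof. by move=> X0; apply: Rintegral_ge0 => t _. Qed.

Lemma meanE X : itg X -> (\int[P]_t (X t)%:E)%E = (mean X)%:E.
Proof. by move=> iX; rewrite fineK //; exact: integrable_fin_num. Qed.

Lemma itg_mulL2 X Y : L2 X -> L2 Y -> itg (fun t => X t * Y t).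
Proof.
move=> [mX iX] [mY iY]; apply: itg_le (itgD iX iY) _.
  exact: measurable_funM.
move=> t; rewrite ler_norml; apply/andP; split.
  by have := sqr_ge0 (X t + Y t); have := sqr_ge0 (X t); have := sqr_ge0 (Y t); nra.
by have := sqr_ge0 (X t - Y t); have := sqr_ge0 (X t); have := sqr_ge0 (Y t); nra.
Qed.

Lemma L2_le X Y : measurable_fun setT X -> L2 Y -> (forall t, `|X t| <= `|Y t|) -> L2 X.
Proof.
move=> mX [mY iY] XY; split=> //; apply: itg_le iY _; first exact: measurable_funX.
move=> t; rewrite ger0_norm ?sqr_ge0 // -[X t ^+ 2]real_normK ?num_real //.
by rewrite -[Y t ^+ 2]real_normK ?num_real // ler_sqr ?nnegrE.
Qed.

Lemma L2D X Y : L2 X -> L2 Y -> L2 (fun t => X t + Y t).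
Proof.
move=> [mX iX] [mY iY]; split; first exact: measurable_funD.
apply: itg_le (itgZ 2 (itgD iX iY)) _.
  by apply: measurable_funX; exact: measurable_funD.
move=> t; rewrite ger0_norm ?sqr_ge0 //.
by have := sqr_ge0 (X t - Y t); nra.
Qed.

Lemma L2_cst c : L2 (fun=> c).
Proof. by split; [exact: measurable_cst | exact: itg_cst]. Qed.

Lemma L2_bounded X c : measurable_fun setT X -> (forall t, `|X t| <= c) -> L2 X.
Proof.
move=> mX Xc; apply: L2_le (L2_cst c) _ => // t.
by rewrite (le_trans (Xc t)) // ler_norm.
Qed.

Lemma L2_mul_bounded X Y c : L2 X -> measurable_fun setT Y -> (forall t, `|Y t| <= c) ->
  L2 (fun t => Y t * X t).
Proof.
move=> [mX iX] mY Yc; split; first exact: measurable_funM.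
apply: itg_le (itgZ (c ^+ 2) iX) _.
  by apply: measurable_funX; exact: measurable_funM.
move=> t; rewrite ger0_norm ?sqr_ge0 // exprMn ler_wpM2r ?sqr_ge0 //.
by rewrite -[Y t ^+ 2]real_normK ?num_real // ler_sqr ?nnegrE // (le_trans _ (Yc t)).
Qed.

Lemma L2Z c X : L2 X -> L2 (fun t => c * X t).
Proof.
move=> [mX iX]; apply: (@L2_mul_bounded _ (fun=> c) `|c|) => //.
Qed.

Lemma L2_sum (I : Type) (r : seq I) (p : pred I) (X : I -> T -> R) :
  (forall i, p i -> L2 (X i)) -> L2 (fun t => \sum_(i <- r | p i) X i t).
Proof.
move=> iX; elim: r => [|i r IH].
  rewrite [X in L2 X](_ : _ = fun=> 0); first exact: L2_cst.
  by apply/funext => t; exact: big_nil.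
have [pi|npi] := boolP (p i).
  rewrite [X in L2 X](_ : _ = fun t => X i t + \sum_(i <- r | p i) X i t).
    by apply: L2D => //; exact: iX.
  by apply/funext => t; rewrite big_cons pi.
rewrite [X in L2 X](_ : _ = fun t => \sum_(i <- r | p i) X i t) //.
by apply/funext => t; rewrite big_cons (negbTE npi).
Qed.

Lemma L2_itg X : L2 X -> itg X.
Proof.
move=> LX; have := itg_mulL2 LX (L2_cst 1).
by congr itg; apply/funext => t; rewrite mulr1.
Qed.

(** Summable means give a bounded sequence almost surely: the sum of the
    sequence has a finite integral, hence is finite almost everywhere. *)
Lemma ae_bounded (X : nat -> T -> R) (M : R) :
  (forall j t, 0 <= X j t) -> (forall j, itg (X j)) ->
  (forall n, \sum_(j < n) mean (X j) <= M) ->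
  {ae P, forall t, exists K, forall j, X j t <= K}.
Proof.
move=> X0 iX sumM.
pose S t := (\sum_(j <oo) (X j t)%:E)%E.
have mX j : measurable_fun setT (EFin \o X j) by exact/measurable_EFinP/itg_measurable.
have S0 t : (0 <= S t)%E by apply: nneseries_ge0 => j _ _; rewrite lee_fin.
have iS : P.-integrable setT S.
  apply/integrableP; split.
    apply: (@ge0_emeasurable_sum _ _ _ setT (fun j t => (X j t)%:E) xpredT) => [j t _ _|j _].
      by rewrite lee_fin.
    exact: mX.
  under eq_integral do rewrite gee0_abs //.
  rewrite integral_nneseries //; last by move=> j t _; rewrite lee_fin.
  apply: (@le_lt_trans _ _ M%:E); last exact: ltry.
  apply: lime_le; first by apply: is_cvg_nneseries => j _ _; apply: integral_ge0 => t _; rewrite lee_fin.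
  apply: nearW => n; rewrite big_mkord.
  under eq_bigr do rewrite meanE //.
  by rewrite sumEFin lee_fin.
have := integrable_ae measurableT iS; apply: filterS => t /(_ I) Sfin.
exists (fine (S t)) => j; rewrite -lee_fin fineK //.
have := @nneseries_lim_ge R (fun j => (X j t)%:E) xpredT 0 j.+1.
rewrite big_nat_recr //= => h; apply: (le_trans _ (h _)) => [|k _ _]; last by rewrite lee_fin.
by rewrite leeDr // sume_ge0 // => k _; rewrite lee_fin.
Qed.

End Expectation.

(** * Independence *)

Section PairIndependence.
Context d (T : measurableType d) (R : realType) (P : probability T R).
Local Open Scope ereal_scope.

(** The joint law of an independent pair is the product of the marginal laws,
    so Fubini factors the expectation of the product. *)
Lemma mean_mul_rv (X Y : {RV P >-> R}) :
  (forall A B, measurable A -> measurable B ->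
     P (X @^-1` A `&` Y @^-1` B) = P (X @^-1` A) * P (Y @^-1` B)) ->
  itg P X -> itg P Y -> itg P (fun t => X t * Y t)%R ->
  mean P (fun t => X t * Y t)%R = (mean P X * mean P Y)%R.
Proof.
move=> indep iX iY iXY.
pose Z t := (X t, Y t).
have mZ : measurable_fun [set: T] Z by exact: measurable_fun_pair.
pose Z' : {RV P >-> (R * R)%type} := mfun_Sub (mem_set mZ).
pose f (z : R * R) := (z.1 * z.2)%:E.
have mf : measurable_fun [set: R * R] f.
  by apply/measurable_EFinP; apply: measurable_funM.
have laws A : measurable A -> A `<=` setT ->
   (distribution P X \x distribution P Y) A = distribution P Z' A.
  by move=> mA _; apply: product_measure_unique => // A1 A2 mA1 mA2; exact: indep.
have fint : (distribution P Z').-integrable setT f.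
  by apply: integrable_pushforward => //; exact: iXY.
have fint2 : (distribution P X \x distribution P Y).-integrable setT f.
  move/integrableP: fint => [_ fint]; apply/integrableP; split => //.
  by rewrite (eq_measure_integral (distribution P Z')).
have e1 : \int[P]_t (X t * Y t)%:E =
    \int[distribution P X \x distribution P Y]_z f z.
  rewrite (eq_measure_integral (distribution P Z')) // integral_distribution //.
have iY' : (distribution P Y).-integrable setT (EFin \o (id : R -> R)).
  by apply: integrable_pushforward => //; exact/measurable_EFinP.
have iX' : (distribution P X).-integrable setT (EFin \o (id : R -> R)).
  by apply: integrable_pushforward => //; exact/measurable_EFinP.
have eY : \int[distribution P Y]_y y%:E = (mean P Y)%:E.
  rewrite -(meanE iY) (integral_distribution (X := Y) (f := EFin)) //.
have eX : \int[distribution P X]_x x%:E = (mean P X)%:E.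
  rewrite -(meanE iX) (integral_distribution (X := X) (f := EFin)) //.
apply: EFin_inj; rewrite EFinM -(meanE iXY) e1.
rewrite -integral12_prod_meas1 // /fubini_F.
under eq_integral => x _.
  rewrite /f /=; under eq_integral do rewrite EFinM.
  rewrite integralZl // eY; over.
by rewrite /= integralZr // eX.
Qed.

Lemma mean_mul_indep (X Y : T -> R) :
  (forall A B, measurable A -> measurable B ->
     P (X @^-1` A `&` Y @^-1` B) = P (X @^-1` A) * P (Y @^-1` B)) ->
  itg P X -> itg P Y -> itg P (fun t => X t * Y t)%R ->
  mean P (fun t => X t * Y t)%R = (mean P X * mean P Y)%R.
Proof.
move=> indep iX iY iXY.
pose X' : {RV P >-> R} := mfun_Sub (mem_set (itg_measurable iX)).
pose Y' : {RV P >-> R} := mfun_Sub (mem_set (itg_measurable iY)).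
exact: (@mean_mul_rv X' Y').
Qed.

End PairIndependence.

Section BorelVectors.
Context (R : realType) (N : nat).

Definition borelType := g_sigma_algebraType (@open 'cV[R]_N).

Definition borel_fun (g : 'cV[R]_N -> R) :=
  measurable_fun (setT : set borelType) (g : borelType -> R).

Lemma borel_fun_preimage g B : borel_fun g -> measurable B -> borel N (g @^-1` B).
Proof. by move=> mg mB; have := mg measurableT B mB; rewrite setTI. Qed.

Lemma borelT : borel N (setT : set 'cV[R]_N).
Proof. exact: (@measurableT _ borelType). Qed.

Lemma borelI (A B : set 'cV[R]_N) : borel N A -> borel N B -> borel N (A `&` B).
Proof. exact: (@measurableI _ borelType). Qed.

Lemma borel_coord i : borel_fun (fun v => v i 0).
Proof.
apply: (measurability _ (RGenOpens.measurableE R)).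
move=> _ [_ [a [b ->] <-]]; rewrite setTI; apply: sub_sigma_algebra.
have /continuousP := @coord_continuous R N 1 i 0; apply.
exact: interval_open.
Qed.

End BorelVectors.

Section FamilyIndependence.
Context d (T : measurableType d) (R : realType) (P : probability T R).
Variables (I : choiceType) (N : nat) (X : I -> T -> 'cV[R]_N).
Hypothesis X_meas : forall i, random_vector (X i).
Hypothesis X_indep : mutually_independent P X.
Variable i0 : I.

Local Notation borel := (@borel R N) (only parsing).

(** A pi-system generating the sigma-algebra of the family without [X i0]. *)
Definition cylinders : set (set T) :=
  [set E | exists (s : seq I) (A : I -> set 'cV[R]_N),
    [/\ uniq s, i0 \notin s, forall i, borel (A i) &
        E = \bigcap_(i in [set` s]) (X i @^-1` A i)]].

Lemma cylinders_setI : setI_closed cylinders.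
Proof.
move=> _ _ [s [A [us i0s mA ->]]] [r [B [ur i0r mB ->]]].
exists (undup (s ++ r)).
exists (fun i => (if i \in s then A i else setT) `&` (if i \in r then B i else setT)).
split; [exact: undup_uniq | by rewrite mem_undup mem_cat negb_or i0s i0r | |].
  by move=> i; apply: borelI; case: ifP => // _; exact: borelT.
apply/seteqP; split=> t /=.
  move=> [h1 h2] i /= _; split; case: ifP => //; [exact: h1 | exact: h2].
move=> h; split=> i /= ir.
  by have [] := h i; rewrite /= ?mem_undup ?mem_cat ?ir.
by have [] := h i; rewrite /= ?mem_undup ?mem_cat ?ir ?orbT.
Qed.

Lemma cylinders_measurable : cylinders `<=` measurable.
Proof.
move=> _ [s [A [_ _ mA ->]]]; rewrite classical_sets.bigcap_seq.
by apply: bigsetI_measurable => i _; exact: X_meas.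
Qed.

Lemma cylinders_setT : cylinders setT.
Proof.
exists [::], (fun=> setT); split=> //; first by move=> i; exact: borelT.
by apply/seteqP; split.
Qed.

Definition others := g_sigma_algebraType cylinders.

Lemma others_measurable (E : set T) : <<s cylinders >> E -> measurable E.
Proof.
apply: smallest_sub; last exact: cylinders_measurable.
exact: sigma_algebra_measurable.
Qed.

(** Both sides, as functions of [E], are finite measures; they agree on the
    pi-system. *)
Lemma others_indep (A : set 'cV[R]_N) (E : set T) : borel A ->
  <<s cylinders >> E -> P (X i0 @^-1` A `&` E) = (P (X i0 @^-1` A) * P E)%E.
Proof.
move=> mA sE; set F := X i0 @^-1` A.
have mF : measurable F by exact: X_meas.
have PF0 : 0 <= fine (P F) by apply: fine_ge0.
pose m1 : {measure set T -> \bar R} := mrestr P mF.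
pose m2 : {measure set T -> \bar R} := mscale (NngNum PF0) P.
have PFE : (fine (P F))%:E = P F by rewrite fineK // fin_num_measure.
have GE : [set G | cylinders G /\ G `<=` setT] = cylinders.
  by apply/seteqP; split=> [G [] | G].
have main G : cylinders G -> m1 G = m2 G.
  move=> [s [B [us i0s mB ->]]].
  rewrite /m1 /m2 /= /mrestr /mscale /= PFE.
  have := X_indep (s := i0 :: s) (A := fun i => if i == i0 then A else B i).
  rewrite cons_uniq i0s us big_cons eqxx => /(_ isT).
  have -> : (\prod_(i <- s) P (X i @^-1` (if i == i0 then A else B i)) =
      \prod_(i <- s) P (X i @^-1` B i))%E.
    apply: eq_big_seq => i si; case: eqP => // ei.
    by move: i0s; rewrite -ei si.
  rewrite -(X_indep us mB) => <-; last by move=> i; case: ifP.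
  congr (P _); apply/seteqP; split=> t /=.
    move=> [h Ft] i /=; rewrite inE => /orP[/eqP ->|si]; first by rewrite eqxx.
    by case: eqP => [->|_] //; exact: h.
  move=> h; split; last by have := h i0; rewrite /= mem_head eqxx; exact.
  move=> i si; have := h i; rewrite /= inE si orbT => /(_ isT).
  by case: eqP => // ei; move: i0s; rewrite -ei si.
have := @g_sigma_algebra_measure_unique_trace _ R T cylinders setT measurableT.
rewrite GE => /(_ cylinders_measurable cylinders_setI m1 m2) h.
have <- : m1 E = (P F * P E)%E.
  rewrite -PFE; apply: h => //; first by exact/main/cylinders_setT.
  by rewrite /m1 /= /mrestr setTI (le_lt_trans (probability_le1 _ _)) // ltry.
by rewrite /m1 /= /mrestr setIC.
Qed.

Lemma others_measurable_fun (Y : T -> R) :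
  measurable_fun (setT : set others) (Y : others -> R) -> measurable_fun setT Y.
Proof.
move=> mY _ B mB; apply: others_measurable.
by have := mY measurableT B mB.
Qed.

Lemma others_comp i (g : 'cV[R]_N -> R) : i != i0 -> borel_fun g ->
  measurable_fun (setT : set others) ((g \o X i) : others -> R).
Proof.
move=> ii0 mg _ B mB; rewrite setTI comp_preimage; apply: sub_sigma_algebra.
exists [:: i], (fun=> g @^-1` B); split => //.
- by rewrite inE eq_sym.
- by move=> _; exact: borel_fun_preimage.
apply/seteqP; split=> t /=; first by move=> h j; rewrite /= inE => /eqP ->.
by apply; rewrite /= inE.
Qed.

(** The form in which the independence of the family is used: a centered factor that
    depends on one vector annihilates the mean of a product. *)
Lemma mean_mul_others (g : 'cV[R]_N -> R) (Y : T -> R) :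
  borel_fun g -> measurable_fun (setT : set others) (Y : others -> R) ->
  itg P (g \o X i0) -> itg P Y -> itg P (fun t => g (X i0 t) * Y t) ->
  mean P (g \o X i0) = 0 ->
  mean P (fun t => g (X i0 t) * Y t) = 0.
Proof.
move=> mg mY ig iY igY g0.
rewrite (mean_mul_indep (X := g \o X i0) (Y := Y)) ?g0 ?mul0r //.
move=> A B mA mB; rewrite comp_preimage; apply: others_indep; first exact: borel_fun_preimage.
by have := mY measurableT B mB; rewrite setTI.
Qed.

End FamilyIndependence.

(** * Sums of orthogonal random variables *)

Section SquareSubsequence.
Context {R : realType}.

Local Notation r j := (root72 (j ^ 2)%N : R).
Local Notation y j := (r j ^+ 2).

Lemma root72_square j : r j ^+ 36 = j%:R.
Proof.
apply/eqP; rewrite -(eqrXn2 (n := 2)) ?exprn_ge0 ?root72_ge0 //.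
by rewrite -exprM root72X natrX.
Qed.

(** The telescoping sequence [1 / y_j - 1 / y_(j+1)] with [y_j = j^(1/18)]
    replaces the summable sequence [j^(-1-1/18)]. *)
Definition weight (j : nat) : R := (y j)^-1 - (y j.+1)^-1.

Let y_gt0 j : (0 < j)%N -> 0 < y j.
Proof.
move=> j0; rewrite exprn_gt0 // (lt_le_trans ltr01) // root72_ge1 //.
by rewrite expn_gt0 j0.
Qed.

Let y_le j : y j <= y j.+1.
Proof.
by rewrite lerXn2r ?nnegrE ?root72_ge0 // root72_le // leq_sqr.
Qed.

Let yX j : y j ^+ 18 = j%:R.
Proof. by rewrite -exprM root72_square. Qed.

Lemma weight_ge0 j : (0 < j)%N -> 0 <= weight j.
Proof. by move=> j0; rewrite subr_ge0 lef_pV2 ?posrE ?y_gt0. Qed.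

(** The mean value inequality for [t ^ 18] between [y j] and [y j.+1], together with
    [y j.+1 ^ 18 <= 2 * y j ^ 18]; hence the constant [36 = 2 * 18]. *)
Lemma weight_ge j : (0 < j)%N -> 1 <= 36 * y j ^+ 19 * weight j.
Proof.
move=> j0; have y0 := y_gt0 j0; have y1 := y_gt0 (ltn0Sn j).
have yy := y_le j.
set a := y j in y0 yy *; set b := y j.+1 in y1 yy *.
have ba0 : 0 <= b - a by rewrite subr_ge0.
have e1 : 1 <= 18 * (b - a) * b ^+ 17.
  have E : 1 = b ^+ 18 - a ^+ 18 :> R by rewrite !yX -natrB ?leqnSn // subSnn.
  rewrite [leLHS]E.
  rewrite subrXX -mulrA mulrCA ler_wpM2l //.
  have le_b (i : 'I_18) : b ^+ (18.-1 - i) * a ^+ i <= b ^+ 17.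
    have -> : b ^+ 17 = b ^+ (18.-1 - i) * b ^+ i by rewrite -exprD subnK // -ltnS.
    apply: ler_wpM2l; first by apply: exprn_ge0; exact: ltW.
    by apply: lerXn2r => //; rewrite nnegrE ltW.
  apply: (le_trans (ler_sum _ (fun i _ => le_b i))).
  by rewrite sumr_const card_ord mulr_natl.
have e2 : b ^+ 18 <= 2 * a ^+ 18.
  by rewrite !yX -natrM ler_nat; lia.
have -> : weight j = (b - a) / (a * b).
  by rewrite /weight -/a -/b; field; rewrite !gt_eqF.
apply: (le_trans e1).
have -> : 36 * a ^+ 19 * ((b - a) / (a * b)) = 18 * (b - a) * (2 * a ^+ 18 / b).
  by field; rewrite !gt_eqF.
rewrite ler_wpM2l ?mulr_ge0 // ler_pdivlMr // -exprSr; exact: e2.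
Qed.

Lemma sum_weight_le1 n : \sum_(j < n) weight j.+1 <= 1.
Proof.
have -> : \sum_(j < n) weight j.+1 = 1 - (y n.+1)^-1.
  elim: n => [|n IH].
    have y1 : y 1 = 1.
      by rewrite /root72 exp1n powR1 expr1n.
    by rewrite big_ord0 y1 invr1 subrr.
  by rewrite big_ord_recr /= IH /weight addrA subrK.
by rewrite lerBlDr lerDl invr_ge0 ltW // y_gt0.
Qed.

End SquareSubsequence.

Lemma exists_sqrt_floor n : (0 < n)%N -> exists j, [/\ 0 < j, j ^ 2 <= n & n < j.+1 ^ 2]%N.
Proof.
elim: n => // -[_ _|n /(_ isT) [j [j0 jn nj]] _]; first by exists 1%N.
have [lt|ge] := ltnP n.+2 (j.+1 ^ 2); first by exists j; split => //; lia.
exists j.+1; split => //.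
have : (j.+1 ^ 2 < j.+2 ^ 2)%N by rewrite ltn_sqr.
lia.
Qed.

(** The exponent is [3/4 + 1/72]. *)
Definition slow_sums (R : realType) (f : nat -> R) := exists2 K : R, 0 <= K &
  forall n, (0 < n)%N -> `|\sum_(1 <= k < n.+1) f k| <= K * root72 n ^+ 55.

Section OrthogonalSums.
Context d (T : measurableType d) (R : realType) (P : probability T R).
Variables (f : nat -> T -> R) (C : R).
Hypothesis f_L2 : forall k, (0 < k)%N -> L2 P (f k).
Hypothesis f_var : forall k, (0 < k)%N -> mean P (fun t => f k t ^+ 2) <= C.
Hypothesis f_orth : forall j k, (0 < j)%N -> (j < k)%N ->
  mean P (fun t => f j t * f k t) = 0.

Let F n t := \sum_(1 <= k < n.+1) f k t.

Let C_ge0 : 0 <= C.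
Proof. by apply: le_trans (f_var (ltn0Sn 0)); apply: mean_ge0 => t; exact: sqr_ge0. Qed.

Lemma F_L2 n : L2 P (F n).
Proof.
rewrite /F (_ : (fun t => _) = fun t => \sum_(1 <= k < n.+1 | (0 < k)%N) f k t).
  by apply: L2_sum => k k0; exact: f_L2.
apply/funext => t; rewrite big_nat [RHS]big_nat_cond; apply: eq_bigl => k.
by case: k => [|k]; rewrite ?andbT.
Qed.

Lemma mean_sqr_sum n : mean P (fun t => F n t ^+ 2) <= C * n%:R.
Proof.
elim: n => [|n IH].
  rewrite mulr0 (_ : (fun t => _) = fun=> 0) ?mean_cst //.
  by apply/funext => t; rewrite /F big_geq // expr0n.
have LF := F_L2 n; have Lf := f_L2 (ltn0Sn n).
have -> : (fun t => F n.+1 t ^+ 2) =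
    (fun t => (F n t ^+ 2 + f n.+1 t ^+ 2) + 2 * (F n t * f n.+1 t)).
  by apply/funext => t; rewrite /F big_nat_recr //=; ring.
have iFf : itg P (fun t => F n t * f n.+1 t) by exact: itg_mulL2.
rewrite meanD; [|exact: itgD LF.2 Lf.2 | exact: itgZ].
rewrite meanD ?meanZ //; [|exact: LF.2 | exact: Lf.2].
have -> : mean P (fun t => F n t * f n.+1 t) = 0.
  have -> : (fun t => F n t * f n.+1 t) =
     (fun t => \sum_(1 <= k < n.+1 | (0 < k < n.+1)%N) f k t * f n.+1 t).
    by apply/funext => t; rewrite /F mulr_suml big_nat.
  rewrite mean_sum; last first.
    by move=> k /andP[k0 kn]; apply: itg_mulL2 => //; exact: f_L2.
  by rewrite big1 // => k /andP[k0 kn]; exact: f_orth.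
rewrite mulr0 addr0 -natr1 mulrDr mulr1 lerD //; exact: f_var.
Qed.

(** Along the squares [n = j^2] the second moments are summable against
    [weight]; between two squares the sum moves by at most [2 (j + 1)] terms,
    whose squares are included in [G] as well, so that one Borel-Cantelli
    argument covers all sample sizes. *)
Let G j t := F (j ^ 2) t ^+ 2 +
  (2 * j.+1)%:R * \sum_((j ^ 2).+1 <= k < (j.+1 ^ 2).+1) f k t ^+ 2.

Let G_itg j : itg P (G j).
Proof.
apply: itgD; first exact: (F_L2 _).2.
apply: itgZ; rewrite (_ : (fun t => _) =
   fun t => \sum_((j ^ 2).+1 <= k < (j.+1 ^ 2).+1 | (0 < k)%N) f k t ^+ 2).
  by apply: itg_sum => k k0; exact: (f_L2 k0).2.
apply/funext => t; rewrite big_nat [RHS]big_nat_cond; apply: eq_bigl => k.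
by case: k => [|k]; rewrite ?andbT.
Qed.

(* [j ^ 2 + (2 (j + 1)) ^ 2 <= 17 j ^ 2]. *)
Let G_mean j : (0 < j)%N -> mean P (G j) <= 17 * C * j%:R ^+ 2.
Proof.
move=> j0; rewrite /G.
set S := fun t => \sum_((j ^ 2).+1 <= k < (j.+1 ^ 2).+1) f k t ^+ 2.
have SE : S = fun t => \sum_((j ^ 2).+1 <= k < (j.+1 ^ 2).+1 | (0 < k)%N) f k t ^+ 2.
  apply/funext => t; rewrite /S big_nat [RHS]big_nat_cond; apply: eq_bigl => k.
  by case: k => [|k]; rewrite ?andbT.
have iS : itg P S by rewrite SE; apply: itg_sum => k k0; exact: (f_L2 k0).2.
rewrite (meanD (X := fun t => F (j ^ 2) t ^+ 2) (Y := fun t => (2 * j.+1)%:R * S t)).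
- rewrite meanZ //.
  have b1 := mean_sqr_sum (j ^ 2).
  have b2 : mean P S <= C * (2 * j.+1)%:R.
    rewrite SE mean_sum; last by move=> k k0; exact: (f_L2 k0).2.
    apply: (le_trans (ler_sum _ (fun k k0 => f_var k0))).
    rewrite big_const_seq iter_addr_0 -[leLHS]mulr_natr ler_wpM2l // ler_nat.
    rewrite (leq_trans (count_size _ _)) // size_iota; lia.
  have b3 : (2 * j.+1)%:R * mean P S <= (2 * j.+1)%:R * (C * (2 * j.+1)%:R).
    by rewrite ler_wpM2l.
  apply: (le_trans (lerD b1 b3)).
  have j1 : 1 <= j%:R :> R by rewrite ler1n.
  rewrite natrX natrM -natr1.
  have : 0 <= C * (j%:R - 1) * (12 * j%:R + 4) by rewrite !mulr_ge0 ?subr_ge0 // addr_ge0 // mulr_ge0.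
  nra.
- exact: (F_L2 _).2.
- exact: itgZ.
Qed.

(** A weak law with a rate, made almost sure: [G j / j ^ 2] has bounded mean and
    [weight] is summable, so [weight j * G j / j ^ 2] is almost surely bounded; thus
    [G j] is of order at most [j ^ (2 + 19/18)], the square of [n ^ (3/4 + 1/72)] for
    [n = j ^ 2]. *)
Lemma orthogonal_sum_bound : {ae P, forall t, slow_sums (f^~ t)}.
Proof.
pose X j t : R := weight j.+1 / j.+1%:R ^+ 2 * G j.+1 t.
have G0 j t : 0 <= G j t.
  rewrite addr_ge0 ?sqr_ge0 // mulr_ge0 // sumr_ge0 // => k _; exact: sqr_ge0.
have w0 j : 0 <= weight j.+1 / j.+1%:R ^+ 2 :> R.
  by rewrite divr_ge0 ?sqr_ge0 // weight_ge0.
have X0 j t : 0 <= X j t by rewrite mulr_ge0.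
have iX j : itg P (X j) by apply: itgZ; exact: G_itg.
have mX j : mean P (X j) <= 17 * C * weight j.+1.
  rewrite meanZ //; apply: (le_trans (ler_wpM2l (w0 j) (G_mean (ltn0Sn j)))).
  by rewrite le_eqVlt; apply/orP; left; apply/eqP; field; rewrite gt_eqF // ltr_wpDr.
have sX n : \sum_(j < n) mean P (X j) <= 17 * C.
  apply: (@le_trans _ _ (\sum_(j < n) 17 * C * weight j.+1)).
    by apply: ler_sum => j _; exact: mX.
  by rewrite -mulr_sumr ler_piMr ?sum_weight_le1 // mulr_ge0.
have := ae_bounded X0 iX sX; apply: filterS => t [K hK].
have K0 : 0 <= K := le_trans (X0 0%N t) (hK 0%N).
exists (Num.sqrt (2 * (36 * K))) => [|n n0]; first exact: sqrtr_ge0.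
have [[|j] [] // _ jn nj] := exists_sqrt_floor n0.
set r := root72 (j.+1 ^ 2) : R.
have r0 : 0 <= r by exact: root72_ge0.
have Gle : G j.+1 t <= 36 * K * r ^+ 110.
  have := hK j; rewrite /X; move: (G0 j.+1 t); set g := G _ t => g0 h.
  have j0 : 0 < j.+1%:R ^+ 2 :> R by rewrite exprn_gt0.
  have h1 : weight j.+1 * g <= K * j.+1%:R ^+ 2.
    by rewrite -ler_pdivrMr // mulrAC.
  have h2 := weight_ge (R := R) (ltn0Sn j); rewrite -/r in h2.
  apply: (@le_trans _ _ (36 * r ^+ 2 ^+ 19 * weight j.+1 * g)).
    by rewrite ler_peMl.
  have -> : 36 * K * r ^+ 110 = 36 * r ^+ 2 ^+ 19 * (K * r ^+ 36 ^+ 2) by ring.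
  rewrite -[leLHS]mulrA ler_wpM2l ?mulr_ge0 ?exprn_ge0 // root72_square; exact: h1.
have Fn : F n t ^+ 2 <= 2 * G j.+1 t.
  have -> : F n t = F (j.+1 ^ 2) t + \sum_((j.+1 ^ 2).+1 <= k < n.+1) f k t.
    by rewrite /F -big_cat_nat.
  have cs : (\sum_((j.+1 ^ 2).+1 <= k < n.+1) f k t) ^+ 2 <=
      (2 * j.+2)%:R * \sum_((j.+1 ^ 2).+1 <= k < (j.+2 ^ 2).+1) f k t ^+ 2.
    have := sum_cauchy_schwarz (index_iota (j.+1 ^ 2).+1 n.+1) predT (fun=> 1) (fun k => f k t).
    under eq_bigr do rewrite mul1r.
    move/le_trans; apply; apply: ler_pM.
    - by apply: sumr_ge0 => k _; exact: sqr_ge0.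
    - by apply: sumr_ge0 => k _; exact: sqr_ge0.
    - by rewrite expr1n sumr_const_nat ler_nat; lia.
    apply: sum_nat_sub => // [k|]; first exact: sqr_ge0.
    by rewrite ltnS ltnW.
  rewrite /G; move: cs; set A := F _ t; set B := \sum_(_ <= k < n.+1) _.
  by have := sqr_ge0 (A - B); nra.
apply: norm_le_sqr; first by rewrite mulr_ge0 ?sqrtr_ge0 // exprn_ge0 // root72_ge0.
have K2 : 0 <= 2 * (36 * K) by rewrite !mulr_ge0.
rewrite exprMn sqr_sqrtr // -exprM.
apply: (le_trans Fn); rewrite -mulrA ler_wpM2l // (le_trans Gle) //.
rewrite ler_wpM2l ?mulr_ge0 // lerXn2r ?nnegrE ?root72_ge0 // root72_le //.
Qed.

End OrthogonalSums.

(** * Moments of the Gaussian law *)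

Section GaussianMoments.
Context {R : realType}.
Local Notation mu := (@lebesgue_measure R).
Local Notation gauss := (normal_prob (0 : R) 1).

Lemma normal_pdf_even (x : R) : normal_pdf 0 1 (- x) = normal_pdf 0 1 x :> R.
Proof.
by rewrite !normal_pdfE ?oner_neq0 // /normal_fun !subr0 sqrrN.
Qed.

Lemma normal_pdf_measurable m s : measurable_fun setT (fun x : R => (normal_pdf m s x)%:E).
Proof. by apply/measurable_EFinP; exact: measurable_normal_pdf. Qed.

Lemma gauss_symmetric (A : set R) : measurable A -> gauss (-%R @^-1` A) = gauss A.
Proof.
move=> mA; rewrite /normal_prob.
transitivity (\int[mu]_(x in -%R @^-1` A) (((fun y => (normal_pdf 0 1 y)%:E) \o -%R) x))%E.
  by apply: eq_integral => x _ /=; rewrite normal_pdf_even.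
have mN : measurable_fun setT (-%R : measurableTypeR R -> measurableTypeR R).
  exact: measurable_funN.
transitivity (\int[pushforward mu (-%R : R -> measurableTypeR R)]_(y in A)
    (normal_pdf 0 1 y)%:E)%E; last first.
  by apply: eq_measure_integral => B mB _; exact: lebesgue_measureN.
apply/esym; apply: (@ge0_integral_pushforward _ _ _ _ R _ mN mu A (fun y => (normal_pdf 0 1 y)%:E) mA).
  by apply: measurable_funTS; exact: normal_pdf_measurable.
by move=> y _; rewrite lee_fin normal_pdf_ge0.
Qed.

Lemma poly_exp_bound (x : R) : (`|x| + 1) ^+ 4 <= 256 * expR (x ^+ 2 / 4).
Proof.
pose y := x ^+ 2 / 4; have y0 : 0 <= y by rewrite divr_ge0 ?sqr_ge0.
have h : (1 + y / 2) ^+ 2 <= expR y.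
  have -> : expR y = expR (y / 2) ^+ 2 by rewrite -expRM_natl; congr expR; field.
  by rewrite lerXn2r ?nnegrE ?expR_ge0 ?expR_ge1Dx // addr_ge0 // divr_ge0.
have e : (`|x| + 1) ^+ 2 <= 8 * y + 2.
  have : `|x| ^+ 2 = 4 * y by rewrite real_normK ?num_real // /y; field.
  by have := sqr_ge0 (`|x| - 1); nra.
apply: (@le_trans _ _ ((8 * y + 2) ^+ 2)).
  rewrite (exprM _ 2 2) lerXn2r ?nnegrE ?sqr_ge0 //.
  by rewrite addr_ge0 // mulr_ge0.
rewrite -/y; nra.
Qed.

Lemma pdf_bound : exists2 C : R, 0 <= C & forall x : R,
  (`|x| + 1) ^+ 4 * normal_pdf 0 1 x <= C * normal_pdf 0 (Num.sqrt 2) x.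
Proof.
have s2 : Num.sqrt 2 != 0 :> R by rewrite sqrtr_eq0 -ltNge.
have p2 : 0 < normal_peak (Num.sqrt 2 : R) by exact: normal_peak_gt0.
have p1 : 0 < normal_peak (1 : R) by apply: normal_peak_gt0; exact: oner_neq0.
exists (256 * normal_peak 1 / normal_peak (Num.sqrt 2)).
  by apply: divr_ge0; [apply: mulr_ge0 => //|]; exact: ltW.
move=> x; rewrite !normal_pdfE ?oner_neq0 // /normal_fun !subr0.
rewrite expr1n sqr_sqrtr //.
have -> : 256 * normal_peak 1 / normal_peak (Num.sqrt 2) *
   (normal_peak (Num.sqrt 2) * expR (- x ^+ 2 / (2 *+ 2))) =
   normal_peak 1 * (256 * expR (- x ^+ 2 / (2 *+ 2))).
  by field; rewrite gt_eqF.
rewrite mulrCA ler_pM2l //.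
have -> : - x ^+ 2 / (1 *+ 2) = - (x ^+ 2 / 4) + - x ^+ 2 / (2 *+ 2) :> R by field.
rewrite expRD mulrA ler_pM2r ?expR_gt0 // expRN ler_pdivrMr ?expR_gt0 //.
exact: poly_exp_bound.
Qed.

(** On the shell [n <= |x| < n + 1] the weight [(n + 1)^4] is absorbed by
    passing from variance [1] to variance [2]; the shells then add up to a
    probability. *)
Lemma gauss_fourth_moment : itg gauss (fun x : R => x ^+ 4).
Proof.
have [C C0 hC] := pdf_bound.
pose Bn (n : nat) := [set x : R | n%:R <= `|x| < n.+1%:R].
have mB n : measurable (Bn n).
  have -> : Bn n = Num.norm @^-1` `[n%:R, n.+1%:R[%classic.
    by apply/seteqP; split=> x /=; rewrite in_itv.
  by rewrite -[X in measurable X]setTI; apply: normr_measurable.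
have tB : trivIset setT Bn.
  apply/trivIsetP => i j _ _ ij; apply/seteqP; split=> // x [/= /andP[ix xi] /andP[jx xj]].
  have := le_lt_trans ix xj; have := le_lt_trans jx xi; rewrite !ltr_nat !ltnS => a b.
  by move: ij; rewrite eqn_leq a b.
have cover x : exists n, Bn n x.
  exists (Num.truncn `|x|); rewrite /Bn /=.
  exact: truncn_itv.
pose g2 := normal_prob (0 : R) (Num.sqrt 2).
have shell n : ((n.+1%:R ^+ 4)%:E * gauss (Bn n) <= C%:E * g2 (Bn n))%E.
  rewrite /g2 /normal_prob.
  have mN m s : measurable_fun (Bn n) (fun x : R => (normal_pdf m s x)%:E).
    by apply: measurable_funTS; exact: normal_pdf_measurable.
  have pull m s (c : R) : 0 <= c ->
      (c%:E * \int[mu]_(x in Bn n) (normal_pdf m s x)%:E =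
       \int[mu]_(x in Bn n) (c%:E * (normal_pdf m s x)%:E))%E.
    move=> c0; rewrite ge0_integralZl ?lee_fin //; first exact: mB.
    - exact: mN.
    - by move=> x _; rewrite lee_fin normal_pdf_ge0.
  rewrite !pull ?exprn_ge0 //.
  apply: ge0_le_integral.
  - exact: mB.
  - by move=> x _; rewrite -EFinM lee_fin mulr_ge0 ?exprn_ge0 // normal_pdf_ge0.
  - by apply: measurable_funeM; exact: mN.
  - by apply: measurable_funeM; exact: mN.
  move=> x /andP[nx _]; rewrite -!EFinM lee_fin; apply: le_trans (hC x).
  rewrite ler_wpM2r ?normal_pdf_ge0 // lerXn2r ?nnegrE ?addr_ge0 //.
  by rewrite -natr1 lerD2r.
apply/integrableP; split.
  by apply/measurable_EFinP; exact: measurable_funX.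
pose f n (x : R) : \bar R := ((n.+1%:R ^+ 4)%:E * (\1_(Bn n) x)%:E)%E.
have f0 n x : (0 <= f n x)%E by rewrite mule_ge0 ?lee_fin ?exprn_ge0.
have mf n : measurable_fun setT (f n).
  by apply: measurable_funeM; apply/measurable_EFinP; exact: measurable_indic.
apply: (@le_lt_trans _ _ (\int[gauss]_x \sum_(n <oo) f n x)%E).
  apply: ge0_le_integral; [exact: measurableT | by [] | | |].
  - by apply: measurableT_comp => //; apply/measurable_EFinP; exact: measurable_funX.
  - by apply: (@ge0_emeasurable_sum _ _ _ setT f xpredT).
  move=> x _; have [n Bx] := cover x.
  have := @nneseries_lim_ge R (fun n => f n x) xpredT 0 n.+1.
  rewrite big_nat_recr //= => h; apply: (le_trans _ (h _)) => [|k _ _]; last exact: f0.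
  apply: (@le_trans _ _ (f n x)); last by rewrite leeDr // sume_ge0.
  rewrite /f indicE mem_set // mule1 lee_fin normrX.
  by move: Bx => /andP[_ xn]; rewrite lerXn2r ?nnegrE // ltW.
rewrite integral_nneseries //.
apply: (@le_lt_trans _ _ (\sum_(n <oo) C%:E * g2 (Bn n))%E).
  apply: lee_nneseries => [n _ _|n _]; first by apply: integral_ge0 => x _; exact: f0.
  rewrite /f ge0_integralZl ?lee_fin ?exprn_ge0 //; last first.
    by apply/measurable_EFinP; apply: measurable_indic; exact: mB.
  have -> : (\int[gauss]_x (\1_(Bn n) x)%:E = gauss (Bn n))%E.
    by rewrite integral_indic ?setIT //; exact: mB.
  exact: shell.
rewrite nneseriesZl => [|n _]; last exact: measure_ge0.
apply: (@le_lt_trans _ _ (C%:E * 1)%E); last by rewrite mule1 ltry.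
have mU : measurable (\bigcup_n Bn n) by exact: bigcupT_measurable.
rewrite lee_wpmul2l ?lee_fin //.
have <- : g2 (\bigcup_n Bn n) = (\sum_(n <oo) g2 (Bn n))%E.
  exact: measure_semi_bigcup.
exact: probability_le1.
Qed.

Lemma gauss_L4 : L2 gauss (fun x : R => x ^+ 2).
Proof.
split; first exact: measurable_funX.
by have := gauss_fourth_moment; congr itg; apply/funext => x; rewrite -exprM.
Qed.

Lemma gauss_L2 : L2 gauss (fun x : R => x).
Proof. by split => //; exact: L2_itg gauss_L4. Qed.

Lemma gauss_mean0 : mean gauss (fun x : R => x) = 0.
Proof.
have i1 : itg gauss (fun x : R => x) := L2_itg gauss_L2.
have iN : itg gauss (fun x : R => - x).
  by have := itgZ (-1) i1; congr itg; apply/funext => x; rewrite mulN1r.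
have mN : measurable_fun setT (-%R : measurableTypeR R -> measurableTypeR R).
  exact: measurable_funN.
have e : (\int[gauss]_x (x%:E) = \int[gauss]_x ((- x)%:E))%E.
  transitivity (\int[pushforward gauss (-%R : measurableTypeR R -> measurableTypeR R)]_x (x%:E))%E.
    by apply: eq_measure_integral => A mA _; exact/esym/gauss_symmetric.
  apply: (@integral_pushforward _ _ _ _ R _ mN gauss setT EFin) => //.
have E : mean gauss (fun x : R => x) = mean gauss (fun x : R => - x) := congr1 fine e.
have mN1 : mean gauss (fun x : R => - x) = - mean gauss (fun x : R => x).
  by rewrite -[RHS]mulN1r -meanZ //; congr mean; apply/funext => x; rewrite mulN1r.
move: E; rewrite mN1; move: (mean _ _) => m; lra.
Qed.

Lemma gauss_var_gt0 : 0 < mean gauss (fun x : R => x ^+ 2).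
Proof.
have i2 : itg gauss (fun x : R => x ^+ 2) := gauss_L2.2.
rewrite lt_neqAle mean_ge0 ?andbT; last by move=> x; exact: sqr_ge0.
apply/negP => /eqP/esym m0.
have : (\int[gauss]_x `|(x ^+ 2)%:E| = 0)%E.
  under eq_integral do rewrite gee0_abs ?lee_fin ?sqr_ge0 //.
  by rewrite (meanE i2) m0.
move/ae_eq_integral_abs => /(_ measurableT).
move=> /(_ (measurable_int _ i2)) [A [mA A0 hA]].
have : gauss setT = 0%E.
  apply/eqP; rewrite -measure_le0.
  have sub : [set: R] `<=` A `|` [set 0].
    move=> x _; case: (eqVneq x 0) => [->|x0]; [by right | left].
    apply: hA => /= h; have := h I => -[] /eqP.
    by rewrite sqrf_eq0 (negbTE x0).
  apply: (@le_trans _ _ (gauss (A `|` [set 0]))).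
    by apply: le_measure; rewrite ?inE //; exact: measurableU.
  have g0 : gauss [set 0] = 0%E.
    have /null_content_dominatesP := normal_prob_dominates (0 : R) 1.
    by apply => //; exact: lebesgue_measure_set1.
  have null_sum (a b c : \bar R) : a = 0%E -> b = 0%E -> (c <= a + b)%E -> (c <= 0)%E.
    by move=> -> ->; rewrite adde0.
  exact: (null_sum _ _ _ A0 g0 (measureU2 gauss mA (measurable_set1 0))).
by rewrite probability_setT => /eqP; rewrite eqe oner_eq0.
Qed.

End GaussianMoments.

(** * Gaussian vectors *)

Section GaussianVectors.
Context d (T : measurableType d) (R : realType) (P : probability T R).
Variables (N : nat) (X : T -> 'cV[R]_N).
Hypothesis X_meas : random_vector X.
Hypothesis X_gauss : standard_gaussian P X.
Local Notation gauss := (normal_prob (0 : R) 1).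

Lemma coord_measurable (Y : T -> 'cV[R]_N) (g : 'cV[R]_N -> R) :
  random_vector Y -> borel_fun g -> measurable_fun setT (g \o Y).
Proof.
move=> mY mg _ B mB; rewrite setTI comp_preimage; apply: mY.
exact: borel_fun_preimage.
Qed.

Let mX s : measurable_fun setT (fun t => X t s 0).
Proof. exact: (coord_measurable X_meas (borel_coord s)). Qed.

Lemma gauss_marginals (s r : 'I_N) (A B : set R) : s != r ->
  measurable A -> measurable B ->
  P ((fun t => X t s 0) @^-1` A `&` (fun t => X t r 0) @^-1` B) = (gauss A * gauss B)%E.
Proof.
move=> sr mA mB.
pose E i := if i == s then A else if i == r then B else setT.
have mE i : measurable (E i) by rewrite /E; case: ifP => // _; case: ifP.
have := X_gauss mE; rewrite (bigD1 s) //= (bigD1 r) /=; last by rewrite eq_sym.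
rewrite big1 => [|i /andP[/negbTE is1 /negbTE ir]]; last first.
  by rewrite /E is1 ir; exact: probability_setT.
rewrite mule1 {2 3}/E !eqxx eq_sym (negbTE sr) => <-.
congr (P _); apply/seteqP; split=> t /=.
  move=> [a b] i; rewrite /E; case: eqP => [->|_] //.
  by case: eqP => [->|].
move=> h; split; first by have := h s; rewrite /E eqxx.
by have := h r; rewrite /E eq_sym (negbTE sr) eqxx.
Qed.

Lemma gauss_marginal (s : 'I_N) (A : set R) : measurable A ->
  P ((fun t => X t s 0) @^-1` A) = gauss A.
Proof.
move=> mA; pose E i := if i == s then A else setT.
have mE i : measurable (E i) by rewrite /E; case: ifP.
have := X_gauss mE; rewrite (bigD1 s) //= big1 => [|i /negbTE is1]; last first.
  by rewrite /E is1; exact: probability_setT.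
rewrite mule1 {2}/E eqxx => <-.
congr (P _); apply/seteqP; split=> t /=.
  by move=> a i; rewrite /E; case: eqP => [->|].
by move=> h; have := h s; rewrite /E eqxx.
Qed.

(** The marginal laws being Gaussian, moments are computed on the line. *)
Lemma gauss_transfer (f : R -> R) (s : 'I_N) : itg gauss f ->
  itg P (fun t => f (X t s 0)) /\ mean P (fun t => f (X t s 0)) = mean gauss f.
Proof.
move=> fi.
have mXs : @measurable_fun _ _ T (measurableTypeR R) setT (fun t => X t s 0) := mX s.
pose Xs := @mfun_Sub _ _ T (measurableTypeR R) (fun t => X t s 0) (mem_set mXs).
have law (A : set (measurableTypeR R)) : measurable A -> A `<=` setT -> distribution P Xs A = gauss A.
  by move=> mA _; exact: gauss_marginal.
have mf : measurable_fun setT (EFin \o f).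
  by apply/measurable_EFinP; exact: itg_measurable fi.
have itgX : itg P (fun t => f (X t s 0)).
  apply/integrableP; split.
    apply/measurable_EFinP; exact: (measurableT_comp (itg_measurable fi) (mX s)).
  rewrite -(@ge0_integral_distribution _ _ _ _ _ P Xs (fun x => `|(f x)%:E|%E)) //; last first.
    exact: measurableT_comp.
  have -> : (\int[distribution P Xs]_x `|(f x)%:E| = \int[gauss]_x `|(f x)%:E|)%E.
    exact: (@eq_measure_integral _ (measurableTypeR R) R setT gauss (distribution P Xs) (fun x => `|(f x)%:E|)%E law).
  by move/integrableP: fi => [].
split => //; apply: EFin_inj; rewrite -(meanE itgX) -(meanE fi).
transitivity (\int[distribution P Xs]_x (f x)%:E)%E; last first.
  exact: (@eq_measure_integral _ (measurableTypeR R) R setT gauss (distribution P Xs) (EFin \o f) law).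
by rewrite (@integral_distribution _ _ _ _ _ P Xs (EFin \o f)).
Qed.

(** Kept symbolic: the excitation of the regressors only asks that it be positive. *)
Definition gauss_var : R := mean gauss (fun x : R => x ^+ 2).
Definition gauss_moment4 : R := mean gauss (fun x : R => x ^+ 4).

Lemma gauss_coord_L2 s : L2 P (fun t => X t s 0).
Proof. by split => //; exact: (gauss_transfer s gauss_L2.2).1. Qed.

Lemma gauss_coord_mean s : mean P (fun t => X t s 0) = 0.
Proof. by rewrite (gauss_transfer s (L2_itg gauss_L2)).2 gauss_mean0. Qed.

Lemma gauss_coord_var s : mean P (fun t => X t s 0 ^+ 2) = gauss_var.
Proof. exact: (gauss_transfer s gauss_L2.2).2. Qed.

Lemma gauss_coord_L4 s : L2 P (fun t => X t s 0 ^+ 2).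
Proof.
split; first by apply: measurable_funX.
have := (gauss_transfer s gauss_fourth_moment).1.
by congr itg; apply/funext => t; rewrite -exprM.
Qed.

Lemma gauss_coord_mu4 s : mean P (fun t => (X t s 0 ^+ 2) ^+ 2) = gauss_moment4.
Proof.
have [_ E] := gauss_transfer s gauss_fourth_moment.
transitivity (mean P (fun t => X t s 0 ^+ 4)); last exact: E.
by congr mean; apply/funext => t; rewrite -exprM.
Qed.

Lemma gauss_coord_cov s r :
  mean P (fun t => X t s 0 * X t r 0) = (s == r)%:R * gauss_var.
Proof.
have [<-|sr] := eqVneq s r; first by rewrite mul1r -(gauss_coord_var s).
rewrite mul0r (mean_mul_indep (X := fun t => X t s 0) (Y := fun t => X t r 0)).
- by rewrite gauss_coord_mean mul0r.
- by move=> A B mA mB; rewrite !gauss_marginal //; exact: gauss_marginals.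
- exact/L2_itg/gauss_coord_L2.
- exact/L2_itg/gauss_coord_L2.
- by apply: itg_mulL2; exact: gauss_coord_L2.
Qed.

End GaussianVectors.

(** * Fluctuations of the inputs and of the noise *)

Section Model.
Context d (T : measurableType d) (R : realType) (P : probability T R).
Variables (N' : nat).
Local Notation N := N'.+1.
Variables (G : 'M[R]_N) (alpha : 'cV[R]_N) (b : 'rV[R]_N) (eps Cw : R).
Variables (u0 : 'cV[R]_N) (u v w : nat -> T -> 'cV[R]_N).
Hypothesis w_meas : forall t, (0 < t)%N -> random_vector (w t).
Hypothesis w_mean : forall t i, (0 < t)%N ->
  ('E_P[fun omega => (w t omega i 0)%R] = 0)%E.
Hypothesis Cw_gt0 : 0 < Cw.
Hypothesis w_bnd : forall t, (0 < t)%N -> {ae P, forall omega, fnorm (w t omega) <= Cw}.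
Hypothesis eps_ge0 : 0 <= eps.
Hypothesis v_meas : forall t, (0 < t)%N -> random_vector (v t).
Hypothesis v_gauss : forall t, (0 < t)%N -> standard_gaussian P (v t).
Hypothesis u_init : forall omega, u 0%N omega = u0.
Hypothesis u_def : forall t omega, (0 < t)%N ->
     u t omega = (t%:R `^ (eps / 2))^-1 *: v t omega.

Definition noise (i : nat + nat) : T -> 'cV[R]_N :=
  match i with inl t => w t.+1 | inr t => v t.+1 end.

Hypothesis wv_indep : mutually_independent P noise.

Lemma noise_meas i : random_vector (noise i).
Proof. by case: i => t; [exact: w_meas | exact: v_meas]. Qed.

(* [Y] is a function of all the noise vectors but the one of index [i]. *)
Local Notation "'adapted' i Y" :=
  (measurable_fun (setT : set (others noise i)) (Y : others noise i -> R))
  (at level 10, i at level 9, Y at level 9).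

(** Truncation makes the noise bounded everywhere instead of almost surely; it
    changes it only on a null set. *)
Definition clamp (a : R) : R := Num.max (- Cw) (Num.min a Cw).

Lemma clamp_le a : `|clamp a| <= Cw.
Proof.
rewrite ler_norml /clamp le_max lexx /= ge_max ge_min lexx orbT andbT.
by have := Cw_gt0; lra.
Qed.

Lemma clamp_id a : `|a| <= Cw -> clamp a = a.
Proof.
rewrite ler_norml => /andP[l r]; rewrite /clamp min_l //.
by apply/max_idPr.
Qed.

Definition wc t omega : 'cV[R]_N := \col_i clamp (w t omega i 0).

Lemma wcE t omega i : wc t omega i 0 = clamp (w t omega i 0).
Proof. by rewrite mxE. Qed.

Lemma clamp_measurable : measurable_fun setT clamp.
Proof.
apply: measurable_maxr; first exact: measurable_cst.
by apply: measurable_minr => //; exact: measurable_cst.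
Qed.

Lemma clamp_coord_borel i : borel_fun (fun x : 'cV[R]_N => clamp (x i 0)).
Proof.
apply: (measurableT_comp (f := clamp)); first exact: clamp_measurable.
exact: borel_coord.
Qed.

Lemma wc_ae : {ae P, forall omega, forall t, (0 < t)%N -> wc t omega = w t omega}.
Proof.
have h : {ae P, forall omega, forall t, fnorm (w t.+1 omega) <= Cw}.
  by apply: ae_foralln => t; exact: w_bnd.
apply: filterS h => omega h [//|t] _; apply/colP => i; rewrite wcE clamp_id //.
apply: norm_le_sqr; first exact: ltW.
apply: (le_trans (sqr_entry_le (w t.+1 omega) i 0)).
by rewrite -fnorm_sqr ler_sqr ?nnegrE ?sqrtr_ge0 // ltW.
Qed.

Lemma wc_measurable t s : (0 < t)%N -> measurable_fun setT (fun omega => wc t omega s 0).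
Proof.
move=> t0; rewrite (_ : (fun _ => _) = (fun x : 'cV[R]_N => clamp (x s 0)) \o w t).
  by apply: coord_measurable; [exact: w_meas | exact: clamp_coord_borel].
by apply/funext => omega /=; rewrite wcE.
Qed.

Lemma wc_L2 t s : (0 < t)%N -> L2 P (fun omega => wc t omega s 0).
Proof.
move=> t0; apply: (@L2_bounded _ _ _ _ _ Cw); first exact: wc_measurable.
by move=> omega; rewrite wcE clamp_le.
Qed.

Lemma wc_mean t s : (0 < t)%N -> mean P (fun omega => wc t omega s 0) = 0.
Proof.
move=> t0; rewrite /mean /Rintegral.
have mw : measurable_fun setT (fun omega => w t omega s 0).
  exact: (coord_measurable (w_meas t0) (borel_coord s)).
have <- : (\int[P]_omega (w t omega s 0)%:E = \int[P]_omega (wc t omega s 0)%:E)%E.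
  apply: ae_eq_integral => //.
  - exact/measurable_EFinP.
  - by apply/measurable_EFinP; exact: wc_measurable.
  by apply: filterS wc_ae => omega h _; rewrite h.
by have := w_mean s t0; rewrite unlock => ->.
Qed.

Local Notation amp t := ((t%:R `^ (eps / 2))^-1 : R).

Lemma amp_ge0 t : 0 <= amp t.
Proof. by rewrite invr_ge0 powR_ge0. Qed.

Lemma amp_sqr t : amp t ^+ 2 = t%:R `^ (- eps).
Proof.
rewrite powRN exprVn; congr (_^-1).
by rewrite -powR_mulrn ?powR_ge0 // -powRrM; congr (_ `^ _); field.
Qed.

Lemma amp_le1 t : (0 < t)%N -> amp t <= 1.
Proof.
move=> t0; have h : 1 <= t%:R `^ (eps / 2) :> R.
  apply: (@le_trans _ _ (1 `^ (eps / 2))); first by rewrite powR1.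
  by rewrite ge0_ler_powR ?nnegrE ?divr_ge0 // ler1n.
by rewrite invf_le1 // (lt_le_trans ltr01).
Qed.

Lemma amp2_le1 t : (0 < t)%N -> amp t ^+ 2 <= 1.
Proof. by move=> t0; rewrite expr_le1 ?amp_ge0 // amp_le1. Qed.

Lemma u_coord t s omega : (0 < t)%N -> u t omega s 0 = amp t * v t omega s 0.
Proof. by move=> t0; rewrite u_def // mxE. Qed.

Lemma u_coordE t s : (0 < t)%N ->
  (fun omega => u t omega s 0) = (fun omega => amp t * v t omega s 0).
Proof. by move=> t0; apply/funext => omega; exact: u_coord. Qed.

Lemma u_L2 t s : (0 < t)%N -> L2 P (fun omega => u t omega s 0).
Proof.
move=> t0; rewrite u_coordE //; apply: L2Z.
exact: (gauss_coord_L2 (v_meas t0) (v_gauss t0)).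
Qed.

Lemma gauss_var_ge0 : 0 <= gauss_var R.
Proof. by apply: mean_ge0 => x; exact: sqr_ge0. Qed.

Lemma u_var t s : (0 < t)%N -> mean P (fun omega => u t omega s 0 ^+ 2) <= gauss_var R.
Proof.
move=> t0; have -> : (fun omega => u t omega s 0 ^+ 2) =
    (fun omega => amp t ^+ 2 * v t omega s 0 ^+ 2).
  by apply/funext => omega; rewrite u_coord // exprMn.
rewrite meanZ; last exact: (gauss_coord_L2 (v_meas t0) (v_gauss t0) s).2.
rewrite (gauss_coord_var (v_meas t0) (v_gauss t0)).
by rewrite ler_piMl ?gauss_var_ge0 // amp2_le1.
Qed.

Lemma u_coord_borel t s : borel_fun (fun x : 'cV[R]_N => amp t * x s 0).
Proof. by apply: measurable_funM; [exact: measurable_cst | exact: borel_coord]. Qed.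

Lemma v_adapted t i s : (0 < t)%N -> i != inr t.-1 -> adapted i (fun omega => v t omega s 0).
Proof.
case: t => // t _ it; apply: (@others_comp _ _ _ _ _ noise i (inr t) (fun x => x s 0)).
  by rewrite eq_sym.
exact: borel_coord.
Qed.

Lemma u_adapted t i s : (0 < t)%N -> i != inr t.-1 -> adapted i (fun omega => u t omega s 0).
Proof.
move=> t0 it; rewrite u_coordE //; apply: measurable_funM; first exact: measurable_cst.
exact: v_adapted.
Qed.

Lemma wc_adapted t i s : (0 < t)%N -> i != inl t.-1 -> adapted i (fun omega => wc t omega s 0).
Proof.
case: t => // t _ it.
rewrite (_ : (fun _ => _) = (fun x : 'cV[R]_N => clamp (x s 0)) \o noise (inl t)).
  by apply: others_comp; [rewrite eq_sym | exact: clamp_coord_borel].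
by apply/funext => omega /=; rewrite wcE.
Qed.

(** In a correlation of two summands the factor that comes last in time is centered
    and independent of all the others. *)
Lemma orthogonal_others i (g : 'cV[R]_N -> R) (F Y Z : T -> R) :
  (forall omega, F omega = g (noise i omega) * Y omega) ->
  borel_fun g -> L2 P (g \o noise i) -> mean P (g \o noise i) = 0 ->
  adapted i Y -> adapted i Z -> L2 P Y -> L2 P Z -> L2 P F ->
  mean P (fun omega => Z omega * F omega) = 0.
Proof.
move=> FE mg Lg g0 aY aZ LY LZ LF.
have E : (fun omega => g (noise i omega) * (Y omega * Z omega)) =
    (fun omega => Z omega * F omega).
  by apply/funext => omega; rewrite FE; ring.
have := @mean_mul_others _ _ _ P _ _ noise noise_meas wv_indep i g
  (fun omega => Y omega * Z omega) mg.
rewrite E; apply => //.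
- exact: measurable_funM.
- exact: L2_itg.
- exact: itg_mulL2.
- exact: itg_mulL2.
Qed.

Lemma L2_mul_of_sqr (X Y : T -> R) : measurable_fun setT X -> measurable_fun setT Y ->
  L2 P (fun omega => X omega ^+ 2) -> L2 P (fun omega => Y omega ^+ 2) ->
  L2 P (fun omega => X omega * Y omega).
Proof.
move=> mX mY LX LY; split; first exact: measurable_funM.
by have := itg_mulL2 LX LY; congr itg; apply/funext => omega; rewrite exprMn.
Qed.

Definition ae_slow_sums (f : nat -> T -> R) := {ae P, forall omega, slow_sums (f^~ omega)}.

Lemma v_noise t : (0 < t)%N -> noise (inr t.-1) = v t.
Proof. by case: t. Qed.

Lemma w_noise t : (0 < t)%N -> noise (inl t.-1) = w t.
Proof. by case: t. Qed.

Lemma orthogonal_u t s (F Y Z : T -> R) : (0 < t)%N ->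
  (forall omega, F omega = u t omega s 0 * Y omega) ->
  adapted (inr t.-1) Y -> adapted (inr t.-1) Z -> L2 P Y -> L2 P Z -> L2 P F ->
  mean P (fun omega => Z omega * F omega) = 0.
Proof.
move=> t0 FE aY aZ LY LZ LF.
have gE : (fun x : 'cV[R]_N => amp t * x s 0) \o noise (inr t.-1) =
   (fun omega => u t omega s 0) by rewrite v_noise // u_coordE.
apply: (@orthogonal_others (inr t.-1) (fun x => amp t * x s 0) F Y Z) => //.
- by move=> omega; rewrite FE u_coord // v_noise.
- exact: u_coord_borel.
- by rewrite gE; exact: u_L2.
rewrite gE u_coordE // meanZ; last exact/L2_itg/(gauss_coord_L2 (v_meas t0) (v_gauss t0)).
by rewrite (gauss_coord_mean (v_meas t0) (v_gauss t0)) mulr0.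
Qed.

Lemma orthogonal_w t s (F Y Z : T -> R) : (0 < t)%N ->
  (forall omega, F omega = wc t omega s 0 * Y omega) ->
  adapted (inl t.-1) Y -> adapted (inl t.-1) Z -> L2 P Y -> L2 P Z -> L2 P F ->
  mean P (fun omega => Z omega * F omega) = 0.
Proof.
move=> t0 FE aY aZ LY LZ LF.
have gE : (fun x : 'cV[R]_N => clamp (x s 0)) \o noise (inl t.-1) =
   (fun omega => wc t omega s 0).
  by rewrite w_noise //; apply/funext => omega /=; rewrite wcE.
apply: (@orthogonal_others (inl t.-1) (fun x => clamp (x s 0)) F Y Z) => //.
- by move=> omega; rewrite FE wcE w_noise.
- exact: clamp_coord_borel.
- by rewrite gE; exact: wc_L2.
by rewrite gE wc_mean.
Qed.

Lemma one_adapted i : adapted i (fun=> 1).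
Proof. exact: measurable_cst. Qed.

Let addk0 k i : (0 < k)%N -> (0 < k + i)%N.
Proof. by move=> k0; rewrite addn_gt0 k0. Qed.

Lemma mean_u_bound (i s : 'I_N) : ae_slow_sums (fun k omega => u (k + i)%N omega s 0).
Proof.
apply: (@orthogonal_sum_bound _ _ _ _ _ (gauss_var R)).
- by move=> k k0; apply: u_L2; exact: addk0.
- by move=> k k0; apply: u_var; exact: addk0.
move=> j k j0 jk; have k0 : (0 < k)%N by exact: ltn_trans jk.
apply: (orthogonal_u (addk0 i k0) (s := s) (Y := fun=> 1)).
- by move=> omega; rewrite mulr1.
- exact: one_adapted.
- by apply: u_adapted; [exact: addk0 | apply/eqP => -[]; lia].
- exact: L2_cst.
- by apply: u_L2; exact: addk0.
- by apply: u_L2; exact: addk0.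
Qed.

Lemma wc_var t s : (0 < t)%N -> mean P (fun omega => wc t omega s 0 ^+ 2) <= Cw ^+ 2.
Proof.
move=> t0; rewrite -[leRHS](mean_cst P).
apply: mean_le; [exact: (wc_L2 s t0).2 | exact: itg_cst |].
move=> omega; rewrite wcE -[X in X <= _]real_normK ?num_real // ler_sqr ?nnegrE ?clamp_le //.
exact: ltW.
Qed.

Lemma mean_w_bound (i s : 'I_N) : ae_slow_sums (fun k omega => wc (k + i).+1 omega s 0).
Proof.
apply: (@orthogonal_sum_bound _ _ _ _ _ (Cw ^+ 2)).
- by move=> k k0; apply: wc_L2.
- by move=> k k0; apply: wc_var.
move=> j k j0 jk; have k0 : (0 < k)%N by exact: ltn_trans jk.
apply: (orthogonal_w (ltn0Sn (k + i)) (s := s) (Y := fun=> 1)).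
- by move=> omega; rewrite mulr1.
- exact: one_adapted.
- by apply: wc_adapted => //; apply/eqP => -[]; lia.
- exact: L2_cst.
- exact: wc_L2.
- exact: wc_L2.
Qed.

Lemma cov_uw_bound (i s j t : 'I_N) :
  ae_slow_sums (fun k omega => u (k + i)%N omega s 0 * wc (k + j).+1 omega t 0).
Proof.
have Luw k : (0 < k)%N ->
    L2 P (fun omega => u (k + i)%N omega s 0 * wc (k + j).+1 omega t 0).
  move=> k0; have := @L2_mul_bounded _ _ _ P _ (fun omega => wc (k + j).+1 omega t 0) Cw
    (u_L2 s (addk0 i k0)) (wc_measurable t (ltn0Sn _)).
  move=> h; rewrite (_ : (fun _ => _) = (fun omega => wc (k + j).+1 omega t 0 * u (k + i)%N omega s 0)).
    by apply: h => omega; rewrite wcE clamp_le.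
  by apply/funext => omega; rewrite mulrC.
apply: (@orthogonal_sum_bound _ _ _ _ _ (Cw ^+ 2 * gauss_var R)) => //.
  move=> k k0; have iu := (u_L2 s (addk0 i k0)).2.
  apply: (@le_trans _ _ (mean P (fun omega => Cw ^+ 2 * u (k + i)%N omega s 0 ^+ 2))).
    apply: mean_le; [exact: (Luw k k0).2 | exact: itgZ |] => omega.
    rewrite exprMn mulrC ler_wpM2r ?sqr_ge0 // wcE.
    by rewrite -[X in X <= _]real_normK ?num_real // ler_sqr ?nnegrE ?clamp_le // ltW.
  by rewrite meanZ // ler_wpM2l ?sqr_ge0 // u_var // addk0.
move=> k' k k'0 jk; have k0 : (0 < k)%N by exact: ltn_trans jk.
apply: (orthogonal_u (addk0 i k0) (s := s) (Y := fun omega => wc (k + j).+1 omega t 0)).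
- by [].
- by apply: wc_adapted.
- apply: measurable_funM; last exact: wc_adapted.
  by apply: u_adapted; [exact: addk0 | apply/eqP => -[]; lia].
- exact: wc_L2.
- exact: Luw.
- exact: Luw.
Qed.

Lemma sqrB_le (a c : R) : (a - c) ^+ 2 <= 2 * a ^+ 2 + 2 * c ^+ 2.
Proof. by have := sqr_ge0 (a + c); nra. Qed.

Lemma u_sqr_L2 t s : (0 < t)%N -> L2 P (fun omega => u t omega s 0 ^+ 2).
Proof.
move=> t0; rewrite (_ : (fun _ => _) = (fun omega => amp t ^+ 2 * v t omega s 0 ^+ 2)).
  by apply: L2Z; exact: (gauss_coord_L4 (v_meas t0) (v_gauss t0)).
by apply/funext => omega; rewrite u_coord // exprMn.
Qed.

Lemma u_sqr_le t s omega : (0 < t)%N -> u t omega s 0 ^+ 2 <= v t omega s 0 ^+ 2.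
Proof. by move=> t0; rewrite u_coord // exprMn ler_piMl ?sqr_ge0 // amp2_le1. Qed.

Lemma uu_L2 p s q t : (0 < p)%N -> (0 < q)%N ->
  L2 P (fun omega => u p omega s 0 * u q omega t 0).
Proof.
move=> p0 q0; apply: L2_mul_of_sqr; [exact: (u_L2 s p0).1 | exact: (u_L2 t q0).1 | |].
  exact: u_sqr_L2.
exact: u_sqr_L2.
Qed.

Lemma uu_var p s q t : (0 < p)%N -> (0 < q)%N ->
  mean P (fun omega => (u p omega s 0 * u q omega t 0) ^+ 2) <= 2 * gauss_moment4 R.
Proof.
move=> p0 q0.
have ip := (gauss_coord_L4 (v_meas p0) (v_gauss p0) s).2.
have iq := (gauss_coord_L4 (v_meas q0) (v_gauss q0) t).2.
apply: (@le_trans _ _ (mean P (fun omega => (v p omega s 0 ^+ 2) ^+ 2 + (v q omega t 0 ^+ 2) ^+ 2))).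
  apply: mean_le; [exact: (uu_L2 s t p0 q0).2 | exact: itgD |] => omega.
  have := u_sqr_le s omega p0; have := u_sqr_le t omega q0.
  have := sqr_ge0 (u p omega s 0); have := sqr_ge0 (u q omega t 0).
  rewrite exprMn; set A := u p _ _ _ ^+ 2; set B := u q _ _ _ ^+ 2.
  set A' := v p _ _ _ ^+ 2; set B' := v q _ _ _ ^+ 2 => B0 A0 BB AA.
  have : A * B <= A' * B' by exact: ler_pM.
  by have := sqr_ge0 (A' - B'); have := sqr_ge0 A'; have := sqr_ge0 B'; nra.
rewrite meanD // (gauss_coord_mu4 (v_meas p0) (v_gauss p0)).
by rewrite (gauss_coord_mu4 (v_meas q0) (v_gauss q0)); lra.
Qed.

Lemma amp_gauss_var_le p : (0 < p)%N -> 0 <= gauss_var R * p%:R `^ (- eps) <= gauss_var R.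
Proof.
move=> p0; rewrite mulr_ge0 ?gauss_var_ge0 ?powR_ge0 //=.
by rewrite ler_piMr ?gauss_var_ge0 // -amp_sqr amp2_le1.
Qed.

(** At distinct times the later input carries the orthogonality; at equal times it is
    carried by the centered product of two coordinates of one input. *)
Lemma cov_uu_bound (i s j t : 'I_N) :
  ae_slow_sums (fun k omega => u (k + i)%N omega s 0 * u (k + j)%N omega t 0 -
    ((i, s) == (j, t))%:R * (gauss_var R * (k + i)%:R `^ (- eps))).
Proof.
pose c k := ((i, s) == (j, t))%:R * (gauss_var R * (k + i)%:R `^ (- eps)).
have Lf k : (0 < k)%N ->
    L2 P (fun omega => u (k + i)%N omega s 0 * u (k + j)%N omega t 0 - c k).
  by move=> k0; apply: L2D; [exact: uu_L2 (addk0 _ k0) (addk0 _ k0) | exact: L2_cst].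
have c_le k : (0 < k)%N -> c k ^+ 2 <= gauss_var R ^+ 2.
  move=> k0; have /andP[c0 c1] := amp_gauss_var_le (addk0 i k0).
  rewrite /c; case: (_ == _); rewrite ?mul1r ?mul0r ?expr0n ?sqr_ge0 //=.
  by rewrite ler_sqr ?nnegrE ?gauss_var_ge0.
apply: (@orthogonal_sum_bound _ _ _ _ _ (4 * gauss_moment4 R + 2 * gauss_var R ^+ 2)) => //.
  move=> k k0; have Lu := uu_L2 s t (addk0 i k0) (addk0 j k0).
  apply: (@le_trans _ _ (mean P (fun omega =>
     2 * (u (k + i)%N omega s 0 * u (k + j)%N omega t 0) ^+ 2 + 2 * c k ^+ 2))).
    apply: mean_le; [exact: (Lf k k0).2 | |] => [|omega].
      apply: itgD; [apply: itgZ; exact: Lu.2 | exact: itg_cst].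
    exact: sqrB_le.
  rewrite meanD; [|apply: itgZ; exact: Lu.2 | exact: itg_cst].
  rewrite meanZ; last exact: Lu.2.
  rewrite mean_cst; have := uu_var s t (addk0 i k0) (addk0 j k0); have := c_le k k0; lra.
move=> k' k k'0 kk; have k0 : (0 < k)%N by exact: ltn_trans kk.
have ki := addk0 i k0; have kj := addk0 j k0.
have [eij|nij] := eqVneq i j.
  subst j; pose g (x : 'cV[R]_N) := amp (k + i)%N ^+ 2 * (x s 0 * x t 0 - (s == t)%:R * gauss_var R).
  have gE omega : u (k + i)%N omega s 0 * u (k + i)%N omega t 0 - c k =
      g (noise (inr (k + i).-1) omega) * 1.
    rewrite v_noise // mulr1 !u_coord // /g /c -amp_sqr.
    by rewrite xpair_eqE eqxx /=; ring.
  have Lv := gauss_coord_L2 (v_meas ki) (v_gauss ki).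
  have gE' : g \o noise (inr (k + i).-1) =
      (fun omega => u (k + i)%N omega s 0 * u (k + i)%N omega t 0 - c k).
    by apply/funext => omega; rewrite gE mulr1.
  apply: (@orthogonal_others (inr (k + i).-1) g _ (fun=> 1)) gE _ _ _ _ _ _ _ _.
  - apply: measurable_funM; first exact: measurable_cst.
    apply: measurable_funB; last exact: measurable_cst.
    by apply: measurable_funM; exact: borel_coord.
  - by rewrite gE'; exact: Lf.
  - rewrite v_noise //.
    have iv := itg_mulL2 (Lv s) (Lv t).
    rewrite (_ : _ \o _ = fun omega => amp (k + i)%N ^+ 2 *
       (v (k + i)%N omega s 0 * v (k + i)%N omega t 0 + (- ((s == t)%:R * gauss_var R)))) //.
    rewrite meanZ; last by apply: itgD => //; exact: itg_cst.
    rewrite meanD //; last exact: itg_cst.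
    by rewrite (gauss_coord_cov (v_meas ki) (v_gauss ki)) mean_cst subrr mulr0.
  - exact: one_adapted.
  - apply: measurable_funB; last exact: measurable_cst.
    by apply: measurable_funM; apply: u_adapted; rewrite ?addk0 //; apply/eqP => -[]; lia.
  - exact: L2_cst.
  - exact: Lf.
  - exact: Lf.
have c0 m : c m = 0 by rewrite /c xpair_eqE (negbTE nij) mul0r.
have nij' : (i != j :> nat) by rewrite val_eqE.
have [ij|ji] := ltnP i j.
  apply: (orthogonal_u kj (s := t) (Y := fun omega => u (k + i)%N omega s 0)).
  - by move=> omega; rewrite -/(c k) c0 subr0 mulrC.
  - by apply: u_adapted => //; apply/eqP => -[]; lia.
  - apply: measurable_funB; last exact: measurable_cst.
    by apply: measurable_funM; apply: u_adapted; rewrite ?addk0 //; apply/eqP => -[]; lia.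
  - exact: u_L2.
  - exact: Lf.
  - exact: Lf.
apply: (orthogonal_u ki (s := s) (Y := fun omega => u (k + j)%N omega t 0)).
- by move=> omega; rewrite -/(c k) c0 subr0.
- by apply: u_adapted => //; apply/eqP => -[]; lia.
- apply: measurable_funB; last exact: measurable_cst.
  by apply: measurable_funM; apply: u_adapted; rewrite ?addk0 //; apply/eqP => -[]; lia.
- exact: u_L2.
- exact: Lf.
- exact: Lf.
Qed.

Local Notation B := (diag_mx b).

(** The trajectory issued from [0]: unlike the observed one, whose initial state may
    depend on the whole noise, it is independent of the later noise. *)
Fixpoint free_state (k : nat) (omega : T) : 'cV[R]_N :=
  if k is l.+1 then alpha + G *m free_state l omega + (B *m u l omega + wc l.+1 omega)
  else 0.

Lemma u_adapted_w k m s : adapted (inl m) (fun omega => u k omega s 0).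
Proof.
case: k => [|k]; last by apply: u_adapted.
by rewrite (_ : (fun _ => _) = fun=> u0 s 0) //; apply/funext => omega; rewrite u_init.
Qed.

Lemma free_state_adapted k m s : (k <= m)%N ->
  adapted (inl m) (fun omega => free_state k omega s 0).
Proof.
elim: k s => [|k IH] s km.
  by rewrite (_ : (fun _ => _) = fun=> 0) //; apply/funext => omega; rewrite mxE.
rewrite (_ : (fun _ => _) = fun omega =>
   (alpha s 0 + \sum_l G s l * free_state k omega l 0) +
   (\sum_l B s l * u k omega l 0 + wc k.+1 omega s 0)); last first.
  by apply/funext => omega; rewrite /= !mxE.
apply: measurable_funD; apply: measurable_funD.
- exact: measurable_cst.
- apply: measurable_sum => l; apply: measurable_funM; first exact: measurable_cst.
  by apply: IH; exact: ltnW.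
- apply: measurable_sum => l; apply: measurable_funM; first exact: measurable_cst.
  exact: u_adapted_w.
- by apply: wc_adapted => //; apply/eqP => -[]; lia.
Qed.

Lemma sqn_wc t omega : sqn (wc t omega) <= N%:R * Cw ^+ 2.
Proof.
rewrite sqn_colE mulr_natl -[X in _ *+ X]card_ord -sumr_const ler_sum // => i _.
rewrite wcE -[X in X <= _]real_normK ?num_real // ler_sqr ?nnegrE ?clamp_le //.
exact: ltW.
Qed.

(** A majorant of the squared norm of the forcing term [alpha + B u_k + w_(k+1)]. *)
Definition drive (k : nat) (omega : T) : R :=
  2 * sqn alpha + 4 * N%:R * Cw ^+ 2 + 4 * sqn B * sqn (u k omega).

Lemma drive_ge0 k omega : 0 <= drive k omega.
Proof.
have h1 := sqn_ge0 alpha; have h2 := sqr_ge0 Cw; have h3 := sqn_ge0 B.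
have h4 := mulr_ge0 h3 (sqn_ge0 (u k omega)).
by have h5 := mulr_ge0 (ler0n R N) h2; rewrite /drive; lra.
Qed.

Lemma drive_bound k omega w' : sqn w' <= N%:R * Cw ^+ 2 ->
  sqn (alpha + (B *m u k omega + w')) <= drive k omega.
Proof.
move=> hw; have h1 := sqnD alpha (B *m u k omega + w').
have h2 := sqnD (B *m u k omega) w'.
have h3 := sqnM B (u k omega).
by rewrite /drive; lra.
Qed.

Lemma u_sqn_itg k : itg P (fun omega => sqn (u k omega)).
Proof.
case: k => [|k].
  rewrite (_ : (fun _ => _) = fun=> sqn u0); first exact: itg_cst.
  by apply/funext => omega; rewrite u_init.
rewrite (_ : (fun _ => _) = fun omega => \sum_s u k.+1 omega s 0 ^+ 2).
  by apply: itg_sum => s _; exact: (u_L2 s (ltn0Sn k)).2.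
by apply/funext => omega; rewrite sqn_colE.
Qed.

Lemma u_sqn_mean k : mean P (fun omega => sqn (u k omega)) <= sqn u0 + N%:R * gauss_var R.
Proof.
have s0 := sqn_ge0 u0; have g0 : 0 <= N%:R * gauss_var R by rewrite mulr_ge0 // gauss_var_ge0.
case: k => [|k].
  rewrite (_ : (fun _ => _) = fun=> sqn u0); first by rewrite mean_cst lerDl.
  by apply/funext => omega; rewrite u_init.
rewrite (_ : (fun _ => _) = fun omega => \sum_s u k.+1 omega s 0 ^+ 2); last first.
  by apply/funext => omega; rewrite sqn_colE.
rewrite mean_sum; last by move=> s _; exact: (u_L2 s (ltn0Sn k)).2.
apply: (@le_trans _ _ (N%:R * gauss_var R)); last by rewrite lerDr.
rewrite mulr_natl -[X in _ *+ X]card_ord -sumr_const ler_sum // => s _.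
exact: u_var.
Qed.

Lemma drive_itg k : itg P (drive k).
Proof. by apply: itgD; [exact: itg_cst | apply: itgZ; exact: u_sqn_itg]. Qed.

Definition drive_mean : R :=
  2 * sqn alpha + 4 * N%:R * Cw ^+ 2 + 4 * sqn B * (sqn u0 + N%:R * gauss_var R).

Lemma drive_mean_le k : mean P (drive k) <= drive_mean.
Proof.
rewrite /drive meanD; [|exact: itg_cst | apply: itgZ; exact: u_sqn_itg].
rewrite mean_cst meanZ; last exact: u_sqn_itg.
by rewrite lerD2l ler_wpM2l ?u_sqn_mean // mulr_ge0 // sqn_ge0.
Qed.

Hypothesis G_stable : spectral_radius G < 1.

(** The means of a Lyapunov function along the trajectory satisfy a contracting
    affine recursion. *)
Lemma free_state_var : exists2 C, 0 <= C & forall k s,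
  itg P (fun omega => free_state k omega s 0 ^+ 2) /\
  mean P (fun omega => free_state k omega s 0 ^+ 2) <= C.
Proof.
have [V [r [K [M [/andP[r0 r1] K0 hV hVG]]]]] := lyapunov G_stable.
have d0 : 0 < 1 - r by rewrite subr_gt0.
pose fix e (k : nat) (omega : T) {struct k} : R := if k is l.+1 then r * e l omega + K * drive l omega else 0.
have V0 : V 0 <= 0 by have /andP[_] := hV 0; rewrite sqn0 mulr0.
have Ve k omega : V (free_state k omega) <= e k omega.
  elim: k => [|k IH] //=.
  have -> : alpha + G *m free_state k omega + (B *m u k omega + wc k.+1 omega) =
     G *m free_state k omega + (alpha + (B *m u k omega + wc k.+1 omega)).
    by rewrite addrAC addrC addrA.
  apply: (le_trans (hVG _ _)); apply: lerD; first exact: ler_wpM2l.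
  by apply: ler_wpM2l => //; apply: drive_bound; exact: sqn_wc.
have ie k : itg P (e k).
  elim: k => [|k IH]; first exact: itg_cst.
  apply: (@itgD _ _ _ _ (fun omega => r * e k omega) (fun omega => K * drive k omega)).
    exact: itgZ.
  by apply: itgZ; exact: drive_itg.
(* The fixed point of the recursion for the means. *)
pose Ce := K * drive_mean / (1 - r).
have dm0 : 0 <= drive_mean.
  apply: le_trans (drive_mean_le 0); apply: mean_ge0 => omega.
  exact: drive_ge0.
have Ce0 : 0 <= Ce by apply: divr_ge0; [exact: mulr_ge0 | exact: ltW].
have me k : mean P (e k) <= Ce.
  elim: k => [|k IH]; first by rewrite mean_cst.
  rewrite (meanD (X := fun omega => r * e k omega) (Y := fun omega => K * drive k omega));
    [|exact: itgZ | apply: itgZ; exact: drive_itg].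
  rewrite !meanZ //; last exact: drive_itg.
  apply: (@le_trans _ _ (r * Ce + K * drive_mean)).
    by apply: lerD; apply: ler_wpM2l => //; exact: drive_mean_le.
  have -> : K * drive_mean = (1 - r) * Ce by rewrite /Ce [RHS]mulrC divfK // gt_eqF.
  by rewrite mulrBl mul1r addrC subrK.
exists Ce => // k s.
have le_e omega : free_state k omega s 0 ^+ 2 <= e k omega.
  apply: le_trans (Ve k omega); have /andP[+ _] := hV (free_state k omega).
  by apply: le_trans; exact: sqr_entry_le.
have mf : measurable_fun setT (fun omega => free_state k omega s 0).
  by apply: (others_measurable_fun noise_meas (i0 := inl k)); exact: free_state_adapted.
have iF : itg P (fun omega => free_state k omega s 0 ^+ 2).
  apply: itg_le (ie k) _; first exact: measurable_funX.
  by move=> omega; rewrite ger0_norm ?sqr_ge0.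
by split => //; apply: le_trans (me k); exact: mean_le.
Qed.

Lemma regressorE (x : nat -> 'cV[R]_N) k (l : 'I_(1 + N)) :
  regressor x k l 0 = if fintype.split l is inr i then x k i 0 else 1.
Proof.
rewrite /regressor mxE; case: splitP => // j _; rewrite mxE.
by rewrite (ord1 j).
Qed.

Lemma free_correlation_bound (s : 'I_N) (l : 'I_(1 + N)) :
  ae_slow_sums (fun k omega => wc k.+1 omega s 0 * regressor (free_state^~ omega) k l 0).
Proof.
have [C C0 hC] := free_state_var.
pose Y k omega := regressor (free_state^~ omega) k l 0.
have YE k : Y k = fun omega => if fintype.split l is inr i then free_state k omega i 0 else 1.
  by apply/funext => omega; exact: regressorE.
have aY k m : (k <= m)%N -> adapted (inl m) (Y k).
  move=> km; rewrite YE; case: (fintype.split l) => [_|i]; first exact: one_adapted.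
  exact: free_state_adapted.
have LY k : L2 P (Y k).
  split; first by apply: (others_measurable_fun noise_meas (i0 := inl k)); exact: aY.
  rewrite YE; case: (fintype.split l) => [_|i]; last exact: (hC k i).1.
  by rewrite expr1n; exact: itg_cst.
have mY k : mean P (fun omega => Y k omega ^+ 2) <= 1 + C.
  rewrite YE; case: (fintype.split l) => [_|i].
    by rewrite expr1n mean_cst lerDl.
  by apply: (le_trans (hC k i).2); rewrite lerDr.
have LF k : L2 P (fun omega => wc k.+1 omega s 0 * Y k omega).
  apply: (L2_mul_bounded (c := Cw)) => //; first exact: wc_measurable.
  by move=> omega; rewrite wcE clamp_le.
apply: (@orthogonal_sum_bound _ _ _ _ _ (Cw ^+ 2 * (1 + C))) => // [k k0|k' k k'0 kk].
  apply: (@le_trans _ _ (mean P (fun omega => Cw ^+ 2 * Y k omega ^+ 2))).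
    apply: mean_le; [exact: (LF k).2 | apply: itgZ; exact: (LY k).2 |] => omega.
    rewrite exprMn ler_wpM2r ?sqr_ge0 // wcE.
    by rewrite -[X in X <= _]real_normK ?num_real // ler_sqr ?nnegrE ?clamp_le // ltW.
  by rewrite meanZ ?ler_wpM2l ?sqr_ge0 //; exact: (LY k).2.
apply: (orthogonal_w (ltn0Sn k) (s := s) (Y := Y k)).
- by [].
- exact: aY.
- apply: measurable_funM; first by apply: wc_adapted => //; apply/eqP => -[]; lia.
  by apply: aY; exact: ltnW.
- exact: LY.
- exact: LF.
- exact: LF.
Qed.

End Model.

(** * Energy of a stable recursion *)

Section Assembly.
Variable R : realType.

Lemma slow_sums_uniform (I : finType) (f : I -> nat -> R) :
  (forall i, slow_sums (f i)) -> exists2 K : R, 0 <= K &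
  forall i n, (0 < n)%N -> `|\sum_(1 <= k < n.+1) f i k| <= K * root72 n ^+ 55.
Proof.
move=> h.
have /choice[K hK] : forall i, exists K : R, 0 <= K /\
    forall n, (0 < n)%N -> `|\sum_(1 <= k < n.+1) f i k| <= K * root72 n ^+ 55.
  by move=> i; have [K K0 hK] := h i; exists K.
exists (\sum_i K i) => [|i n n0]; first by apply: sumr_ge0 => i _; exact: (hK i).1.
apply: le_trans ((hK i).2 n n0) _; apply: ler_wpM2r; first exact/exprn_ge0/root72_ge0.
by rewrite (bigD1 i) //= lerDl; apply: sumr_ge0 => j _; exact: (hK j).1.
Qed.

Lemma root72_exp_le p q n : (0 < n)%N -> (p <= q)%N -> root72 n ^+ p <= root72 n ^+ q :> R.
Proof. by move=> n0 pq; rewrite ler_weXn2l // root72_ge1. Qed.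

Lemma slow_sumsD (f g : nat -> R) : slow_sums f -> slow_sums g ->
  slow_sums (fun k => f k + g k).
Proof.
move=> [K K0 hf] [L L0 hg]; exists (K + L) => [|n n0]; first exact: addr_ge0.
rewrite big_split mulrDl; apply: le_trans (ler_normD _ _) _.
by apply: lerD; [exact: hf | exact: hg].
Qed.

(** A bounded sequence times a square summable one: the partial sums are at most
    of order the square root of [n], by the Cauchy-Schwarz inequality. *)
Lemma slow_sums_l2 (f g : nat -> R) (c E : R) : 0 <= E ->
  (forall k, f k ^+ 2 <= c) -> (forall n, \sum_(1 <= k < n.+1) g k ^+ 2 <= E) ->
  slow_sums (fun k => f k * g k).
Proof.
move=> E0 hf hg; have c0 : 0 <= c by apply: le_trans (hf 0%N); exact: sqr_ge0.
have D0 : 0 <= 1 + c * E by apply: addr_ge0 => //; exact: mulr_ge0.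
exists (1 + c * E) => // n n0.
have r0 : 0 <= root72 n :> R by exact: root72_ge0.
apply: norm_le_sqr; first by apply: mulr_ge0 => //; exact: exprn_ge0.
apply: (le_trans (sum_cauchy_schwarz _ _ _ _)).
have hf' : \sum_(1 <= k < n.+1) f k ^+ 2 <= c * n%:R.
  apply: (@le_trans _ _ (\sum_(1 <= k < n.+1) c)); first by apply: ler_sum => k _.
  by rewrite sumr_const_nat subSS subn0 mulr_natr.
have cn0 : 0 <= c * n%:R by exact: mulr_ge0.
apply: (@le_trans _ _ (c * n%:R * E)).
  apply: ler_pM => //; first by apply: sumr_ge0 => k _; exact: sqr_ge0.
  by apply: sumr_ge0 => k _; exact: sqr_ge0.
have -> : c * n%:R * E = (c * E) * root72 n ^+ 72 by rewrite root72X mulrAC.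
rewrite exprMn -exprM; apply: ler_pM => //.
- exact: mulr_ge0.
- exact: exprn_ge0.
- by have := mulr_ge0 c0 E0; nra.
- exact: root72_exp_le.
Qed.

Section Energy.
Variables (N' : nat) (G : 'M[R]_N'.+1).
Hypothesis G_stable : spectral_radius G < 1.

(** The total energy of a stable linear recursion is controlled by that of its
    initial state and of its input: sum the one-step decay of the Lyapunov
    function. *)
Lemma state_energy : exists2 L : R, 0 <= L & forall (x f : nat -> 'cV[R]_N'.+1),
  (forall k, x k.+1 = G *m x k + f k) ->
  forall n, \sum_(0 <= k < n) sqn (x k) <= L * (sqn (x 0%N) + \sum_(0 <= k < n) sqn (f k)).
Proof.
have [V [r [K [M [/andP[r0 r1] K0 hV hVG]]]]] := lyapunov G_stable.
have d0 : 0 < 1 - r by rewrite subr_gt0.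
have V0 y : 0 <= V y.
  by have /andP[+ _] := hV y; apply: le_trans; exact: sqn_ge0.
exists ((`|M| + K) / (1 - r)) => [|x f xE n].
  by apply: divr_ge0; [exact: addr_ge0 | exact: ltW].
rewrite mulrAC ler_pdivlMr // mulrC.
set F := \sum_(0 <= k < n) sqn (f k).
have F0 : 0 <= F by apply: sumr_ge0 => k _; exact: sqn_ge0.
have s0 := sqn_ge0 (x 0%N).
have decay : V (x n) + (1 - r) * \sum_(0 <= k < n) V (x k) <= V (x 0%N) + K * F.
  rewrite /F; elim: (n) => [|m IH]; first by rewrite !big_geq // !mulr0.
  rewrite !big_nat_recr //= !mulrDr; have := hVG (x m) (f m); rewrite -xE.
  by move: IH; lra.
have h1 : \sum_(0 <= k < n) sqn (x k) <= \sum_(0 <= k < n) V (x k).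
  by apply: ler_sum => k _; have /andP[] := hV (x k).
have h2 : V (x 0%N) <= `|M| * sqn (x 0%N).
  have /andP[_ h] := hV (x 0%N); apply: (le_trans h).
  by rewrite ler_wpM2r // ler_norm.
have h3 := ler_wpM2l (ltW d0) h1; have h4 := V0 (x n).
have h5 := mulr_ge0 (normr_ge0 M) F0; have h6 := mulr_ge0 K0 s0.
by rewrite mulrDl !mulrDr; lra.
Qed.

End Energy.

End Assembly.

(** * Energy and correlations along one trajectory *)

Section Trajectory.
Variables (R : realType) (N' : nat).
Local Notation N := N'.+1.
(* [w k] is the noise that drives [x k.+1]. *)
Variables (G B : 'M[R]_N) (alpha : 'cV[R]_N) (x u w : nat -> 'cV[R]_N).
Variables (eps sg2 W : R).
Hypothesis G_stable : spectral_radius G < 1.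
Hypothesis x_rec : forall k, x k.+1 = alpha + G *m x k + (B *m u k + w k).
Hypothesis eps_ge0 : 0 <= eps.
Hypothesis sg2_ge0 : 0 <= sg2.
Hypothesis w_bound : forall k, sqn (w k) <= W.
Hypothesis u_var : forall s,
  slow_sums (fun k => u k s 0 * u k s 0 - sg2 * k%:R `^ (- eps)).

Lemma powR_Neps_le1 k : (0 < k)%N -> k%:R `^ (- eps) <= 1 :> R.
Proof.
move=> k0; rewrite powRN; have h : 1 <= k%:R `^ eps :> R.
  apply: (@le_trans _ _ (1 `^ eps)); first by rewrite powR1.
  by rewrite ge0_ler_powR ?nnegrE // ler1n.
by rewrite invf_le1 // (lt_le_trans ltr01).
Qed.

Lemma input_energy : exists2 C : R, 0 <= C &
  forall n, (0 < n)%N -> \sum_(1 <= k < n.+1) sqn (u k) <= C * n%:R.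
Proof.
have [K K0 hK] := slow_sums_uniform u_var.
exists (\sum_(s < N) (K + sg2)) => [|n n0].
  by apply: sumr_ge0 => s _; exact: addr_ge0.
under eq_bigr do rewrite sqn_colE.
rewrite exchange_big mulr_suml; apply: ler_sum => s _ /=.
have E : \sum_(1 <= k < n.+1) u k s 0 ^+ 2 =
    \sum_(1 <= k < n.+1) (u k s 0 * u k s 0 - sg2 * k%:R `^ (- eps)) +
    \sum_(1 <= k < n.+1) sg2 * k%:R `^ (- eps).
  by rewrite -big_split; apply: eq_bigr => k _; rewrite /= subrK expr2.
rewrite E mulrDl; apply: lerD.
  apply: (le_trans (ler_norm _)); apply: (le_trans (hK s n n0)).
  by rewrite -root72X; apply: ler_wpM2l => //; exact: root72_exp_le.
apply: (@le_trans _ _ (\sum_(1 <= k < n.+1) sg2)); last first.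
  by rewrite sumr_const_nat subSS subn0 mulr_natr.
rewrite big_nat_cond [leRHS]big_nat_cond; apply: ler_sum => k /andP[/andP[k0 _] _].
by apply: ler_piMr => //; exact: powR_Neps_le1.
Qed.

Lemma sqn_regressor k : sqn (regressor x k) = 1 + sqn (x k).
Proof.
rewrite !sqn_colE big_split_ord big_ord1 /regressor; congr (_ + _).
  by rewrite col_mxEu mxE eqxx expr1n.
by apply: eq_bigr => i _; rewrite col_mxEd.
Qed.

Lemma regressor_energy : exists2 K : R, 0 <= K & forall n, (0 < n)%N ->
  \sum_(1 <= k < n.+1) sqn (regressor x k) <= K * root72 n ^+ 72.
Proof.
have [L L0 hL] := state_energy G_stable.
have [C C0 hC] := input_energy.
pose f k := alpha + (B *m u k + w k).
have xE k : x k.+1 = G *m x k + f k by rewrite x_rec /f addrAC addrC addrA.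
have [D D0 [S S0 fle]] : exists2 D, 0 <= D & exists2 S, 0 <= S &
    forall k, sqn (f k) <= D + S * sqn (u k).
  have W0 : 0 <= W by apply: le_trans (w_bound 0); exact: sqn_ge0.
  have a0 := sqn_ge0 alpha; have b0 := sqn_ge0 B.
  exists (2 * sqn alpha + 4 * W); first lra.
  exists (4 * sqn B) => [|k]; first lra.
  have h1 := sqnD alpha (B *m u k + w k); have h2 := sqnD (B *m u k) (w k).
  by have h3 := sqnM B (u k); have h4 := w_bound k; rewrite /f; lra.
pose a0 := sqn (x 0%N); pose b0 := sqn (u 0%N).
have a00 : 0 <= a0 by exact: sqn_ge0.
have b00 : 0 <= b0 by exact: sqn_ge0.
have K0 : 0 <= 1 + L * (a0 + 2 * D + S * b0 + S * C).
  have h1 := mulr_ge0 S0 b00; have h2 := mulr_ge0 S0 C0.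
  by apply: addr_ge0 => //; apply: mulr_ge0 => //; lra.
exists (1 + L * (a0 + 2 * D + S * b0 + S * C)) => // n n0; rewrite root72X.
under eq_bigr do rewrite sqn_regressor.
rewrite big_split sumr_const_nat subSS subn0 [leRHS]mulrDl mul1r lerD2l.
have n1 : 1 <= n%:R :> R by rewrite ler1n.
have hx : \sum_(1 <= k < n.+1) sqn (x k) <= \sum_(0 <= k < n.+1) sqn (x k).
  by rewrite [leRHS]big_ltn // lerDr sqn_ge0.
apply: (le_trans hx); apply: (le_trans (hL x f xE n.+1)); rewrite -mulrA.
apply: ler_wpM2l => //.
have hf : \sum_(0 <= k < n.+1) sqn (f k) <= D * n.+1%:R + S * (b0 + C * n%:R).
  apply: (@le_trans _ _ (\sum_(0 <= k < n.+1) (D + S * sqn (u k)))).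
    by apply: ler_sum => k _; exact: fle.
  rewrite big_split sumr_const_nat subn0 mulr_natr lerD2l -mulr_sumr.
  by apply: ler_wpM2l => //; rewrite big_ltn // lerD2l hC.
apply: (@le_trans _ _ (a0 + (D * n.+1%:R + S * (b0 + C * n%:R)))).
  by rewrite lerD2l.
rewrite -natr1 !mulrDr mulr1 !mulrDl.
have h1 : a0 <= a0 * n%:R by rewrite ler_peMr.
have h2 : D <= D * n%:R by rewrite ler_peMr.
have h3 : S * b0 <= S * b0 * n%:R by apply: ler_peMr => //; exact: mulr_ge0.
by rewrite [S * (C * _)]mulrA; lra.
Qed.

(** Two trajectories with the same inputs and noise merge so fast that their
    difference is square summable; correlating the noise with it costs no more
    than the square root of the sample size. *)
Lemma correlation_transfer (y : nat -> 'cV[R]_N) s l :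
  (forall k, y k.+1 = alpha + G *m y k + (B *m u k + w k)) ->
  slow_sums (fun k => w k s 0 * regressor y k l 0) ->
  slow_sums (fun k => w k s 0 * regressor x k l 0).
Proof.
move=> y_rec hy; have [L L0 hL] := state_energy G_stable.
pose e k := x k - y k.
have eE k : e k.+1 = G *m e k + 0.
  rewrite /e x_rec y_rec addr0 mulmxBr.
  by rewrite opprD addrACA subrr addr0 opprD addrACA subrr add0r.
have he : slow_sums (fun k => w k s 0 * (regressor x k l 0 - regressor y k l 0)).
  apply: (@slow_sums_l2 _ _ _ W (L * sqn (e 0%N))).
  - by apply: mulr_ge0 => //; exact: sqn_ge0.
  - by move=> k; apply: le_trans (w_bound k); exact: sqr_entry_le.
  move=> n; have := hL e (fun=> 0) eE n.+1.
  rewrite [X in _ + X]big1; last by move=> k _; exact: sqn0.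
  rewrite addr0; apply: le_trans.
  apply: (@le_trans _ _ (\sum_(1 <= k < n.+1) sqn (e k))); last first.
    by rewrite [leRHS]big_ltn // lerDr sqn_ge0.
  apply: ler_sum => k _; rewrite !regressorE; case: (fintype.split l) => [_|i].
    by rewrite subrr expr0n sqn_ge0.
  by have := sqr_entry_le (e k) i 0; rewrite !mxE.
have [K K0 hK] := slow_sumsD hy he; exists K => // n n0.
rewrite (eq_bigr (fun k => w k s 0 * regressor y k l 0 +
   w k s 0 * (regressor x k l 0 - regressor y k l 0))); first exact: hK.
by move=> k _; rewrite mulrBr addrC subrK.
Qed.

End Trajectory.

(** * Almost sure recovery *)

Lemma fnorm_G_part_le (R : realType) N (A : 'M[R]_(N, 1 + N)) : fnorm (G_part A) <= fnorm A.
Proof.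
rewrite !fnormE ler_wsqrtr // /sqn; apply: ler_sum => i _.
rewrite [leRHS]big_split_ord big_ord1 /=.
rewrite (eq_bigr (fun j => A i (rshift 1 j) ^+ 2)) ?lerDr ?sqr_ge0 //.
by move=> j _; rewrite /G_part mxE.
Qed.

Lemma full_measure_subset d (T : measurableType d) (R : realType) (P : probability T R)
  (Q : T -> Prop) : {ae P, forall omega, Q omega} ->
  exists Omega0 : set T, [/\ measurable Omega0, P Omega0 = 1%E &
    forall omega, Omega0 omega -> Q omega].
Proof.
move=> [A [mA PA sA]]; exists (~` A); split.
- exact: measurableC.
- by rewrite probability_setC // PA sube0.
by move=> omega nA; apply: contrapT => nQ; apply: nA; exact: sA.
Qed.

Lemma ae_slow_sums_forall d (T : measurableType d) (R : realType) (P : probability T R)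
  (I : finType) (f : I -> nat -> T -> R) : (forall i, ae_slow_sums P (f i)) ->
  {ae P, forall omega, forall i, slow_sums ((f i)^~ omega)}.
Proof. exact: (@filter_forall _ I (fun i omega => slow_sums ((f i)^~ omega))). Qed.

Lemma aeI d (T : measurableType d) (R : realType) (P : probability T R) (A B : T -> Prop) :
  {ae P, forall omega, A omega} -> {ae P, forall omega, B omega} ->
  {ae P, forall omega, A omega /\ B omega}.
Proof. by move=> hA hB; apply: filterI. Qed.

Section Recovery.
Context (d : measure_display) (T : measurableType d) (R : realType) (P : probability T R).
Variable N' : nat.
Local Notation N := N'.+1.
Variables (G : 'M[R]_N) (alpha : 'cV[R]_N) (b : 'rV[R]_N) (eps Cw alpha0 : R).
Variables (u0 : 'cV[R]_N) (x u v w : nat -> T -> 'cV[R]_N).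
Variables (lam : nat -> T -> R) (Gamma : nat -> T -> 'M[R]_(N, 1 + N)).
Hypothesis G_stable : spectral_radius G < 1.
Hypothesis GB_ctrl : controllable G (diag_mx b).
Hypothesis w_meas : forall t, (0 < t)%N -> random_vector (w t).
Hypothesis w_mean : forall t i, (0 < t)%N ->
  ('E_P[fun omega => (w t omega i 0)%R] = 0)%E.
Hypothesis Cw_gt0 : 0 < Cw.
Hypothesis w_bnd : forall t, (0 < t)%N -> {ae P, forall omega, fnorm (w t omega) <= Cw}.
Hypothesis eps_ge0 : 0 <= eps.
Hypothesis eps_lt : eps < 1 / (3 * (N%:R + 2)).
Hypothesis v_meas : forall t, (0 < t)%N -> random_vector (v t).
Hypothesis v_gauss : forall t, (0 < t)%N -> standard_gaussian P (v t).
Hypothesis u_init : forall omega, u 0%N omega = u0.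
Hypothesis u_def : forall t omega, (0 < t)%N ->
     u t omega = (t%:R `^ (eps / 2))^-1 *: v t omega.
Hypothesis wv_indep : mutually_independent P (noise v w).
Hypothesis x_rec : forall t omega, x t.+1 omega =
     alpha + G *m x t omega + diag_mx b *m u t omega + w t.+1 omega.
Hypothesis alpha0_gt0 : 0 < alpha0.
Hypothesis lam_adm : forall omega, admissible_penalty (x^~ omega) (lam^~ omega).
Hypothesis Gamma_out : forall omega,
     sparse_recovery_output alpha0 (diag_mx b) (x^~ omega) (u^~ omega)
       (lam^~ omega) (Gamma^~ omega).

Lemma eps_le_ninth : eps <= 9^-1.
Proof.
apply/ltW/(lt_le_trans eps_lt); rewrite div1r lef_pV2 ?posrE //.
have : 1 <= N%:R :> R by rewrite ler1n.
lra.
Qed.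

Lemma recovery_ae : {ae P, forall omega,
  (fnorm (G_part (Gamma n.+1 omega) - G) @[n --> \oo] --> (0 : R)) /\
  exists n0 : nat, forall n, (n0 <= n)%N ->
    mxsupport (G_part (Gamma n.+1 omega)) = mxsupport G}.
Proof.
have aw := wc_ae Cw_gt0 w_bnd.
have amu := ae_slow_sums_forall (fun q : 'I_N * 'I_N =>
  mean_u_bound w_meas Cw_gt0 eps_ge0 v_meas v_gauss u_def wv_indep q.1 q.2).
have amw := ae_slow_sums_forall (fun q : 'I_N * 'I_N =>
  mean_w_bound w_meas w_mean Cw_gt0 w_bnd eps_ge0 v_meas wv_indep q.1 q.2).
have auw := ae_slow_sums_forall (fun q : ('I_N * 'I_N) * ('I_N * 'I_N) =>
  cov_uw_bound w_meas Cw_gt0 eps_ge0 v_meas v_gauss u_def wv_indep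
    q.1.1 q.1.2 q.2.1 q.2.2).
have auu := ae_slow_sums_forall (fun q : ('I_N * 'I_N) * ('I_N * 'I_N) =>
  cov_uu_bound w_meas Cw_gt0 eps_ge0 v_meas v_gauss u_def wv_indep
    q.1.1 q.1.2 q.2.1 q.2.2).
have afr := ae_slow_sums_forall (fun q : 'I_N * 'I_(1 + N) =>
  free_correlation_bound alpha b w_meas w_mean Cw_gt0 w_bnd eps_ge0 v_meas v_gauss
    u_init u_def wv_indep G_stable q.1 q.2).
(* All the fluctuation bounds hold together outside of one null set. *)
have good := aeI aw (aeI amu (aeI amw (aeI auw (aeI auu afr)))).
apply: filterS good => omega [hw [hmu [hmw [huw [huu hfr]]]]].
pose X := x^~ omega; pose U := u^~ omega; pose W k := wc Cw w k.+1 omega.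
have WE k : W k = w k.+1 omega by exact: hw.
have X_rec k : X k.+1 = alpha + G *m X k + (diag_mx b *m U k + W k).
  by rewrite /X x_rec WE addrA.
have [K1 K10 hK1] := slow_sums_uniform hmu.
have [K2 K20 hK2] := slow_sums_uniform hmw.
have [K3 K30 hK3] := slow_sums_uniform huw.
have [K4 K40 hK4] := slow_sums_uniform huu.
pose K := K1 + K2 + K3 + K4.
have K0 : 0 <= K by rewrite /K; lra.
have up (a L : R) n : 0 <= L -> `|a| <= L * root72 n ^+ 55 -> L <= K ->
    `|a| <= K * root72 n ^+ 55.
  move=> L0 aL LK; apply: (le_trans aL); apply: ler_wpM2r => //.
  exact/exprn_ge0/root72_ge0.
have [c c0 exc] : exists2 c, 0 < c & \forall n \near \oo, forall q : 'rV_(1 + N),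
    c * root72 n ^+ 64 * sqn q <= qform (gram X n) q.
  apply: (excitation_bound X_rec GB_ctrl (stable_unit G_stable) eps_ge0 eps_le_ninth
    (@gauss_var_gt0 R) K0) => [n i s|n i s|n i s j t|n i s j t] n0.
  - by apply: (up _ _ _ K10 (hK1 (i, s) n n0)); rewrite /K; lra.
  - by apply: (up _ _ _ K20 (hK2 (i, s) n n0)); rewrite /K; lra.
  - by apply: (up _ _ _ K30 (hK3 ((i, s), (j, t)) n n0)); rewrite /K; lra.
  - by apply: (up _ _ _ K40 (hK4 ((i, s), (j, t)) n n0)); rewrite /K; lra.
have Wb k : sqn (W k) <= N%:R * Cw ^+ 2 by exact: sqn_wc.
have Uvar s : slow_sums (fun k => U k s 0 * U k s 0 - gauss_var R * k%:R `^ (- eps)).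
  have [L L0 hL] := huu ((ord0, s), (ord0, s)); exists L => // n n0.
  have := hL n n0; congr (`|_| <= _); apply: eq_bigr => k _ /=.
  by rewrite addn0 eqxx mul1r.
have [K5 K50 hK5] := regressor_energy G_stable X_rec eps_ge0 (gauss_var_ge0 R) Wb Uvar.
have corr (q : 'I_N * 'I_(1 + N)) :
    slow_sums (fun k => W k q.1 0 * regressor X k q.2 0).
  exact: (correlation_transfer G_stable X_rec Wb (y := (free_state G alpha b Cw u w)^~ omega)).
have [K6 K60 hK6] := slow_sums_uniform corr.
have obsE k : (0 < k)%N ->
    obs (diag_mx b) X U k = row_mx alpha G *m regressor X k + W k.
  move=> _; rewrite /obs X_rec /regressor mul_row_col mulmx1.
  by rewrite [_ *m U k + _]addrC addrA addrK.
have [||cvg_Theta [n0 supp_Theta]] := pathwise_consistency alpha0_gt0 obsE (@lam_adm omega)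
  (@Gamma_out omega) c0 (K := K5 + K6) exc.
- move=> n n1; apply: (le_trans (hK5 n n1)); apply: ler_wpM2r; last lra.
  exact/exprn_ge0/root72_ge0.
- move=> n s l n1; have E : noise_corr X W n s l =
      \sum_(1 <= k < n.+1) W k s 0 * regressor X k l 0.
    rewrite /noise_corr summxE; apply: eq_bigr => k _.
    by rewrite mxE big_ord1 [_^T _ _]mxE.
  rewrite E; apply: (le_trans (hK6 (s, l) n n1)); apply: ler_wpM2r; last lra.
  exact/exprn_ge0/root72_ge0.
have GE : G_part (row_mx alpha G) = G by rewrite /G_part row_mxKr.
split.
  apply: (squeeze_cvgr _ (cvg_cst 0) cvg_Theta).
  near=> n; rewrite sqrtr_ge0 /=.
  apply: le_trans (fnorm_G_part_le _).
  by rewrite -{1}GE /G_part -linearB.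
exists n0 => n nn; have /seteqP[h1 h2] := supp_Theta n nn.
have key i j : (Gamma n.+1 omega i (rshift 1 j) != 0) = (G i j != 0).
  apply/idP/idP => h.
    by have := h1 (i, rshift 1 j) h; rewrite /mxsupport /= row_mxEr.
  by apply: (h2 (i, rshift 1 j)); rewrite /mxsupport /= row_mxEr.
by apply/seteqP; split=> -[i j]; rewrite /mxsupport /= /G_part mxE key.
Unshelve. all: by end_near.
Qed.

End Recovery.

Theorem theorem4 (d : measure_display) (T : measurableType d) (R : realType)
  (P : probability T R) (N : nat)
  (G : 'M[R]_N) (alpha : 'cV[R]_N) (b : 'rV[R]_N) (eps Cw alpha0 : R)
  (u0 : 'cV[R]_N) (x u v w : nat -> T -> 'cV[R]_N)
  (lam : nat -> T -> R) (Gamma : nat -> T -> 'M[R]_(N, 1 + N))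
  (* the system *)
  (G_diag : forall i, G i i = 0)
  (G_stable : spectral_radius G < 1)
  (b_bin : forall i, b 0 i = 0 \/ b 0 i = 1)
  (GB_ctrl : controllable G (diag_mx b))
  (* the noise *)
  (w_meas : forall t, (0 < t)%N -> random_vector (w t))
  (w_id : forall s t, (0 < s)%N -> (0 < t)%N ->
     identically_distributed P (w s) (w t))
  (w_mean : forall t i, (0 < t)%N -> ('E_P[fun omega => (w t omega i 0)%R] = 0)%E)
  (Cw_gt0 : 0 < Cw)
  (w_bnd : forall t, (0 < t)%N -> {ae P, forall omega, fnorm (w t omega) <= Cw})
  (* the inputs *)
  (eps_ge0 : 0 <= eps)
  (eps_lt : eps < 1 / (3 * (N%:R + 2)))
  (v_meas : forall t, (0 < t)%N -> random_vector (v t))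
  (v_gauss : forall t, (0 < t)%N -> standard_gaussian P (v t))
  (u_init : forall omega, u 0%N omega = u0)
  (u_def : forall t omega, (0 < t)%N ->
     u t omega = (t%:R `^ (eps / 2))^-1 *: v t omega)
  (* all the w_t and v_t, t >= 1, are mutually independent *)
  (wv_indep : mutually_independent P
     (fun i : nat + nat => match i with inl t => w t.+1 | inr t => v t.+1 end))
  (* the states *)
  (x_init : random_vector (x 0%N))
  (x_rec : forall t omega, x t.+1 omega =
     alpha + G *m x t omega + diag_mx b *m u t omega + w t.+1 omega)
  (* the algorithm *)
  (alpha0_gt0 : 0 < alpha0)
  (lam_adm : forall omega, admissible_penalty (x^~ omega) (lam^~ omega))
  (Gamma_out : forall omega,
     sparse_recovery_output alpha0 (diag_mx b) (x^~ omega) (u^~ omega)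
       (lam^~ omega) (Gamma^~ omega)) :
  exists Omega0 : set T,
    [/\ measurable Omega0, P Omega0 = 1%E &
      forall omega, Omega0 omega ->
        (fnorm (G_part (Gamma n.+1 omega) - G) @[n --> \oo] --> (0 : R)) /\
        exists n0 : nat, forall n, (n0 <= n)%N ->
          mxsupport (G_part (Gamma n.+1 omega)) = mxsupport G].
Proof.
case: N => [|N'] in G alpha b u0 x u v w Gamma G_diag G_stable b_bin GB_ctrl w_meas
  w_id w_mean w_bnd eps_lt v_meas v_gauss u_init u_def wv_indep x_init x_rec lam_adm
  Gamma_out *; last first.
  apply: full_measure_subset.
  exact: (recovery_ae G_stable GB_ctrl w_meas w_mean Cw_gt0 w_bnd eps_ge0 eps_lt
    v_meas v_gauss u_init u_def wv_indep x_rec alpha0_gt0 lam_adm Gamma_out).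
(* Without coordinates there is nothing to estimate. *)
exists setT; split=> [||omega _]; [exact: measurableT | exact: probability_setT |].
have G_eq n : G_part (Gamma n.+1 omega) = G by apply/matrixP => -[].
split; last by exists 0%N => n _; rewrite G_eq.
rewrite (_ : (fun _ => _) = fun=> 0); first exact: cvg_cst.
by apply/funext => n; rewrite G_eq subrr fnormE sqn0 sqrtr0.
Qed.
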